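(* Let $\{x_i\}_{i\in I}\subset\mathbb{R}^d$ be a set of $N=\#I$ points satisfying the intrinsic dimension condition with dimension $\tilde d$ and constant $C_{\tilde d}$. Let $\Theta\in\mathbb{R}^{I\times I}$, $\Theta_{ij}=G(x_i,x_j)$, be a positive-definite kernel matrix, let $\prec$ be a reverse $r$-maximin ordering of the points ($r\in(0,1]$) with length scales $\ell=(\ell_i)_{i\in I}$, and let $\rho>0$ and $\lambda>1$. Let $L^\rho$ denote the KL-minimizing factor for the sparsity pattern under consideration. (1) Using the sparsity pattern $S_{\prec,\ell,\rho}$, the non-aggregated algorithm computes $L^\rho$ in complexity $CN\rho^{\tilde d}$ in space and $CN\rho^{3\tilde d}$ in time. (2) If in addition $\{x_i\}_{i\in I}$ fulfills the regular refinement condition for $\lambda$ and $\ell$ with constant $C_{\lambda,\ell}$, then, using the pattern $\tilde S_{\prec,\ell,\rho,\lambda}$ or $\bar S_{\prec,\ell,\rho,\lambda}$, the aggregated algorithm computes $L^\rho$ in complexity $CN\rho^{\tilde d}$ in space and $C_{\lambda,\ell}\,CN\rho^{2\tilde d}$ in time. Here the constant $C$ depends only on $C_{\tilde d}$, $\tilde d$, $r$, $\lambda$ and the maximal cost of evaluating a single entry of $\Theta$, but not on $N$ or $d$.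
   Context: $\operatorname{dist}$ is Euclidean distance. $\partial\Omega$ is a given, possibly empty, set (the boundary of a domain $\Omega$ containing the points); the distance to the empty set is $+\infty$. Reverse $r$-maximin ordering: a total (elimination) order $\prec$ on $I$ is reverse $r$-maximin with length scales $\{\ell_i\}$ if for every $j\in I$, $$\ell_j:=\operatorname{dist}(x_j,\{x_i:i\succ j\}\cup\partial\Omega)\ \ge\ r\max_{k\prec j}\operatorname{dist}(x_k,\{x_i:i\succ j\}\cup\partial\Omega).$$ All matrices have rows and columns ordered by $\prec$. Intrinsic dimension condition: there is a constant $C_{\tilde d}$, independent of $N$, such that for all $0<r'\le R$ and $x\in\mathbb{R}^d$, every $A\subset I$ with $\operatorname{dist}(x_i,x)\le R$ for all $i\in A$ and $\operatorname{dist}(x_i,x_j)\ge r'$ for all distinct $i,j\in A$ satisfies $|A|\le C_{\tilde d}(R/r')^{\tilde d}$. Regular refinement condition for $\lambda$ and $\ell$ with constant $C_{\lambda,\ell}$: with $\ell_1$ the length scale of the first index w.r.t. $\prec$, $\sum_{k=\lfloor\log(\ell_1)/\log(\lambda)\rfloor}^{\infty}\#\{i:\lambda^k\le\ell_i\}\le C_{\lambda,\ell}N$. Sparsity pattern: $S_{\prec,\ell,\rho}=\{(i,j): i\succeq j,\ \operatorname{dist}(x_i,x_j)\le\rho\ell_j\}$, with column sets $s_j=\{i:(i,j)\in S_{\prec,\ell,\rho}\}$. Supernodes: repeatedly pick the first index $i$ (w.r.t. $\prec$) not yet aggregated and put into a common supernode all not yet aggregated indices of $\{j: (j,i)\in S_{\prec,\ell,\rho},\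 \ell_j\le\lambda\ell_i\}$, until all indices are aggregated. $\tilde I$ is the set of supernodes, $i\leadsto\tilde i$ means $i$ was aggregated into $\tilde i$, and each supernode $\tilde i$ is identified with the first index (w.r.t. $\prec$) aggregated into it. Let $s_{\tilde k}=\bigcup_{k\leadsto\tilde k}s_k$ and $$\tilde S_{\prec,\ell,\rho,\lambda}=\bigcup_{\tilde k\in\tilde I}\{(i,k): k\leadsto\tilde k,\ k\preceq i\in s_{\tilde k}\},$$ $$\bar S_{\prec,\ell,\rho,\lambda}=\bigcup_{\tilde k\in\tilde I}\{(i,k): k\leadsto\tilde k,\ k\preceq i,\ \operatorname{dist}(x_{\tilde k},x_i)\le\rho(1+\lambda)\ell_{\tilde k}\}.$$ KL-minimizing factor for a pattern $S$: the lower-triangular matrix $L$ with nonzeros in $S$ minimizing the Kullback-Leibler divergence $\mathbb{D}_{\mathrm{KL}}(\mathcal{N}(0,\Theta)\|\mathcal{N}(0,(LL^\top)^{-1}))$ between centered Gaussians, computed by the column formula $L_{s_k,k}=\Theta_{s_k,s_k}^{-1}\mathbf{e}_1/\sqrt{\mathbf{e}_1^\top\Theta_{s_k,s_k}^{-1}\mathbf{e}_1}$, where $s_k$ is the column set of $k$ in $S$ listed in the order $\prec$, $\Theta_{s_k,s_k}$ is the corresponding submatrix (restricted before inversion), and $\mathbf{e}_1$ is the first unit vector. Non-aggregated algorithm (input: $G$, points, $\prec$, pattern): for every $k\in I$, form $\Theta_{s_k,s_k}$ by evaluating $G$, compute $v=\Theta_{s_k,s_k}^{-1}\mathbf{e}_1$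 by dense Cholesky factorization, and set $L_{s_k,k}=v/\sqrt{v_1}$. Aggregated algorithm (input: $G$, points, $\prec$, aggregated pattern): for every supernode $\tilde k$, with $s_{\tilde k}$ the set of all row indices occurring in the columns $k\leadsto\tilde k$ of the pattern, form $\Theta_{s_{\tilde k},s_{\tilde k}}$ by evaluating $G$, compute by one dense (order-reversed) Cholesky factorization the upper triangular $U$ with $\Theta_{s_{\tilde k},s_{\tilde k}}=UU^\top$, and for each $k\leadsto\tilde k$ set the $k$-th column of $L$ equal to $U^{-\top}\mathbf{e}_k$, where $\mathbf{e}_k$ is the unit vector at index $k$.
   Formalization: In the bounds ρ is replaced by max(1,ρ) and C_{λ,ℓ} by max(1,C_{λ,ℓ}), since the stated bounds fail as ρ→0 or when C_{λ,ℓ}=1/N (cost is at least N); regular refinement counts only indices with finite length scale, which is a weaker hypothesis. *)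

(* Defs.v *)
From HB Require Import structures.
From mathcomp Require Import all_boot all_order all_algebra.
From mathcomp Require Import all_classical all_reals all_analysis.

Set Implicit Arguments.
Unset Strict Implicit.
Unset Printing Implicit Defensive.

Import Order.TTheory GRing.Theory Num.Theory.
Import numFieldTopology.Exports.

Local Open Scope ring_scope.

(* The norm that MathComp-Analysis puts on ['rV[R]_d] is the sup norm, hence a
   separate definition of the Euclidean distance. *)
Definition edist (R : realType) (d : nat) (y z : 'rV[R]_d) : R :=
  Num.sqrt (\sum_(t < d) (y ord0 t - z ord0 t) ^+ 2).

(* [ereal_inf set0 = +oo], the convention for the distance to the empty set. *)
Definition dist_set (R : realType) (d : nat) (y : 'rV[R]_d)
    (A : set 'rV[R]_d) : \bar R :=
  ereal_inf [set (edist y z)%:E | z in A]%classic.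

Definition frontier (T : topologicalType) (A : set T) : set T :=
  (closure A `\` interior A)%classic.

Definition intrinsic_dimension (R : realType) (d N : nat)
    (x : 'I_N -> 'rV[R]_d) (dt Cd : R) : Prop :=
  forall (r' R' : R) (y : 'rV[R]_d) (A : {set 'I_N}),
    0 < r' -> r' <= R' ->
    (forall i, i \in A -> edist (x i) y <= R') ->
    (forall i j, i \in A -> j \in A -> i != j -> r' <= edist (x i) (x j)) ->
    #|A|%:R <= Cd * (R' / r') `^ dt.

Definition strict_total_order (T : eqType) (prec : rel T) : Prop :=
  [/\ irreflexive prec, transitive prec
    & forall i j, i != j -> prec i j || prec j i].

Definition preceq (T : eqType) (prec : rel T) : rel T :=
  fun i j => (i == j) || prec i j.

Definition listing (N : nat) (prec : rel 'I_N) (A : {set 'I_N}) : seq 'I_N :=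
  sort (preceq prec) (enum A).

Definition after (R : realType) (d N : nat) (prec : rel 'I_N)
    (x : 'I_N -> 'rV[R]_d) (bd : set 'rV[R]_d) (j : 'I_N) : set 'rV[R]_d :=
  ([set x i | i in [set i | prec j i]] `|` bd)%classic.

Definition reverse_maximin (R : realType) (d N : nat) (r : R)
    (prec : rel 'I_N) (x : 'I_N -> 'rV[R]_d) (bd : set 'rV[R]_d)
    (l : 'I_N -> \bar R) : Prop :=
  forall j, l j = dist_set (x j) (after prec x bd j) /\
    (r%:E * \big[maxe/0]_(k | prec k j) dist_set (x k) (after prec x bd j)
       <= l j)%E.

(* If the boundary is empty, the last index has length scale [+oo]. It would
   then contribute to every term and make the series diverge, so only the
   indices with finite length scale are counted. This changes nothing when the
   boundary is nonempty, and in general it only weakens the condition. *)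
Definition regular_refinement (R : realType) (N : nat) (prec : rel 'I_N)
    (l : 'I_N -> \bar R) (lambda Clam : R) : Prop :=
  forall i1 : 'I_N, (forall i, i != i1 -> prec i1 i) ->
    let k1 : int := Num.floor (ln (fine (l i1)) / ln lambda) in
    (\sum_(0 <= m <oo)
       #|[set i : 'I_N | ((lambda ^ (k1 + m%:Z))%:E <= l i < +oo)%E]|%:R%:E
     <= (Clam * N%:R)%:E)%E.

Definition pattern (R : realType) (d N : nat) (prec : rel 'I_N)
    (x : 'I_N -> 'rV[R]_d) (l : 'I_N -> \bar R) (rho : R) :
    {set 'I_N * 'I_N} :=
  [set p | preceq prec p.2 p.1 &&
           ((edist (x p.1) (x p.2))%:E <= rho%:E * l p.2)%E].

Definition column (N : nat) (S : {set 'I_N * 'I_N}) (k : 'I_N) : {set 'I_N} :=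
  [set i | (i, k) \in S].

(* [todo] is the list, sorted by [prec], of the indices not yet aggregated.
   A supernode is the pair of its first index and of the list of its members.
   As every pass removes at least one index, [n := size todo] passes are
   enough. *)
Fixpoint aggregate (R : realType) (N : nat) (S : {set 'I_N * 'I_N})
    (l : 'I_N -> \bar R) (lambda : R) (n : nat) (todo : seq 'I_N) :
    seq ('I_N * seq 'I_N) :=
  match n, todo with
  | n'.+1, i :: _ =>
      let near := fun j => ((j, i) \in S) && (l j <= lambda%:E * l i)%E in
      (i, [seq j <- todo | near j])
        :: aggregate S l lambda n' [seq j <- todo | ~~ near j]
  | _, _ => [::]
  end.

Definition supernodes (R : realType) (d N : nat) (prec : rel 'I_N)
    (x : 'I_N -> 'rV[R]_d) (l : 'I_N -> \bar R) (rho lambda : R) :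
    seq ('I_N * seq 'I_N) :=
  aggregate (pattern prec x l rho) l lambda N (listing prec [set: 'I_N]).

Definition rows (N : nat) (S : {set 'I_N * 'I_N}) (K : 'I_N * seq 'I_N) :
    {set 'I_N} :=
  \bigcup_(k in K.2) column S k.

Definition pattern_tilde (R : realType) (d N : nat) (prec : rel 'I_N)
    (x : 'I_N -> 'rV[R]_d) (l : 'I_N -> \bar R) (rho lambda : R) :
    {set 'I_N * 'I_N} :=
  \bigcup_(K <- supernodes prec x l rho lambda)
    [set p | [&& p.2 \in K.2, preceq prec p.2 p.1
               & p.1 \in rows (pattern prec x l rho) K]].

Definition pattern_bar (R : realType) (d N : nat) (prec : rel 'I_N)
    (x : 'I_N -> 'rV[R]_d) (l : 'I_N -> \bar R) (rho lambda : R) :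
    {set 'I_N * 'I_N} :=
  \bigcup_(K <- supernodes prec x l rho lambda)
    [set p | [&& p.2 \in K.2, preceq prec p.2 p.1
               & ((edist (x K.1) (x p.1))%:E
                    <= (rho * (1 + lambda))%:E * l K.1)%E]].

Definition kernel_mx (R : realType) (d N : nat)
    (G : 'rV[R]_d -> 'rV[R]_d -> R) (x : 'I_N -> 'rV[R]_d) : 'M[R]_N :=
  \matrix_(i, j) G (x i) (x j).

Definition positive_definite (R : realType) (n : nat) (A : 'M[R]_n) : Prop :=
  A^T = A /\ forall v : 'rV[R]_n, v != 0 -> 0 < (v *m A *m v^T) ord0 ord0.

(* Lebesgue integral over R^n, one coordinate after the other (the library has
   no Lebesgue measure on R^n). *)
Fixpoint integral_Rn (R : realType) (n : nat) :
    ('rV[R]_n -> \bar R) -> \bar R :=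
  match n with
  | 0 => fun f => f 0
  | n'.+1 => fun f =>
      (\int[@lebesgue_measure R]_t
         integral_Rn (fun v : 'rV[R]_n' => f (row_mx t%:M v)))%E
  end.

Definition gaussian_pdf (R : realType) (n : nat) (Sigma : 'M[R]_n)
    (v : 'rV[R]_n) : R :=
  expR (- (v *m invmx Sigma *m v^T) ord0 ord0 / 2) /
  Num.sqrt ((2 * pi) ^+ n * \det Sigma).

Definition KL_gaussian (R : realType) (n : nat) (Sigma1 Sigma2 : 'M[R]_n) :
    \bar R :=
  integral_Rn (fun v : 'rV[R]_n =>
    (gaussian_pdf Sigma1 v *
     ln (gaussian_pdf Sigma1 v / gaussian_pdf Sigma2 v))%:E).

(* "Lower-triangular" refers to [prec]; [L *m L^T] has to be invertible for
   N(0, (L L^T)^-1) to make sense. *)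
Definition sparse_factor (R : realType) (N : nat) (prec : rel 'I_N)
    (S : {set 'I_N * 'I_N}) (L : 'M[R]_N) : Prop :=
  [/\ forall i k, prec i k -> L i k = 0,
      forall i k, (i, k) \notin S -> L i k = 0
    & L *m L^T \in unitmx].

Definition KL_minimizer (R : realType) (N : nat) (prec : rel 'I_N)
    (S : {set 'I_N * 'I_N}) (Theta L : 'M[R]_N) : Prop :=
  sparse_factor prec S L /\
  forall M : 'M[R]_N, sparse_factor prec S M ->
    (KL_gaussian Theta (invmx (L *m L^T))
       <= KL_gaussian Theta (invmx (M *m M^T)))%E.

Definition submx_on (R : realType) (N : nat) (Theta : 'M[R]_N)
    (s : seq 'I_N) : 'M[R]_(size s) :=
  \matrix_(a, b) Theta (tnth (in_tuple s) a) (tnth (in_tuple s) b).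

(* Column formula. The minimizer is only unique up to the signs of its columns;
   the formula selects the one with positive diagonal. [insub (index i s)] is
   the position of [i] in [s], and [None] if [i] does not occur in [s]. *)
Definition KL_factor (R : realType) (N : nat) (prec : rel 'I_N)
    (S : {set 'I_N * 'I_N}) (Theta : 'M[R]_N) : 'M[R]_N :=
  \matrix_(i, k)
    let s := listing prec (column S k) in
    let e1 : 'cV[R]_(size s) := \col_a ((a : nat) == 0%N)%:R in
    let v := invmx (submx_on Theta s) *m e1 in
    if insub (index i s) is Some a
    then v a ord0 / Num.sqrt ((e1^T *m v) ord0 ord0)
    else 0.

(* [Out i k] stores the entry (i, k) of the sparse output, the other cells are
   working memory: a matrix, a vector and a scalar. *)
Inductive cell (I : Type) : Type :=
  Out of I & I | Mat of nat & nat | Vec of nat | Tmp.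
Arguments Mat {I}.
Arguments Vec {I}.
Arguments Tmp {I}.

Definition cell_code (I : Type) (c : cell I) : I * I + nat * nat + option nat :=
  match c with
  | Out i k => inl (inl (i, k))
  | Mat a b => inl (inr (a, b))
  | Vec a => inr (Some a)
  | Tmp => inr None
  end.

Definition cell_decode (I : Type) (c : I * I + nat * nat + option nat) :
    cell I :=
  match c with
  | inl (inl (i, k)) => Out i k
  | inl (inr (a, b)) => Mat a b
  | inr (Some a) => Vec a
  | inr None => Tmp
  end.

Lemma cell_codeK (I : Type) : cancel (@cell_code I) (@cell_decode I).
Proof. by case. Qed.

HB.instance Definition _ (I : eqType) :=
  Equality.copy (cell I) (can_type (@cell_codeK I)).

(* The first argument is the destination. *)
Inductive instr (I : Type) : Type :=
| iEval of cell I & I & I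
| iBit of cell I & bool
| iSub of cell I & cell I & cell I
| iMul of cell I & cell I & cell I
| iDiv of cell I & cell I & cell I
| iSqrt of cell I & cell I.

Definition memory (R I : Type) := cell I -> R.

Definition write (R : Type) (I : eqType) (m : memory R I) (c : cell I) (v : R) :
    memory R I :=
  fun c' => if c' == c then v else m c'.

(* [ev i j] is the value returned by the evaluation of the entry (i, j). *)
Definition step (R : realType) (I : eqType) (ev : I -> I -> R)
    (m : memory R I) (o : instr I) : memory R I :=
  match o with
  | iEval c i j => write m c (ev i j)
  | iBit c b => write m c b%:R
  | iSub c c1 c2 => write m c (m c1 - m c2)
  | iMul c c1 c2 => write m c (m c1 * m c2)
  | iDiv c c1 c2 => write m c (m c1 / m c2)
  | iSqrt c c1 => write m c (Num.sqrt (m c1))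
  end.

Definition run (R : realType) (I : eqType) (ev : I -> I -> R)
    (p : seq (instr I)) (m : memory R I) : memory R I :=
  foldl (step ev) m p.

(* [cost i j] is the cost of evaluating the entry (i, j); storing the result
   and every other instruction cost 1. *)
Definition instr_time (I : Type) (cost : I -> I -> nat) (o : instr I) : nat :=
  if o is iEval _ i j then (cost i j).+1 else 1%N.

Definition time_cost (I : Type) (cost : I -> I -> nat) (p : seq (instr I)) : nat :=
  sumn (map (instr_time cost) p).

Definition instr_cells (I : Type) (o : instr I) : seq (cell I) :=
  match o with
  | iEval c _ _ | iBit c _ => [:: c]
  | iSub c c1 c2 | iMul c c1 c2 | iDiv c c1 c2 => [:: c; c1; c2]
  | iSqrt c c1 => [:: c; c1]
  end.

(* Number of distinct memory cells used, for the output and as working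
   memory. *)
Definition space_cost (I : eqType) (p : seq (instr I)) : nat :=
  size (undup (flatten (map (@instr_cells I) p))).

Definition output (R : realType) (N : nat) (S : {set 'I_N * 'I_N})
    (m : memory R 'I_N) : 'M[R]_N :=
  \matrix_(i, k) if (i, k) \in S then m (Out i k) else 0.

(* The loops are unrolled: an algorithm maps the ordering and the pattern to a
   list of instructions, without access to the values in memory. *)

Definition submul (I : Type) (c c1 c2 : cell I) : seq (instr I) :=
  [:: iMul Tmp c1 c2; iSub c c Tmp].

Definition load (I : Type) (i0 : I) (s : seq I) : seq (instr I) :=
  [seq iEval (Mat a b) (nth i0 s a) (nth i0 s b)
     | a <- iota 0 (size s), b <- iota 0 (size s)].

(* Replaces the lower triangle of the [n] x [n] matrix stored in the cells
   [A a b] by its lower triangular Cholesky factor. *)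
Definition cholesky (I : Type) (n : nat) (A : nat -> nat -> cell I) :
    seq (instr I) :=
  flatten [seq
    flatten [seq submul (A b b) (A b t) (A b t) | t <- iota 0 b]
    ++ iSqrt (A b b) (A b b)
    :: flatten [seq
         flatten [seq submul (A a b) (A a t) (A b t) | t <- iota 0 b]
         ++ [:: iDiv (A a b) (A a b) (A b b)]
       | a <- iota b.+1 (n - b.+1)]
  | b <- iota 0 n].

(* y := A^-1 e_q for [A] lower triangular; the entries of [y] before [q] vanish
   and are not stored. *)
Definition forward_subst (I : Type) (n : nat) (A : nat -> nat -> cell I)
    (y : nat -> cell I) (q : nat) : seq (instr I) :=
  flatten [seq
    iBit (y a) (a == q)
    :: flatten [seq submul (y a) (A a t) (y t) | t <- iota q (a - q)]
    ++ [:: iDiv (y a) (y a) (A a a)]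
  | a <- iota q (n - q)].

(* y := A^-T y for [A] lower triangular *)
Definition backward_subst (I : Type) (n : nat) (A : nat -> nat -> cell I)
    (y : nat -> cell I) : seq (instr I) :=
  flatten [seq
    flatten [seq submul (y a) (A t a) (y t) | t <- iota a.+1 (n - a.+1)]
    ++ [:: iDiv (y a) (y a) (A a a)]
  | a <- rev (iota 0 n)].

Definition column_program (I : Type) (k : I) (s : seq I) : seq (instr I) :=
  let n := size s in
  load k s
  ++ cholesky n Mat
  ++ forward_subst n Mat Vec 0
  ++ backward_subst n Mat Vec
  ++ iSqrt Tmp (Vec 0)
  :: [seq iDiv (Out (nth k s a) k) (Vec a) Tmp | a <- iota 0 n].

Definition non_aggregated (N : nat) (prec : rel 'I_N)
    (S : {set 'I_N * 'I_N}) : seq (instr 'I_N) :=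
  flatten [seq column_program k (listing prec (column S k)) | k <- enum 'I_N].

(* Cholesky factorization of the matrix with reversed rows and columns leaves
   in the cells [Mat a b], a <= b, the upper triangular U with
   Theta_{s,s} = U U^T. *)
Definition supernode_program (I : eqType) (k1 : I) (ks s : seq I) :
    seq (instr I) :=
  let n := size s in
  load k1 s
  ++ cholesky n (fun a b => Mat (n.-1 - a) (n.-1 - b))
  ++ flatten [seq
       forward_subst n (fun a b => Mat b a) (fun a => Out (nth k1 s a) k)
         (index k s)
     | k <- ks].

Definition aggregated (N : nat) (prec : rel 'I_N)
    (nodes : seq ('I_N * seq 'I_N)) (S : {set 'I_N * 'I_N}) :
    seq (instr 'I_N) :=
  flatten [seq supernode_program K.1 K.2 (listing prec (rows S K))
          | K <- nodes].

Definition computes_KL_factor (R : realType) (d N : nat) (prec : rel 'I_N)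
    (S : {set 'I_N * 'I_N}) (G : 'rV[R]_d -> 'rV[R]_d -> R)
    (x : 'I_N -> 'rV[R]_d) (p : seq (instr 'I_N)) : Prop :=
  let L := KL_factor prec S (kernel_mx G x) in
  KL_minimizer prec S (kernel_mx G x) L /\
  forall m : memory R 'I_N,
    output S (run (fun i j => G (x i) (x j)) p m) = L.

(* Main.v *)
From mathcomp Require Import all_boot all_order all_algebra.
From mathcomp Require Import all_classical all_reals all_analysis.
From mathcomp Require Import fingroup perm measurable_realfun normal_distribution.
From mathcomp Require Import ring lra zify.
Require Import Defs.

(** The statement has three parts that are proved independently: the column
    formula gives a minimizer of the divergence, the two straight-line programs
    compute this minimizer exactly, and their cost is as announced.

    Minimizer.  For a precision matrix P = L L^T the divergence of N(0, Theta)
    from N(0, P^-1) is (tr (P Theta) - N - ln det P - ln det Theta) / 2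
    ([KL_gaussian_precision]).  The integral over R^n being iterated, it is
    evaluated one coordinate at a time: a Schur complement ([pd_schur]) completes
    the square in the first coordinate, and what remains there is a Gaussian
    integral of a quadratic polynomial on the line.  When L is triangular for the
    ordering, det P is the product of the squares of the diagonal of L and the
    divergence becomes a sum over the columns u of L of u Theta u^T / 2 - ln |u_k|
    ([KL_triangular]).  The columns are thus minimized separately, by the
    Cauchy-Schwarz inequality for the form Theta ([kl_column_opt]).  The minimizer
    u on the column set s is characterized by u_k > 0 and Theta u = e_k / u_k on s
    ([kl_column]), which determines it ([kl_column_unique]).

    Exactness.  It is enough to see that the outputs of the programs satisfy this
    characterization.  The Cholesky factor exists ([cholesky_exists]); loop
    invariants show that the programs compute it and solve the triangular systems
    ([run_cholesky], [run_forward], [run_backward]).  For a supernode, the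
    restriction of U U^T to the positions from the one of k on only involves the
    lower right block of U, which is why a single factorization serves all the
    columns of the supernode.

    Cost.  Length scales nearly increase along the ordering: l_j >= r l_i for i
    before j ([scale_mono]).  Hence the points from k on are r l_k-separated, and
    the intrinsic dimension bounds a column, or the rows of a supernode, by
    M = O(max(1, rho)^dt) ([ball_card]).  As n rows cost O(n^3) operations and,
    besides the output, O(n^2) cells of reusable memory, with n <= N, this gives
    the first claim and the space bound of the second.  For the time of the second,
    the sum of n^3 over the supernodes is at most M^2 times the sum of n, and the
    latter is O(N): the leaders of the supernodes whose length scale is about
    lambda^k are rho lambda^k-separated, so that a point is a row of boundedly many
    of them ([leaders_at_level]), while the regular refinement bounds the sum over k
    of the number of points that are rows of some supernode of level k
    ([sum_at_least], [sum_rows]). *)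

Set Implicit Arguments.
Unset Strict Implicit.
Unset Printing Implicit Defensive.

Import Order.TTheory GRing.Theory Num.Theory.
Import numFieldTopology.Exports.

Local Open Scope ring_scope.

(** * Gaussian moments on the line *)

Section GaussianLine.
Local Open Scope classical_set_scope.
Variable R : realType.
Local Notation mu := (@lebesgue_measure R).
Local Open Scope ereal_scope.

(** The integral over [-n, n] is F(n) - F(-n), and dominated convergence passes
    to the limit.  Applied to a polynomial of degree at most one times the Gaussian
    weight, this gives the first two moments without an integration by parts. *)
Lemma integral_derivative_line (F f : R -> R) :
  continuous f -> (forall x, is_derive x (1 : R)%R F (f x)) ->
  mu.-integrable setT (EFin \o f) ->
  F (n%:R)%R @[n --> \oo] --> (0 : R)%R ->
  F (- n%:R)%R @[n --> \oo] --> (0 : R)%R ->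
  \int[mu]_x (f x)%:E = 0.
Proof.
move=> cf dF intf Fy FNy.
pose A (n : nat) : set (measurableTypeR R) := `[(- n%:R)%R, (n%:R : R)%R]%classic.
pose f_ (n : nat) : measurableTypeR R -> \bar R := (EFin \o f) \_ (A n).
have mA n : measurable (A n) by exact: measurable_itv.
have /integrableP[mf _] := intf.
have cF : continuous F.
  move=> x; apply/differentiable_continuous/derivable1_diffP.
  exact: (@ex_derive _ _ _ _ _ _ _ (dF x)).
have mf_ n : measurable_fun setT (f_ n).
  have /(measurable_restrictT _ (mA n)) := measurable_funTS (D := A n) mf.
  exact.
have [|||_ _] := @dominated_convergence _ _ _ mu setT measurableT f_ (EFin \o f)
  (fun x => `|(f x)%:E|) mf_ mf _ _ _.
- apply: aeW => x _; apply: cvg_near_cst; near=> n.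
  rewrite /f_ patchE ifT// in_setE /A/= in_itv/= -ler_norml.
  by near: n; exact: nbhs_infty_ger.
- exact: integrable_abse.
- apply: aeW => x n _; rewrite /f_ patchE; case: ifP => _ //=.
  by rewrite normr0 lee_fin.
move=> /cvg_lim <- //; apply/cvg_lim => //.
apply: (@cvg_trans _ ((F n%:R - F (- n%:R))%:E @[n --> \oo])); last first.
  apply: cvg_EFin; first by near=> n.
  rewrite -[X in _ --> X](subr0 (0:R)%R); exact: cvgB.
apply: near_eq_cvg; near=> n => /=.
have n0 : (- n%:R < n%:R :> R)%R.
  have : (0 < n%:R :> R)%R by near: n; exact: nbhs_infty_gtr.
  lra.
rewrite /f_ -integral_mkcond (continuous_FTC2 n0 (F := F)) ?EFinB//.
- exact: continuous_subspaceT.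
- split.
  + by move=> x _; exact: (@ex_derive _ _ _ _ _ _ _ (dF x)).
  + exact/cvg_at_right_filter/cF.
  + exact/cvg_at_left_filter/cF.
- by move=> x _; rewrite derive1E; exact: derive_val.
Unshelve. all: by end_near. Qed.

Definition gauss_weight (s m t : R) : R := expR (- (s * (t - m) ^+ 2) / 2)%R.

Lemma gauss_weight_normal s m : (0 < s)%R ->
  gauss_weight s m = (fun t => Num.sqrt (2 * pi / s) * normal_pdf m (Num.sqrt s^-1) t)%R.
Proof.
move=> s0; apply/funext => t.
have sn0 : Num.sqrt s^-1 != 0%R by rewrite sqrtr_eq0 -ltNge invr_gt0.
rewrite normal_pdfE// /normal_peak /normal_fun sqr_sqrtr ?invr_ge0 ?ltW//.
rewrite mulrA (_ : (s^-1 * pi *+ 2 = 2 * pi / s)%R); last by ring.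
rewrite mulfV ?mul1r; last first.
  by rewrite sqrtr_eq0 -ltNge divr_gt0 ?mulr_gt0 ?pi_gt0.
congr expR; field; exact: lt0r_neq0.
Qed.

Lemma integrable_gauss_weight s m : (0 < s)%R ->
  mu.-integrable setT (EFin \o gauss_weight s m).
Proof.
move=> s0; rewrite gauss_weight_normal//.
have := integrableZl measurableT (Num.sqrt (2 * pi / s)) (integrable_normal_pdf m (Num.sqrt s^-1)).
by apply: eq_integrable => // x _; rewrite /= EFinM.
Qed.

Lemma integral_gauss_weight s m : (0 < s)%R ->
  \int[mu]_t (gauss_weight s m t)%:E = (Num.sqrt (2 * pi / s))%:E.
Proof.
move=> s0; rewrite gauss_weight_normal//.
under eq_integral do rewrite EFinM.
rewrite integralZl//; last exact: integrable_normal_pdf.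
by rewrite integral_normal_pdf mule1.
Qed.

Lemma is_derive_gauss_weight s m x :
  is_derive x (1 : R)%R (gauss_weight s m) (- s * (x - m) * gauss_weight s m x)%R.
Proof.
rewrite /gauss_weight; apply: is_derive_eq.
rewrite !scaler0 !subr0 add0r /GRing.scale/=.
by field.
Qed.

Lemma continuous_gauss_weight s m : continuous (gauss_weight s m).
Proof.
move=> x; apply/differentiable_continuous/derivable1_diffP.
exact: (@ex_derive _ _ _ _ _ _ _ (is_derive_gauss_weight s m x)).
Qed.

Lemma gauss_weight_gt0 s m t : (0 < gauss_weight s m t)%R.
Proof. exact: expR_gt0. Qed.

(** The weight is the square of the one with half the precision, one factor of
    which absorbs the quadratic term because z <= exp z.  This gives both the
    integrability of the moments and the decay at infinity. *)
Lemma sqr_gauss_weight_le s m t : (0 < s)%R ->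
  ((t - m) ^+ 2 * gauss_weight s m t <= 4 / s * gauss_weight (s / 2) m t)%R.
Proof.
move=> s0; set z := (s / 4 * (t - m) ^+ 2)%R.
have -> : gauss_weight s m t = (expR (- z) * gauss_weight (s / 2) m t)%R.
  by rewrite /gauss_weight -expRD /z; congr expR; field.
rewrite mulrA ler_pM2r ?gauss_weight_gt0// expRN ler_pdivrMr ?expR_gt0//.
have -> : ((t - m) ^+ 2 = 4 / s * z)%R by rewrite /z; field; exact: lt0r_neq0.
by rewrite ler_pM2l ?divr_gt0//; have := expR_ge1Dx z; lra.
Qed.

Lemma integrable_gauss_moment2 s m : (0 < s)%R ->
  mu.-integrable setT (EFin \o (fun t => (t - m) ^+ 2 * gauss_weight s m t)%R).
Proof.
move=> s0; have s20 : (0 < s / 2)%R by rewrite divr_gt0.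
apply: le_integrable (integrableZl measurableT (4 / s)%R (integrable_gauss_weight m s20)) => //.
  apply/measurable_EFinP; apply: continuous_measurable_fun => x.
  apply: cvgM; last exact: continuous_gauss_weight.
  apply: (cvg_comp (fun x => x - m)%R (fun x => x ^+ 2)%R).
    by apply: (@cvgB _ R^o) => //; [exact: cvg_id|exact: cvg_cst].
  exact: sqr_continuous.
move=> x _ /=; rewrite lee_fin ger0_norm; last by apply: mulr_ge0; [exact: sqr_ge0|exact: expR_ge0].
apply: le_trans (ler_norm _).
exact: sqr_gauss_weight_le.
Qed.

Lemma integrable_gauss_moment1 s m : (0 < s)%R ->
  mu.-integrable setT (EFin \o (fun t => (t - m) * gauss_weight s m t)%R).
Proof.
move=> s0.
apply: le_integrable (integrableD measurableT (integrable_gauss_weight m s0)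
  (integrable_gauss_moment2 m s0)) => //.
  apply/measurable_EFinP; apply: continuous_measurable_fun => x.
  apply: cvgM; last exact: continuous_gauss_weight.
  by apply: (@cvgB _ R^o); [exact: cvg_id|exact: cvg_cst].
move=> x _ /=; rewrite lee_fin; apply: le_trans (ler_norm _).
have w0 := gauss_weight_gt0 s m x.
rewrite normrM (gtr0_norm w0).
rewrite -[X in (_ <= X + _)%R]mul1r -mulrDl ler_pM2r// -(real_normK (num_real (x - m)%R)).
have := sqr_ge0 (`|x - m| - 1)%R; have := normr_ge0 (x - m)%R; nra.
Qed.

Lemma cvg0_of_decay (G : R -> R) m K :
  (forall t, 1 <= `|t - m| -> `|G t| * `|t - m| <= K)%R ->
  G n%:R%R @[n --> \oo] --> (0 : R)%R /\ G (- n%:R)%R @[n --> \oo] --> (0 : R)%R.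
Proof.
move=> HG.
have H (e : R) t : (0 < e -> 1 + `|K| / e <= `|t - m| -> `|G t| < e)%R.
  move=> e0 ht.
  have t1 : (1 <= `|t - m|)%R by rewrite (le_trans _ ht)// lerDl divr_ge0// ltW.
  have t0 : (0 < `|t - m|)%R by exact: lt_le_trans t1.
  rewrite -(ltr_pM2r t0); apply: le_lt_trans (HG _ t1) _.
  apply: (le_lt_trans (ler_norm _)); rewrite mulrC -ltr_pdivrMr//.
  by rewrite (lt_le_trans _ ht)// ltrDr.
split; apply/cvgrPdist_lt => e e0; near=> n; rewrite sub0r normrN; apply: H => //.
  have : (`|m| + (1 + `|K| / e) <= n%:R)%R by near: n; exact: nbhs_infty_ger.
  rewrite -lerBrDl => /le_trans; apply; rewrite lerBlDr.
  apply: le_trans (ler_normD _ _); rewrite subrK; exact: ler_norm.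
have : (`|m| + (1 + `|K| / e) <= n%:R)%R by near: n; exact: nbhs_infty_ger.
rewrite -lerBrDl => /le_trans; apply; rewrite lerBlDr -opprD normrN.
rewrite -[leLHS](addrK m); exact: le_trans (ler_norm _) (ler_normB _ _).
Unshelve. all: by end_near. Qed.

(** Holds for every polynomial factor of degree one, which covers the two
    antiderivatives used for the first and the second moment. *)
Lemma gauss_decay s m (a b : R) : (0 < s)%R ->
  exists K, forall t, (1 <= `|t - m| ->
    `|(a + b * (t - m)) * gauss_weight s m t| * `|t - m| <= K)%R.
Proof.
move=> s0; exists ((`|a| + `|b|) * (4 / s))%R => t t1.
have w0 := gauss_weight_gt0 s m t.
have t0 : (0 < `|t - m|)%R by exact: lt_le_trans t1.
rewrite normrM (gtr0_norm w0).
apply: (@le_trans _ _ ((`|a| + `|b|) * ((t - m) ^+ 2 * gauss_weight s m t)))%R.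
  rewrite mulrAC -(real_normK (num_real (t - m)%R)) mulrA ler_pM2r// expr2 mulrA ler_pM2r//.
  apply: (le_trans (ler_normD _ _)); rewrite normrM mulrDl lerD2r.
  by rewrite ler_peMr.
rewrite ler_wpM2l ?addr_ge0//; apply: le_trans (sqr_gauss_weight_le _ _ s0) _.
rewrite ler_piMr ?divr_ge0 ?(ltW s0)// /gauss_weight -[leRHS]expR0 ler_expR mulNr oppr_le0.
by rewrite divr_ge0// mulr_ge0 ?sqr_ge0// divr_ge0// ltW.
Qed.

Lemma integral_gauss_moment1 s m : (0 < s)%R ->
  \int[mu]_t ((t - m) * gauss_weight s m t)%:E = 0.
Proof.
move=> s0; have [K HK] := gauss_decay m (- s^-1)%R 0%R s0.
have [Hy HNy] := cvg0_of_decay HK.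
apply: (@integral_derivative_line (fun t => (- s^-1 + 0 * (t - m)) * gauss_weight s m t)%R
  (fun t => (t - m) * gauss_weight s m t)%R) => //.
- move=> x; apply: cvgM; last exact: continuous_gauss_weight.
  by apply: (@cvgB _ R^o); [exact: cvg_id|exact: cvg_cst].
- move=> x; apply: is_derive_eq (is_deriveM _ (is_derive_gauss_weight s m x)) _.
  rewrite /GRing.scale/=; field; exact: lt0r_neq0.
- exact: integrable_gauss_moment1.
Qed.

Lemma integral_gauss_moment2 s m : (0 < s)%R ->
  \int[mu]_t ((t - m) ^+ 2 * gauss_weight s m t)%:E = (s^-1 * Num.sqrt (2 * pi / s))%:E.
Proof.
move=> s0; have [K HK] := gauss_decay m 0%R (- s^-1)%R s0.
(* (t - m)^2 w - w / s is the derivative of - (t - m) w / s. *)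
have [Hy HNy] := cvg0_of_decay HK.
pose f t : R := ((t - m) ^+ 2 * gauss_weight s m t + (- s^-1) * gauss_weight s m t)%R.
have cm : continuous (fun x : R => x - m)%R.
  by move=> x; apply: (@cvgB _ R^o); [exact: cvg_id|exact: cvg_cst].
have i1 := integrable_gauss_moment2 m s0.
have i2 := integrable_gauss_weight m s0.
have i3 := integrableZl measurableT (- s^-1)%R i2.
have : \int[mu]_t (f t)%:E = 0.
  apply: (@integral_derivative_line (fun t => (0 + (- s^-1) * (t - m)) * gauss_weight s m t)%R) => //.
  - move=> x; apply: cvgD; apply: cvgM; try exact: continuous_gauss_weight; last exact: cvg_cst.
    by apply: (cvg_comp (fun x => x - m)%R (fun x => x ^+ 2)%R); [exact: cm|exact: sqr_continuous].
  - move=> x; apply: is_derive_eq (is_deriveM _ (is_derive_gauss_weight s m x)) _.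
    rewrite /f /GRing.scale/=; field; exact: lt0r_neq0.
  - by apply: eq_integrable (integrableD measurableT i1 i3) => // x _; rewrite /f /= EFinD.
under eq_integral do rewrite EFinD.
rewrite integralD//.
under [X in _ + X]eq_integral do rewrite EFinM.
rewrite integralZl// integral_gauss_weight// -EFinM => /eqP.
by rewrite mulNr EFinN sube_eq ?add0e//; [move/eqP|exact: (integrable_fin_num measurableT i1)].
Qed.

(** One step of the iterated integral: the inner integrations leave a quadratic
    polynomial in the outer variable. *)
Lemma integral_gauss_quadratic s m (a b c : R) : (0 < s)%R ->
  \int[mu]_t (gauss_weight s m t * (a + b * (t - m) + c * (t - m) ^+ 2))%:E
  = (Num.sqrt (2 * pi / s) * (a + c / s))%:E.
Proof.
move=> s0.
have i0 := integrableZl measurableT a (integrable_gauss_weight m s0).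
have i1 := integrableZl measurableT b (integrable_gauss_moment1 m s0).
have i2 := integrableZl measurableT c (integrable_gauss_moment2 m s0).
under eq_integral => t _.
  rewrite (_ : _%:E = a%:E * (gauss_weight s m t)%:E + b%:E * ((t - m) * gauss_weight s m t)%:E
    + c%:E * ((t - m) ^+ 2 * gauss_weight s m t)%:E); last first.
    by rewrite -!EFinM -!EFinD; congr EFin; ring.
  over.
rewrite integralD//; last exact: integrableD.
rewrite integralD// !integralZl//; try exact: integrable_gauss_moment1;
  try exact: integrable_gauss_moment2; try exact: integrable_gauss_weight.
rewrite integral_gauss_weight// integral_gauss_moment1// integral_gauss_moment2//.
by rewrite mule0 adde0 -!EFinM -EFinD; congr EFin; ring.
Qed.
End GaussianLine.

(** * Gaussian integrals in several variables *)

Definition qform (R : realType) n (A : 'M[R]_n) (v : 'rV[R]_n) : R :=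
  (v *m A *m v^T) ord0 ord0.

Section PD.
Variable R : realType.

Lemma qform_eq n (A : 'M[R]_n) v : v *m A *m v^T = (qform A v)%:M.
Proof. by rewrite [LHS]mx11_scalar. Qed.

Lemma pd_qform_ge0 n (A : 'M[R]_n) v : positive_definite A -> 0 <= qform A v.
Proof.
move=> [_ Apos]; have [->|v0] := eqVneq v 0; last exact/ltW/Apos.
by rewrite /qform !mul0mx mxE.
Qed.

Lemma pd_unit n (A : 'M[R]_n) : positive_definite A -> A \in unitmx.
Proof.
move=> [_ Apos]; rewrite unitmxE unitfE; apply/det0P => -[v v0 vA].
by have := Apos v v0; rewrite vA mul0mx mxE ltxx.
Qed.

(** Completing the square: in the coordinates (t, v) the form A is
    s t^2 + (v - t w) D (v - t w)^T, where D is the lower right block and s the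
    Schur complement. *)
Lemma pd_schur n (A : 'M[R]_(1 + n)) : positive_definite A ->
  exists (s : R) (w : 'rV[R]_n) (D : 'M[R]_n),
    [/\ 0 < s, positive_definite D &
        A = block_mx 1 (- w) 0 1%:M *m block_mx s%:M 0 0 D *m (block_mx 1 (- w) 0 1%:M)^T].
Proof.
move=> [symA posA].
set a := ulsubmx A; set b := ursubmx A; set D := drsubmx A.
have AE : A = block_mx a b b^T D.
  by rewrite -[LHS]submxK -/a -/b -/D; congr block_mx; rewrite /b trmx_ursub symA.
have pdD : positive_definite D.
  split; first by rewrite /D trmx_drsub symA.
  move=> v v0; have := posA (row_mx 0 v).
  rewrite AE mul_row_block tr_row_mx mul_row_col !mul0mx !add0r trmx0 mulmx0 add0r.
  apply; apply: contraNneq v0 => /(congr1 rsubmx); rewrite row_mxKr => ->.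
  by apply/eqP/matrixP => i j; rewrite !mxE.
have uD := pd_unit pdD; have symD := pdD.1.
pose w := - (b *m invmx D).
have wD : w *m D = - b by rewrite mulNmx mulmxKV.
have Dw : D *m w^T = - b^T by rewrite -symD -trmx_mul wD linearN.
pose s := a ord0 ord0 - qform D w.
have sE : s%:M = a - w *m D *m w^T.
  by rewrite qform_eq [a]mx11_scalar -raddfB.
have eqA : A = block_mx 1 (- w) 0 1%:M *m block_mx s%:M 0 0 D *m (block_mx 1 (- w) 0 1%:M)^T.
  rewrite tr_block_mx !mulmx_block !(mul1mx, mulmx1, mul0mx, mulmx0, addr0, add0r, trmx1, trmx0) AE.
  rewrite mulNmx wD opprK [(- w)^T]linearN/= !mulmxN Dw opprK sE wD mulNmx.
  by rewrite opprK addrK.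
exists s, w, D; split => //.
have := posA (row_mx 1 w); rewrite {1}eqA.
set U := block_mx 1 _ _ _; have wU : row_mx 1 w *m U = row_mx 1 0.
  by rewrite mul_row_block !mul1mx mulmx0 mulmx1 addr0 addNr.
rewrite -!mulmxA mulmxA wU mulmxA -trmx_mul wU tr_row_mx mul_row_block mul_row_col.
rewrite !(mul1mx, mul0mx, mulmx0, addr0) trmx1 mulmx1 mxE eqxx mulr1n; apply.
apply/eqP => /(congr1 lsubmx); rewrite row_mxKl => /matrixP/(_ ord0 ord0).
by rewrite !mxE/= => /eqP; rewrite oner_eq0.
Qed.

Lemma det_schur n (s : R) (w : 'rV[R]_n) (D : 'M[R]_n) :
  \det (block_mx 1 (- w) 0 1%:M *m block_mx s%:M 0 0 D *m (block_mx 1 (- w) 0 1%:M)^T)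
  = s * \det D.
Proof.
rewrite !det_mulmx det_tr !det_ublock det1 det_scalar1 !det1.
by rewrite !mul1r mulr1.
Qed.

Lemma pd_det_gt0 n (A : 'M[R]_n) : positive_definite A -> 0 < \det A.
Proof.
elim: n A => [A _|n IH A]; first by rewrite det_mx00.
move=> /(@pd_schur n)[s [w [D [s0 pdD ->]]]].
by rewrite (det_schur s w D) mulr_gt0// IH.
Qed.

Lemma inv_schur n (s : R) (w : 'rV[R]_n) (D : 'M[R]_n) : 0 < s -> D \in unitmx ->
  invmx (block_mx 1 (- w) 0 1%:M *m block_mx s%:M 0 0 D *m (block_mx 1 (- w) 0 1%:M)^T)
  = (block_mx 1 w 0 1%:M)^T *m block_mx (s^-1)%:M 0 0 (invmx D) *m (block_mx 1 w 0 1%:M).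
Proof.
move=> s0 uD.
set U := block_mx 1 (- w) 0 _; set V := block_mx 1 w 0 _.
set S := block_mx s%:M _ _ _; set T := block_mx s^-1%:M _ _ _.
have UV : U *m V = 1%:M.
  by rewrite /U /V mulmx_block !(mul1mx, mulmx1, mul0mx, mulmx0, addr0, add0r) subrr -scalar_mx_block.
have VU : V *m U = 1%:M := mulmx1C UV.
have ST : S *m T = 1%:M.
  rewrite /S /T mulmx_block !(mul1mx, mulmx1, mul0mx, mulmx0, addr0, add0r).
  by rewrite -scalar_mxM mulfV ?lt0r_neq0// mulmxV// -scalar_mx_block.
have E : (U *m S *m U^T) *m (V^T *m T *m V) = 1%:M.
  rewrite -!mulmxA (mulmxA U^T) -trmx_mul VU trmx1 mul1mx (mulmxA S) ST mul1mx.
  exact: UV.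
have [uA _] := mulmx1_unit E.
by rewrite -[RHS]mul1mx -(mulVmx uA) -(mulmxA (invmx _)) E mulmx1.
Qed.
End PD.

Section GaussianMoments.
Variable R : realType.

Lemma qformD n (Q : 'M[R]_n) (g f : 'rV[R]_n) (u : R) :
  qform Q (g + u *: f) =
  qform Q g + ((g *m Q *m f^T) ord0 ord0 + (f *m Q *m g^T) ord0 ord0) * u + qform Q f * u ^+ 2.
Proof.
rewrite /qform linearD linearZ/= !mulmxDl !mulmxDr -!scalemxAl -!scalemxAr !mxE.
ring.
Qed.

Lemma mxtrace_mul_outer n (Q : 'M[R]_n) (f : 'rV[R]_n) :
  \tr (Q *m (f^T *m f)) = qform Q f.
Proof.
by rewrite mulmxA mxtrace_mulC mulmxA qform_eq mxtrace_scalar mulr1n.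
Qed.

Lemma qform_schur n (s t : R) (w v : 'rV[R]_n) (D : 'M[R]_n) :
  qform (block_mx 1 (- w) 0 1%:M *m block_mx s%:M 0 0 D *m (block_mx 1 (- w) 0 1%:M)^T)
    (row_mx t%:M v) = s * t ^+ 2 + qform D (v - t *: w).
Proof.
rewrite /qform -!mulmxA mulmxA -trmx_mul mulmxA.
have -> : row_mx t%:M v *m block_mx 1 (- w) 0 1%:M = row_mx t%:M (v - t *: w).
  by rewrite mul_row_block !mulmx1 mulmx0 addr0 mulmxN mul_scalar_mx addrC.
rewrite mul_row_block tr_row_mx !(mulmx0, addr0, add0r) mul_row_col tr_scalar_mx.
rewrite -!scalar_mxM [LHS]mxE mxE eqxx mulr1n; congr (_ + _).
  by rewrite mulrAC mulrC expr2.
by rewrite mulmxA.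
Qed.

(** Induction on n through [pd_schur].  Fixing the first coordinate t turns the
    integrand into one of the same shape in the other coordinates, with mean and
    affine argument v C + e shifted proportionally to t; the matrix C, the offset e
    and the factor k are there to make the statement stable under this step. *)
Lemma integral_Rn_gauss n (A : 'M[R]_n) (mu : 'rV[R]_n) m (C : 'M[R]_(n, m))
    (e : 'rV[R]_m) (Q : 'M[R]_m) (k a : R) :
  positive_definite A ->
  integral_Rn (fun v : 'rV[R]_n =>
    (k * expR (- qform A (v - mu) / 2) * (a + qform Q (v *m C + e)))%:E) =
  (k * Num.sqrt ((2 * pi) ^+ n / \det A) *
    (a + qform Q (mu *m C + e) + \tr (Q *m (C^T *m invmx A *m C))))%:E.
Proof.
elim: n A mu C e k => [|n IH]; last rewrite -[n.+1]/(1 + n)%N; move=> A mu C e k pdA.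
  rewrite /= det_mx00 expr0 divr1 sqrtr1 mulr1; congr EFin.
  rewrite (flatmx0 C) (thinmx0 mu) !mulmx0 !linear0 addr0.
  by rewrite addr0 {1}/qform !mul0mx mxE oppr0 mul0r expR0 mulr1.
have [s [w [D [s0 pdD AE]]]] := pd_schur pdA.
pose m0 : R := lsubmx mu ord0 ord0.
pose mr : 'rV[R]_n := rsubmx mu.
have mE : mu = row_mx m0%:M mr.
  by rewrite -[LHS](hsubmxK mu) [lsubmx _]mx11_scalar.
pose c0 : 'rV[R]_m := usubmx C.
pose Cr : 'M[R]_(n, m) := dsubmx C.
have CE : C = col_mx c0 Cr by rewrite -[LHS](vsubmxK C).
pose f := c0 + w *m Cr; pose g := mu *m C + e.
have gE : g = m0 *: c0 + mr *m Cr + e by rewrite /g mE CE mul_row_col mul_scalar_mx.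
(* The shifted mean is mr + (t - m0) w, and f is the change of the affine
   argument at the mean per unit of t. *)
have inner t : integral_Rn (fun v : 'rV[R]_n =>
    (k * expR (- qform A (row_mx t%:M v - mu) / 2) *
      (a + qform Q (row_mx t%:M v *m C + e)))%:E) =
  (gauss_weight s m0 t *
    (k * Num.sqrt ((2 * pi) ^+ n / \det D) * (a + qform Q g + \tr (Q *m (Cr^T *m invmx D *m Cr))) +
     k * Num.sqrt ((2 * pi) ^+ n / \det D) *
       ((g *m Q *m f^T) ord0 ord0 + (f *m Q *m g^T) ord0 ord0) * (t - m0) +
     k * Num.sqrt ((2 * pi) ^+ n / \det D) * qform Q f * (t - m0) ^+ 2))%:E.
  transitivity (integral_Rn (fun v : 'rV[R]_n =>
    (k * gauss_weight s m0 t * expR (- qform D (v - (mr + (t - m0) *: w)) / 2) *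
      (a + qform Q (v *m Cr + (e + t *: c0))))%:E)).
    congr integral_Rn; apply/funext => v; congr (_ * (_ + qform Q _))%:E.
      rewrite mE opp_row_mx add_row_mx -raddfB AE qform_schur -mulrA -expRD.
      rewrite (_ : v - mr - (t - m0) *: w = v - (mr + (t - m0) *: w)); last first.
        by rewrite opprD addrA.
      by congr (_ * expR _); field.
    by rewrite CE mul_row_col mul_scalar_mx -addrA addrC -addrA.
  rewrite IH//; congr EFin.
  have -> : (mr + (t - m0) *: w) *m Cr + (e + t *: c0) = g + (t - m0) *: f.
    rewrite gE /f scalerDr mulmxDl scalemxAl [in RHS]scalerBl.
    apply/matrixP => i j; rewrite !mxE; ring.
  rewrite qformD; ring.
rewrite [LHS]/=; under eq_integral => t _ do rewrite inner.
rewrite integral_gauss_quadratic//; congr EFin.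
have uD := pd_unit pdD; have dD := pd_det_gt0 pdD.
rewrite AE (det_schur s w D) (inv_schur w s0 uD).
rewrite -/g.
have -> : C^T *m ((block_mx 1 w 0 1%:M)^T *m block_mx s^-1%:M 0 0 (invmx D) *m block_mx 1 w 0 1%:M) *m C
  = s^-1 *: (f^T *m f) + Cr^T *m invmx D *m Cr.
  have VC : block_mx 1 w 0 1%:M *m C = col_mx f Cr.
    by rewrite CE mul_block_col mul0mx add0r !mul1mx.
  rewrite -!mulmxA VC mulmxA -trmx_mul VC mulmxA tr_col_mx mul_row_block !(mulmx0, addr0, add0r).
  rewrite mul_row_col mul_mx_scalar -scalemxAl. by rewrite mulmxA.
rewrite (mulmxDr Q) mxtraceD -scalemxAr mxtraceZ mxtrace_mul_outer.
rewrite add1n exprS (_ : 2 * pi * (2 * pi) ^+ n / (s * \det D) = (2 * pi / s) * ((2 * pi) ^+ n / \det D)); last first.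
  field; by rewrite !lt0r_neq0.
rewrite [in RHS]sqrtrM; last by rewrite divr_ge0 ?mulr_ge0 ?pi_ge0 ?(ltW s0).
ring.
Qed.
End GaussianMoments.

(** * The divergence and its minimization column by column *)

Section KL.
Variable R : realType.


Lemma ln_sqrtr (x : R) : 0 < x -> ln (Num.sqrt x) = ln x / 2.
Proof.
move=> x0; rewrite -{2}(sqr_sqrtr (ltW x0)) lnXn ?sqrtr_gt0//.
by rewrite mulr2n mulrDl -splitr.
Qed.

Lemma pd_inv n (A : 'M[R]_n) : positive_definite A -> positive_definite (invmx A).
Proof.
move=> pdA; have uA := pd_unit pdA; have symA := pdA.1.
split=> [|v v0]; first by rewrite trmx_inv symA.
have := pdA.2 (v *m invmx A); rewrite mulmxKV// trmx_mul trmx_inv symA mulmxA; apply.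
by apply: contraNneq v0 => /(congr1 (mulmx^~ A)); rewrite mulmxKV// mul0mx => ->.
Qed.

(** The logarithm of the quotient of the densities is a quadratic polynomial,
    whose mean is given by [integral_Rn_gauss]. *)
Lemma KL_gaussian_precision n (Theta P : 'M[R]_n) :
  positive_definite Theta -> positive_definite P ->
  KL_gaussian Theta (invmx P) =
  ((\tr (P *m Theta) - n%:R) / 2 - ln (\det P) / 2 - ln (\det Theta) / 2)%:E.
Proof.
move=> pdT pdP; have dT := pd_det_gt0 pdT; have dP := pd_det_gt0 pdP.
have uT := pd_unit pdT; have c0 : 0 < (2 * pi : R) ^+ n by rewrite exprn_gt0 ?mulr_gt0 ?pi_gt0.
pose Z1 := Num.sqrt ((2 * pi) ^+ n * \det Theta).
pose Z2 := Num.sqrt ((2 * pi) ^+ n * (\det P)^-1).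
have Z1_gt0 : 0 < Z1 by rewrite sqrtr_gt0 mulr_gt0.
have Z2_gt0 : 0 < Z2 by rewrite sqrtr_gt0 mulr_gt0 ?invr_gt0.
have lnZ : ln (Z2 / Z1) = - ln (\det P) / 2 - ln (\det Theta) / 2.
  rewrite ln_div ?posrE// /Z1 /Z2 !ln_sqrtr ?mulr_gt0 ?invr_gt0//.
  by rewrite !lnM ?lnV ?posrE ?invr_gt0//; ring.
transitivity (integral_Rn (fun v : 'rV[R]_n =>
  (Z1^-1 * expR (- qform (invmx Theta) (v - 0) / 2) *
    (ln (Z2 / Z1) + qform (2^-1 *: (P - invmx Theta)) (v *m 1%:M + 0)))%:E)).
  congr integral_Rn; apply/funext => v; congr EFin.
  rewrite /gaussian_pdf invmxK det_inv -/Z1 -/Z2 -!/(qform _ _) subr0 mulmx1 addr0.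
  rewrite [X in X * ln _]mulrC; congr (_ * _).
  set a := expR _; set b := expR _.
  rewrite (_ : a / Z1 / (b / Z2) = (a / b) * (Z2 / Z1)); last first.
    by field; rewrite !lt0r_neq0 ?expR_gt0.
  rewrite lnM ?posrE ?divr_gt0 ?expR_gt0// addrC; congr (_ + _).
  rewrite ln_div ?posrE ?expR_gt0// !expRK.
  rewrite /qform -scalemxAr -scalemxAl mulmxBr mulmxBl !mxE; ring.
rewrite integral_Rn_gauss; last exact: pd_inv.
congr EFin; rewrite invmxK mul0mx add0r {1}/qform !mul0mx mxE trmx1 mul1mx mulmx1 addr0.
rewrite det_inv invrK -/Z1 mulVf ?lt0r_neq0// mul1r lnZ.
by rewrite -scalemxAl mxtraceZ mulmxBl mulVmx// raddfB/= mxtrace1; ring.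
Qed.

Definition prec_rank (N : nat) (prec : rel 'I_N) (i : 'I_N) := #|[set j | prec j i]|.

Lemma prec_rank_lt N (prec : rel 'I_N) i j :
  strict_total_order prec -> prec i j -> (prec_rank prec i < prec_rank prec j)%N.
Proof.
move=> [irr tr _] ij; apply: proper_card; apply/properP; split.
  by apply/fintype.subsetP => k; rewrite !inE => /tr; apply.
by exists i; rewrite inE// irr.
Qed.

(** A permutation that moves no index forward in the ordering does not increase
    any rank; the sum of the ranks being invariant, it is the identity. *)
Lemma det_prec_trig N (prec : rel 'I_N) (M : 'M[R]_N) : strict_total_order prec ->
  (forall i k, prec i k -> M i k = 0) -> \det M = \prod_k M k k.
Proof.
move=> so M0; rewrite /determinant (bigD1 (1%g : {perm 'I_N}))//= [X in _ + X]big1 ?addr0 => [|s s1].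
  by rewrite odd_perm1 expr0 mul1r; apply: eq_bigr => i _; rewrite perm1.
suff [i si] : exists i, prec i (s i).
  by rewrite (bigD1 i)//= M0// mul0r mulr0.
apply/existsP; apply: contraNT s1; rewrite negb_exists => /forallP nprec.
have le i : (prec_rank prec (s i) <= prec_rank prec i ?= iff (s i == i))%N.
  have [_ _ tot] := so; have [->|/tot] := eqVneq (s i) i; first by split; rewrite ?eqxx.
  rewrite (negbTE (nprec i)) orbF => /(prec_rank_lt so) lt.
  by split; [exact: ltnW|rewrite ltn_eqF].
have E : (\sum_i prec_rank prec (s i) = \sum_i prec_rank prec i)%N.
  by rewrite [RHS](reindex_inj (@perm_inj _ s)).
have [_] := leqif_sum (fun i (_ : true) => le i).
rewrite E eqxx => /esym/forallP H; apply/eqP/permP => i; rewrite perm1.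
exact/eqP/H.
Qed.

(** The normal equations of the minimization over the vectors supported in s,
    normalized so that the diagonal entry is positive.  The vector is a row because
    [positive_definite] is stated for rows. *)
Definition kl_column N (Theta : 'M[R]_N) (s : {set 'I_N}) (k : 'I_N) (u : 'rV[R]_N) :=
  [/\ forall i, i \notin s -> u ord0 i = 0, k \in s, 0 < u ord0 k &
      forall i, i \in s -> (u *m Theta) ord0 i = (i == k)%:R / u ord0 k].

Lemma kl_column_mul N (Theta : 'M[R]_N) s k u (z : 'rV[R]_N) :
  kl_column Theta s k u -> (forall i, i \notin s -> z ord0 i = 0) ->
  (u *m Theta *m z^T) ord0 ord0 = z ord0 k / u ord0 k.
Proof.
move=> [u0 ks uk uT] z0; rewrite mxE (bigD1 k)//= big1 => [|i ik].
  by rewrite uT// eqxx mxE addr0 mul1r mulrC.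
have [si|/z0 zi] := boolP (i \in s); last by rewrite [_^T _ _]mxE zi mulr0.
by rewrite uT// (negbTE ik) !mul0r.
Qed.

Lemma kl_column_norm N (Theta : 'M[R]_N) s k u :
  kl_column Theta s k u -> qform Theta u = 1.
Proof.
move=> H; have [u0 _ uk _] := H.
by rewrite /qform (kl_column_mul H)// divff ?lt0r_neq0.
Qed.

(** Symmetry of Theta forces the diagonal entries to agree; the difference is then
    isotropic for the positive definite form Theta. *)
Lemma kl_column_unique N (Theta : 'M[R]_N) s k u u' :
  positive_definite Theta ->
  kl_column Theta s k u -> kl_column Theta s k u' -> u = u'.
Proof.
move=> pdT H H'; have [u0 ks uk uT] := H; have [u0' _ uk' uT'] := H'.
have symT : (u *m Theta *m u'^T) ord0 ord0 = (u' *m Theta *m u^T) ord0 ord0.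
  have -> : u' *m Theta *m u^T = (u *m Theta *m u'^T)^T.
    by rewrite !trmx_mul trmxK pdT.1 mulmxA.
  by rewrite [RHS]mxE.
have ek : u ord0 k = u' ord0 k.
  move: symT; rewrite (kl_column_mul H u0') (kl_column_mul H' u0) => /eqP.
  rewrite eqr_div ?lt0r_neq0// -!expr2 => /eqP /esym.
  by move/(congr1 Num.sqrt); rewrite !sqrtr_sqr !gtr0_norm.
apply/eqP; rewrite -subr_eq0; apply/negPn/negP => /(pdT.2); set w := u - u'.
have w0 i : i \notin s -> w ord0 i = 0 by move=> si; rewrite !mxE u0// u0'// subrr.
suff -> : (w *m Theta *m w^T) ord0 ord0 = 0 by rewrite ltxx.
rewrite mxE big1// => i _; have [si|/w0 wi] := boolP (i \in s); last by rewrite [_^T _ _]mxE wi mulr0.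
by rewrite mulmxBl [X in X * _]mxE uT// mxE uT'// ek subrr mul0r.
Qed.

(** With c = z_k / u_k, positivity of the form at z - c u gives c^2 <= z Theta z^T
    and ln (c^2) <= c^2 - 1 does the rest. *)
Lemma kl_column_opt N (Theta : 'M[R]_N) s k u (z : 'rV[R]_N) :
  positive_definite Theta -> kl_column Theta s k u ->
  (forall i, i \notin s -> z ord0 i = 0) -> z ord0 k != 0 ->
  qform Theta u / 2 - ln `|u ord0 k| <= qform Theta z / 2 - ln `|z ord0 k|.
Proof.
move=> pdT H z0 zk; have [u0 ks uk uT] := H.
rewrite (kl_column_norm H) (gtr0_norm uk).
set c := z ord0 k / u ord0 k.
have c0 : 0 < `|c| by rewrite normr_gt0 /c; apply: mulf_neq0 => //; rewrite invr_neq0// lt0r_neq0.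
have qz : c ^+ 2 <= qform Theta z.
  have := pd_qform_ge0 (z + (- c) *: u) pdT; rewrite qformD (kl_column_norm H).
  rewrite (kl_column_mul H z0) -/c.
  have -> : z *m Theta *m u^T = (u *m Theta *m z^T)^T.
    by rewrite !trmx_mul trmxK pdT.1 mulmxA.
  rewrite mxE (kl_column_mul H z0) -/c; nra.
have -> : ln `|z ord0 k| = ln `|c| + ln (u ord0 k).
  by rewrite -lnM ?posrE// /c normrM normfV (gtr0_norm uk) divfK ?lt0r_neq0.
have : ln (`|c| ^+ 2) <= `|c| ^+ 2 - 1.
  have := @le_ln1Dx R (`|c| ^+ 2 - 1); rewrite [1 + _]addrC subrK; apply.
  by rewrite ltrBrDl addrN exprn_gt0.
rewrite lnXn// real_normK ?num_real// mulr2n; lra.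
Qed.

Lemma mul_tr_pd N (M : 'M[R]_N) : M \in unitmx -> positive_definite (M *m M^T).
Proof.
move=> uM; split=> [|v v0]; first by rewrite trmx_mul trmxK.
rewrite mulmxA -mulmxA -trmx_mul mxE.
have vM : v *m M != 0.
  by apply: contraNneq v0 => /(congr1 (mulmx^~ (invmx M))); rewrite mulmxK// mul0mx => ->.
rewrite lt_def sumr_ge0 ?andbT => [|i _]; last by rewrite [_^T _ _]mxE -expr2 sqr_ge0.
apply: contraNneq vM => /eqP; rewrite psumr_eq0 => [/allP H|i _]; last first.
  by rewrite [_^T _ _]mxE -expr2 sqr_ge0.
apply/eqP/matrixP => i j; rewrite ord1 [RHS]mxE.
by have := H j (mem_index_enum _); rewrite [_^T _ _]mxE -expr2 sqrf_eq0 => /eqP.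
Qed.

(** Both the trace and the logarithm of the determinant split over the columns. *)
Lemma KL_triangular N (prec : rel 'I_N) (S : {set 'I_N * 'I_N}) (Theta M : 'M[R]_N) :
  strict_total_order prec -> positive_definite Theta -> sparse_factor prec S M ->
  (forall k, M k k != 0) /\
  KL_gaussian Theta (invmx (M *m M^T)) =
  (\sum_k (qform Theta (col k M)^T / 2 - ln `|M k k|)
    - N%:R / 2 - ln (\det Theta) / 2)%:E.
Proof.
move=> so pdT [trigM _ uMM].
have uM : M \in unitmx.
  by move: uMM; rewrite !unitmxE det_mulmx unitrM => /andP[].
have dM := det_prec_trig so trigM.
have Mk k : M k k != 0.
  by move: uM; rewrite unitmxE unitfE dM => /prodf_neq0; apply.
split=> //; rewrite KL_gaussian_precision//; last exact: mul_tr_pd.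
congr EFin; rewrite sumrB -mulr_suml.
have -> : \tr (M *m M^T *m Theta) = \sum_k qform Theta (col k M)^T.
  rewrite -mulmxA mxtrace_mulC; apply: eq_bigr => k _.
  rewrite /qform trmxK tr_col -row_mul !mxE; apply: eq_bigr => j _.
  by rewrite [row _ _ _ _]mxE [col _ _ _ _]mxE.
have -> : ln (\det (M *m M^T)) / 2 = \sum_k ln `|M k k|.
  rewrite det_mulmx det_tr -expr2 -real_normK ?num_real// lnXn; last first.
    by rewrite normr_gt0; move: uM; rewrite unitmxE unitfE.
  rewrite mulr2n mulrDl -splitr dM normr_prod.
  pose K x (y : R) := 0 < x /\ ln x = y.
  have [] // : K (\prod_k `|M k k|) (\sum_k ln `|M k k|).
  apply: big_rec2 => [|k y x _ [x0 <-]]; first by split; rewrite ?ln1.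
  by split; rewrite ?mulr_gt0 ?lnM ?posrE// normr_gt0.
ring.
Qed.

Lemma kl_columns_minimize N (prec : rel 'I_N) (S : {set 'I_N * 'I_N}) (Theta L : 'M[R]_N) :
  strict_total_order prec -> positive_definite Theta ->
  (forall i k, (i, k) \in S -> preceq prec k i) ->
  (forall k, kl_column Theta (column S k) k (col k L)^T) ->
  KL_minimizer prec S Theta L.
Proof.
move=> so pdT lowS klL.
have LS i k : (i, k) \notin S -> L i k = 0.
  move=> ikS; have [H _ _ _] := klL k.
  by have := H i; rewrite inE !mxE; apply.
have Lt i k : prec i k -> L i k = 0.
  move=> ik; apply: LS; apply/negP => /lowS; rewrite /preceq.
  have [irr tr _] := so; case/orP => [/eqP e|ki]; first by rewrite e irr in ik.
  by have := tr _ _ _ ik ki; rewrite irr.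
have Lkk k : 0 < L k k by have [_ _ + _] := klL k; rewrite !mxE.
have sfL : sparse_factor prec S L.
  split=> //; rewrite unitmxE det_mulmx det_tr unitrM andbb (det_prec_trig so Lt).
  by rewrite unitfE; apply/prodf_neq0 => k _; rewrite lt0r_neq0.
split=> // M sfM; have [Mk ->] := KL_triangular so pdT sfM.
have [_ ->] := KL_triangular so pdT sfL; rewrite lee_fin !lerD2r.
apply: ler_sum => k _.
have := kl_column_opt pdT (klL k) (z := (col k M)^T); rewrite !mxE; apply => // i.
by rewrite inE !mxE; have [_ + _] := sfM; apply.
Qed.
End KL.

(** * Columns listed in the order, Cholesky factors *)

Section Lists.
Variables (R : realType) (N : nat).

(** Serves for principal submatrices and for reversing the order of the indices. *)
Lemma pd_sub m n (A : 'M[R]_n) (f : 'I_m -> 'I_n) : positive_definite A -> injective f ->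
  positive_definite (\matrix_(i, j) A (f i) (f j)).
Proof.
move=> [symA posA] injf; split=> [|v v0].
  by apply/matrixP => i j; rewrite !mxE -[in LHS]symA mxE.
pose P : 'M[R]_(m, n) := \matrix_(a, i) (f a == i)%:R.
have PE p (B : 'M[R]_(n, p)) a j : (P *m B) a j = B (f a) j.
  rewrite mxE (bigD1 (f a))//= mxE eqxx mul1r big1 ?addr0// => i /negbTE ia.
  by rewrite mxE eq_sym ia mul0r.
have -> : \matrix_(i, j) A (f i) (f j) = P *m A *m P^T.
  apply/matrixP => i j; rewrite -mulmxA PE mxE.
  by rewrite -[A *m P^T]trmxK trmx_mul trmxK mxE PE mxE.
have := posA (v *m P); rewrite trmx_mul !mulmxA; apply.
apply: contraNneq v0 => vP0; apply/eqP/matrixP => i j; rewrite ord1 [RHS]mxE.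
have /matrixP/(_ ord0 (f j)) := vP0.
rewrite !mxE (bigD1 j)//= mxE eqxx mulr1 big1 ?addr0// => a aj.
by rewrite mxE (inj_eq injf) (negbTE aj) mulr0.
Qed.

(** The programs know indices through their positions in a list; this translates
    the normal equations from positions to indices. *)
Lemma kl_column_of_seq (Theta : 'M[R]_N) (s : seq 'I_N) (A : {set 'I_N}) (k : 'I_N) (y : nat -> R) :
  uniq s -> A =i s -> k \in s -> nth k s 0 = k -> 0 < y 0%N ->
  (forall a, (a < size s)%N ->
    \sum_(b < size s) Theta (nth k s b) (nth k s a) * y b = (a == 0)%:R / y 0%N) ->
  kl_column Theta A k (\row_i if i \in s then y (index i s) else 0).
Proof.
move=> us As ks s0 y0 eqy.
have ik : index k s = 0%N.
  by rewrite -{1}s0 index_uniq// -has_predT; apply/hasP; exists k.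
split; rewrite ?As//; first by move=> i; rewrite As mxE => /negbTE ->.
  by rewrite mxE ks ik.
move=> i; rewrite As => si; rewrite !mxE ks ik.
have ilt : (index i s < size s)%N by rewrite index_mem.
have -> : (i == k) = (index i s == 0%N).
  apply/eqP/eqP => [->//|i0]; by rewrite -(nth_index k si) i0 s0.
rewrite -eqy// (bigID (mem s))/= [X in _ + X]big1 ?addr0; last first.
  by move=> j /negbTE js; rewrite mxE js mul0r.
rewrite -big_uniq//= (big_nth k) big_mkord; apply: eq_bigr => b _.
by rewrite mxE mem_nth// index_uniq// nth_index// mulrC.
Qed.
End Lists.

Section Listing.
Variables (N : nat) (prec : rel 'I_N).
Hypothesis so : strict_total_order prec.

Lemma preceq_trans : transitive (preceq prec).
Proof.
have [_ tr _] := so; move=> j i k; rewrite /preceq.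
case/predU1P => [->//|ij] /predU1P[<-|jk]; first by rewrite ij orbT.
by rewrite (tr _ _ _ ij jk) orbT.
Qed.

Lemma preceq_anti : antisymmetric (preceq prec).
Proof.
have [irr tr _] := so; move=> i j; rewrite /preceq => /andP[/predU1P[->//|ij] /predU1P[->//|ji]].
by have := tr _ _ _ ij ji; rewrite irr.
Qed.

Lemma preceq_total : total (preceq prec).
Proof.
have [_ _ tot] := so; move=> i j; rewrite /preceq [j == i]eq_sym.
by have [//|/tot] := eqVneq i j.
Qed.

Implicit Types (A : {set 'I_N}) (k : 'I_N).

Lemma mem_listing A : listing prec A =i A.
Proof. by move=> i; rewrite mem_sort mem_enum. Qed.

Lemma listing_uniq A : uniq (listing prec A).
Proof. by rewrite sort_uniq enum_uniq. Qed.

Lemma size_listing A : size (listing prec A) = #|A|.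
Proof. by rewrite size_sort cardE. Qed.

Lemma listing_sorted A : sorted (preceq prec) (listing prec A).
Proof. exact: (sort_sorted preceq_total). Qed.

Lemma listing_head A k : k \in A -> (forall i, i \in A -> preceq prec k i) ->
  nth k (listing prec A) 0 = k.
Proof.
rewrite -mem_listing => kA; have := listing_sorted A; have := mem_listing A; move: kA.
case: (listing prec A) => [//|h s] kA memA srt kmin /=.
have hA : h \in A by rewrite -memA inE eqxx.
apply: preceq_anti; rewrite (kmin _ hA) andbT.
move: kA; rewrite inE => /predU1P[->|ks]; first by rewrite /preceq eqxx.
by have /allP := order_path_min preceq_trans srt; apply.
Qed.

(** In a listing, the indices from k on form a suffix: the triangular systems of a
    supernode start at the position of k. *)
Lemma listing_drop A (B : {set 'I_N}) k : k \in A ->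
  B =i [pred i | (i \in A) && preceq prec k i] ->
  let s := listing prec A in drop (index k s) s =i B.
Proof.
move=> kA BE /= i; set s := listing prec A; rewrite BE inE -(mem_listing A) -/s.
have ks : k \in s by rewrite mem_listing.
have srt : sorted (preceq prec) s := listing_sorted A.
have us : uniq s := listing_uniq A.
have [si|nsi] := boolP (i \in s); last first.
  by apply: contraNF nsi => /mem_drop.
have le_iff : preceq prec k i = (index k s <= index i s)%N.
  apply/idP/idP => [ki|le].
    rewrite leqNgt; apply/negP => lt.
    have := sorted_ltn_nth preceq_trans k srt.
    move=> /(_ (index i s) (index k s)); rewrite !inE !index_mem => /(_ si ks lt).
    rewrite !nth_index// => ik.
    by have := preceq_anti (introT andP (conj ki ik)) => e; rewrite e ltnn in lt.
  have refl : reflexive (preceq prec) by move=> x; rewrite /preceq eqxx.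
  have := sorted_leq_nth preceq_trans refl k srt.
  move=> /(_ (index k s) (index i s)); rewrite !inE !index_mem => /(_ ks si le).
  by rewrite !nth_index.
rewrite le_iff andTb.
have := us; rewrite -{1}[s](cat_take_drop (index k s)) cat_uniq => /and3P[_ /hasPn nd _].
apply/idP/idP => [id|le].
  rewrite leqNgt; apply/negP => lt; have /negP := nd _ id; apply.
  by rewrite /= in_take_leq ?index_size// .
move: si; rewrite -{1}[s](cat_take_drop (index k s)) mem_cat => /orP[|//]; rewrite in_take_leq ?index_size//.
by rewrite ltnNge le.
Qed.
End Listing.

Section KLFactor.
Variables (R : realType) (N : nat) (prec : rel 'I_N).
Hypothesis so : strict_total_order prec.

(** What is needed of a pattern for every column to have a diagonal entry and for
    the factor to be triangular. *)
Definition lower_pattern (S : {set 'I_N * 'I_N}) :=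
  (forall k, (k, k) \in S) /\ (forall i k, (i, k) \in S -> preceq prec k i).

Lemma listing_column_head S k : lower_pattern S -> nth k (listing prec (column S k)) 0 = k.
Proof.
move=> [diagS lowS]; apply: (listing_head so); first by rewrite inE.
by move=> i; rewrite inE => /lowS.
Qed.

Lemma KL_factor_column S (Theta : 'M[R]_N) k : positive_definite Theta -> lower_pattern S ->
  kl_column Theta (column S k) k (col k (KL_factor prec S Theta))^T.
Proof.
move=> pdT lowS; set s := listing prec (column S k).
have us : uniq s by exact: listing_uniq.
have ks : k \in s by rewrite mem_listing inE lowS.1.
have s_gt0 : (0 < size s)%N by rewrite -has_predT; apply/hasP; exists k.
pose a0 := Ordinal s_gt0.
pose T := submx_on Theta s.
have pdT' : positive_definite T.
  apply: (pd_sub pdT (f := fun a => tnth (in_tuple s) a)) => a b /eqP.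
  by rewrite !(tnth_nth k) nth_uniq// => /eqP/val_inj.
pose e1 : 'cV[R]_(size s) := \col_a ((a : nat) == 0%N)%:R.
pose v := invmx T *m e1.
have vE : v = invmx T *m e1 by [].
have Tv : T *m v = e1 by rewrite vE mulKVmx// pd_unit.
clearbody v.
have e1v : (e1^T *m v) ord0 ord0 = v a0 ord0.
  rewrite mxE (bigD1 a0)//= !mxE mul1r [X in _ + X]big1 ?addr0// => i ia.
  by rewrite !mxE (_ : (_ == _) = false) ?mul0r//; apply: contraNF ia => /eqP i0; apply/eqP/val_inj.
have v0 : 0 < v a0 ord0.
  have -> : v a0 ord0 = (v^T *m T *m v^T^T) ord0 ord0.
    by rewrite trmxK -mulmxA Tv -e1v -[in LHS](trmxK v) -trmx_mul mxE.
  apply: pdT'.2; apply/eqP => /(congr1 trmx); rewrite trmxK trmx0 => v0.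
  have /matrixP/(_ a0 ord0) := Tv; rewrite v0 mulmx0 !mxE => /esym/eqP.
  by rewrite oner_eq0.
pose y b := if insub b is Some a then v a ord0 / Num.sqrt (v a0 ord0) else 0.
have yE (b : 'I_(size s)) : y b = v b ord0 / Num.sqrt (v a0 ord0).
  by rewrite /y valK.
have y0E : y 0%N = Num.sqrt (v a0 ord0).
  by rewrite (yE a0) -{1}(sqr_sqrtr (ltW v0)) expr2 mulfK// lt0r_neq0// sqrtr_gt0.
have -> : (col k (KL_factor prec S Theta))^T = \row_i if i \in s then y (index i s) else 0.
  apply/rowP => i; rewrite !mxE; cbv zeta; rewrite -/s -/T -/e1 -vE e1v -/(y _).
  have [//|si] := boolP (i \in s); rewrite /y insubF//.
  by rewrite index_mem (negbTE si).
apply: kl_column_of_seq => //.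
- by move=> i; rewrite mem_listing.
- exact: listing_column_head.
- by rewrite y0E sqrtr_gt0.
move=> a ha; have /matrixP/(_ (Ordinal ha) ord0) := Tv; rewrite y0E !mxE/= => <-.
rewrite mulr_suml; apply: eq_bigr => b _.
by rewrite mxE yE !(tnth_nth k)/= mulrA -{1}pdT.1 mxE.
Qed.

Lemma KL_factor_minimizer S (Theta : 'M[R]_N) : positive_definite Theta -> lower_pattern S ->
  KL_minimizer prec S Theta (KL_factor prec S Theta).
Proof.
move=> pdT lowS; apply: kl_columns_minimize => //; first exact: lowS.2.
by move=> k; exact: KL_factor_column.
Qed.

(** The programs are compared with the column formula through the normal
    equations only. *)
Lemma KL_factor_eq S (Theta L : 'M[R]_N) : positive_definite Theta -> lower_pattern S ->
  (forall k, kl_column Theta (column S k) k (col k L)^T) -> L = KL_factor prec S Theta.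
Proof.
move=> pdT lowS HL; apply/matrixP => i k.
have := kl_column_unique pdT (HL k) (KL_factor_column k pdT lowS).
by move=> /matrixP/(_ ord0 i); rewrite [LHS]mxE [RHS]mxE [LHS]mxE [RHS]mxE.
Qed.
End KLFactor.

Section CholeskyExists.
Variable R : realType.

(** [pd_schur] splits off the first coordinate and recursion factors the block D,
    so that the factor comes out upper triangular. *)
Lemma upper_cholesky n (A : 'M[R]_n) : positive_definite A ->
  exists U : 'M[R]_n, [/\ A = U *m U^T, forall i, 0 < U i i &
    forall i j : 'I_n, (j < i)%N -> U i j = 0].
Proof.
elim: n A => [|n IH]; last rewrite -[n.+1]/(1 + n)%N; move=> A pdA.
  by exists 0; split=> [|[]//|[]//]; rewrite [LHS]flatmx0 [RHS]flatmx0.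
have [s [w [D [s0 /IH[T [DE Tpos T0]] ->]]]] := pd_schur pdA.
set V := block_mx 1 _ _ _; pose X := V *m block_mx (Num.sqrt s)%:M 0 0 T.
have XE : X = block_mx (Num.sqrt s)%:M (- w *m T) 0 T.
  by rewrite /X /V mulmx_block !(mul1mx, mul0mx, mulmx0, addr0, add0r).
exists X; split.
- rewrite /X trmx_mul mulmxA -[Y in _ = Y *m _]mulmxA; congr (_ *m _ *m _).
  rewrite tr_block_mx mulmx_block !(trmx0, mul0mx, mulmx0, addr0, add0r) -DE.
  by rewrite tr_scalar_mx -scalar_mxM -expr2 sqr_sqrtr// ltW.
- move=> i; rewrite XE; case: (split_ordP i) => j ->; last by rewrite block_mxEdr.
  by rewrite block_mxEul mxE ord1 eqxx mulr1n sqrtr_gt0.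
- move=> i j; rewrite XE; case: (split_ordP i) => i' ->; case: (split_ordP j) => j' -> /=.
  + by rewrite !ord1.
  + by rewrite !ord1.
  + by rewrite block_mxEdl mxE.
  + by rewrite block_mxEdr ltn_add2l; exact: T0.
Qed.

(** The lower triangular factor is the upper triangular one of the matrix in
    reversed order.  Functions on nat match the memory cells of the programs. *)
Lemma cholesky_exists n (T : nat -> nat -> R) :
  positive_definite (\matrix_(i < n, j < n) T i j) ->
  exists F : nat -> nat -> R, (forall b, (b < n)%N -> 0 < F b b) /\
    forall a b, (b <= a < n)%N -> T a b = \sum_(0 <= t < b.+1) F a t * F b t.
Proof.
move=> pdT; have [U [UE Upos U0]] := upper_cholesky (pd_sub pdT (@rev_ord_inj n)).
pose F a b : R := if insub a is Some i then
  if insub b is Some j then U (rev_ord i) (rev_ord j) else 0 else 0.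
have FE (i j : 'I_n) : F i j = U (rev_ord i) (rev_ord j) by rewrite /F !valK.
exists F; split=> [b bn|a b /andP[ba an]]; first by rewrite (FE (Ordinal bn) (Ordinal bn)).
have bn : (b < n)%N by exact: leq_ltn_trans an.
pose i := Ordinal an; pose j := Ordinal bn.
have /matrixP/(_ (rev_ord i) (rev_ord j)) := UE; rewrite !mxE !rev_ordK/= => ->.
rewrite (reindex_inj (@rev_ord_inj n))/=.
rewrite (eq_bigr (fun t : 'I_n => F a t * F b t)) => [|t _]; last first.
  by rewrite mxE (FE i t) (FE j t).
rewrite -(big_mkord xpredT (fun t => F a t * F b t)).
rewrite (big_cat_nat _ (n := b.+1))//= [X in _ + X]big_nat_cond [X in _ + X]big1 ?addr0// => t.
rewrite andbT => /andP[bt tn]; rewrite (FE j (Ordinal tn)) U0 ?mulr0//=.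
by lia.
Qed.
End CholeskyExists.

(** * Loop invariants of the programs *)

Definition dest (I : Type) (o : instr I) : cell I :=
  match o with
  | iEval c _ _ | iBit c _ | iSub c _ _ | iMul c _ _ | iDiv c _ _ | iSqrt c _ => c
  end.

Section Run.
Variables (R : realType) (I : eqType) (ev : I -> I -> R).
Implicit Types (p : seq (instr I)) (m : memory R I) (c : cell I).

Lemma run_cat p1 p2 m : run ev (p1 ++ p2) m = run ev p2 (run ev p1 m).
Proof. exact: foldl_cat. Qed.

Lemma run_cons o p m : run ev (o :: p) m = run ev p (step ev m o).
Proof. by []. Qed.

Lemma writeE m c v c' : write m c v c' = if c' == c then v else m c'.
Proof. by []. Qed.

Lemma step_frame o m c : c != dest o -> step ev m o c = m c.
Proof. by case: o => /= *; rewrite writeE ifN. Qed.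

Lemma all_flatten_map (T S : Type) (P : pred T) (f : S -> seq T) s :
  all P (flatten (map f s)) = all (fun x => all P (f x)) s.
Proof. by elim: s => //= x s IH; rewrite all_cat IH. Qed.

Lemma run_frame p m c : all (fun o => c != dest o) p -> run ev p m c = m c.
Proof.
elim: p m => //= o p IH m /andP[co cp].
by rewrite IH// step_frame.
Qed.

(** Frame rule for independent blocks, used with Q the output cells of one column. *)
Lemma run_block (T : eqType) (f : T -> seq (instr I)) (s : seq T) (x : T)
    (Q : pred (cell I)) m :
  uniq s -> x \in s ->
  (forall y, y \in s -> y != x -> all (fun o => ~~ Q (dest o)) (f y)) ->
  exists s1, {subset s1 <= s} /\ forall c, Q c ->
    run ev (flatten (map f s)) m c = run ev (f x) (run ev (flatten (map f s1)) m) c.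
Proof.
move=> us xs; case/splitPr: xs us => s1 s2 us other.
exists s1; split=> [y ys|c Qc]; first by rewrite mem_cat ys.
rewrite map_cat flatten_cat run_cat/= run_cat run_frame//.
rewrite all_flatten_map; apply/allP => y ys /=.
have xy : y != x.
  by apply: contraTneq us => <-; rewrite cat_uniq /= ys !andbF.
have ys' : y \in s1 ++ x :: s2 by rewrite mem_cat inE ys !orbT.
by apply: sub_all (other y ys' xy) => o; apply: contraNneq => <-.
Qed.

Lemma run_loop (P : nat -> memory R I -> Prop) (f : nat -> seq (instr I)) lo n m :
  P lo m -> (forall a m, (lo <= a < lo + n)%N -> P a m -> P a.+1 (run ev (f a) m)) ->
  P (lo + n)%N (run ev (flatten [seq f a | a <- iota lo n]) m).
Proof.
elim: n lo m => [|n IH] lo m P0 PS; first by rewrite addn0.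
rewrite /= run_cat addnS -addSn; apply: IH => [|a m' ha].
  by apply: PS => //; rewrite leqnn addnS ltnS leq_addr.
by apply: PS; lia.
Qed.

Lemma run_loop_rev (P : nat -> memory R I -> Prop) (f : nat -> seq (instr I)) n m :
  P n m -> (forall a m, (a < n)%N -> P a.+1 m -> P a (run ev (f a) m)) ->
  P 0%N (run ev (flatten [seq f a | a <- rev (iota 0 n)]) m).
Proof.
elim: n m => [//|n IH] m Pn PS.
rewrite -addn1 iotaD rev_cat /= run_cat; apply: IH => [|a m' ha].
  by rewrite add0n; apply: PS.
by apply: PS; lia.
Qed.

Lemma run_submul_loop (c : cell I) (g h : nat -> cell I) lo n m m' :
  c != Tmp ->
  (forall t, (lo <= t < lo + n)%N -> [&& g t != c, h t != c, g t != Tmp & h t != Tmp]) ->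
  run ev (flatten [seq submul c (g t) (h t) | t <- iota lo n]) m = m' ->
  m' c = m c - \sum_(lo <= t < lo + n) m (g t) * m (h t) /\
  (forall c', c' != c -> c' != Tmp -> m' c' = m c').
Proof.
move=> cT gh <-; apply: (run_loop (P := fun a m' =>
  m' c = m c - \sum_(lo <= t < a) m (g t) * m (h t) /\
  (forall c', c' != c -> c' != Tmp -> m' c' = m c'))).
  by rewrite big_geq// subr0.
move=> a {}m' /[dup] ha /gh /and4P[gc hc gT hT] [m'c fr]; split.
  rewrite /submul /run /= !writeE !eqxx (negbTE cT) m'c !fr//.
  by rewrite big_nat_recr/=; [ring|lia].
by move=> c' c'c c'T; rewrite /submul /run/= !writeE (negbTE c'c) (negbTE c'T) fr.
Qed.

Section Matrix.
Variables (n : nat) (A : nat -> nat -> cell I) (F : nat -> nat -> R).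
Hypothesis A_Tmp : forall a b, (a < n)%N -> (b < n)%N -> A a b != Tmp.
Hypothesis A_inj : forall a b a' b', (a < n)%N -> (b < n)%N -> (a' < n)%N -> (b' < n)%N ->
  (A a b == A a' b') = (a == a') && (b == b').
Hypothesis F_pos : forall b, (b < n)%N -> 0 < F b b.

(** Content of the cell of entry (a, b) of the lower triangle before and after its
    column has been treated. *)
Definition chol_entry (done : bool) a b :=
  if done then F a b else \sum_(0 <= t < b.+1) F a t * F b t.

(** The computed entries are compared with a given factor F instead of being shown
    to be a factor, so that the square roots and quotients are known to be
    legitimate. *)
Lemma run_cholesky m :
  (forall a b, (b <= a < n)%N -> m (A a b) = \sum_(0 <= t < b.+1) F a t * F b t) ->
  forall a b, (b <= a < n)%N -> run ev (cholesky n A) m (A a b) = F a b.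
Proof.
move=> m0.
suff H : forall a b, (b <= a < n)%N ->
    run ev (cholesky n A) m (A a b) = chol_entry (b < 0 + n)%N a b.
  by move=> a b /[dup] hab /H ->; rewrite /chol_entry ifT//; lia.
apply: (run_loop (P := fun k m' => forall a b, (b <= a < n)%N ->
  m' (A a b) = chol_entry (b < k)%N a b)).
  by move=> a b /m0 ->.
move=> b {m m0}m; rewrite add0n => /andP[_ bn] mb.
rewrite run_cat run_cons.
set m1 := run ev _ m; have [|m1b m1f] := run_submul_loop (A_Tmp bn bn) _ (erefl m1).
  by move=> t tb; rewrite !A_inj ?A_Tmp//; lia.
have {}m1b : m1 (A b b) = F b b ^+ 2.
  rewrite m1b mb ?leqnn// /chol_entry ltnn add0n big_nat_recr//= expr2.
  rewrite [X in _ - X](eq_big_nat _ _ (F2 := fun t => F b t * F b t)).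
    by rewrite addrAC subrr add0r.
  by move=> t /andP[_ tb]; rewrite mb /chol_entry ?tb//; lia.
have {}m1f a' b' : (b' <= a' < n)%N -> ~~ ((a' == b) && (b' == b)) ->
    m1 (A a' b') = chol_entry (b' < b)%N a' b'.
  move=> h ne; rewrite m1f ?mb//; last by rewrite A_Tmp//; lia.
  by rewrite A_inj//; lia.
have m2E a' b' : (b' <= a' < n)%N -> step ev m1 (iSqrt (A b b) (A b b)) (A a' b') =
  chol_entry ((b' < b) || ((b' == b) && (a' < b.+1)))%N a' b'.
  move=> h; rewrite /= writeE A_inj; try lia.
  case: ifP => [/andP[/eqP -> /eqP ->]|ne].
    by rewrite m1b sqrtr_sqr gtr0_norm ?F_pos// /chol_entry ltnn eqxx ltnSn.
  rewrite m1f// ?ne//; congr chol_entry; lia.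
move: (step _ _ _) m2E => m2 m2E {m1 m1b m1f}.
have H : forall a' b', (b' <= a' < n)%N ->
  run ev (flatten [seq flatten [seq submul (A a b) (A a t) (A b t) | t <- iota 0 b]
         ++ [:: iDiv (A a b) (A a b) (A b b)]
       | a <- iota b.+1 (n - b.+1)]) m2 (A a' b') =
    chol_entry ((b' < b) || ((b' == b) && (a' < b.+1 + (n - b.+1))))%N a' b'.
  apply: (run_loop (P := fun k m' => forall a' b', (b' <= a' < n)%N ->
    m' (A a' b') = chol_entry ((b' < b) || ((b' == b) && (a' < k)))%N a' b')) => //.
  move=> a m' ha m'E a' b' h; rewrite run_cat run_cons.
  have an : (a < n)%N by lia.
  set m1 := run ev _ m'; have [|m1b m1f] := run_submul_loop (A_Tmp an bn) _ (erefl m1).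
    by move=> t tb; rewrite !A_inj ?A_Tmp//; lia.
  rewrite /run /= writeE A_inj//; try lia.
  case: ifP => [/andP[/eqP -> /eqP ->]|ne].
    rewrite m1b (m1f (A b b)) ?A_inj ?A_Tmp//; try lia.
    rewrite !m'E; try lia.
    rewrite /chol_entry eqxx /= !ltnn /= ifT; last by lia.
    rewrite add0n big_nat_recr//=.
    rewrite [X in _ - X](eq_big_nat _ _ (F2 := fun t => F a t * F b t)).
      by rewrite ltnSn addrAC subrr add0r mulfK// lt0r_neq0// F_pos.
    by move=> t /andP[_ tb]; rewrite !m'E /chol_entry ?tb//; lia.
  rewrite m1f ?A_inj ?A_Tmp ?ne//; try lia.
  rewrite m'E//; congr chol_entry; lia.
move=> a' b' h; rewrite H//; congr chol_entry; lia.
Qed.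

Section Substitution.
Variable y : nat -> cell I.
Hypothesis y_Tmp : forall a, (a < n)%N -> y a != Tmp.
Hypothesis y_inj : forall a b, (a < n)%N -> (b < n)%N -> (y a == y b) = (a == b).
Hypothesis y_A : forall a b t, (a < n)%N -> (b < n)%N -> (t < n)%N -> A a b != y t.

Lemma run_forward q m m' :
  (q <= n)%N ->
  (forall a b, (b <= a < n)%N -> m (A a b) = F a b) ->
  run ev (forward_subst n A y q) m = m' ->
  (forall a b, (b <= a < n)%N -> m' (A a b) = F a b) /\
  forall a, (q <= a < n)%N ->
    \sum_(q <= t < a.+1) F a t * m' (y t) = (a == q)%:R.
Proof.
move=> qn mA <-.
suff [HA Hy] : (forall a b, (b <= a < n)%N -> run ev (forward_subst n A y q) m (A a b) = F a b) /\
  forall a, (q <= a < q + (n - q))%N ->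
    \sum_(q <= t < a.+1) F a t * run ev (forward_subst n A y q) m (y t) = (a == q)%:R.
  by split=> // a qa; apply: Hy; lia.
apply: (run_loop (P := fun k m' => (forall a b, (b <= a < n)%N -> m' (A a b) = F a b) /\
  forall a, (q <= a < k)%N -> \sum_(q <= t < a.+1) F a t * m' (y t) = (a == q)%:R)).
  by split=> // a; lia.
move=> a {mA}m ha [mA my]; rewrite run_cons run_cat run_cons.
have an : (a < n)%N by lia.
set m1 := step _ m _.
set m2 := run ev _ m1; have [|m2b m2f] := run_submul_loop (y_Tmp an) _ (erefl m2).
  by move=> t tb; rewrite !y_A ?y_inj ?A_Tmp ?y_Tmp//; lia.
have m1E c : c != y a -> m1 c = m c by move=> ca; rewrite /m1/= writeE ifN.
have m2E c : c != y a -> c != Tmp -> m2 c = m c by move=> ca cT; rewrite m2f// m1E.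
rewrite /run /=; set m3 := write m2 _ _.
have m3a : m3 (y a) = m2 (y a) / m2 (A a a) by rewrite /m3 writeE eqxx.
have m3E c : c != y a -> c != Tmp -> m3 c = m c by move=> ca cT; rewrite /m3 writeE ifN// m2E.
clearbody m3; split.
  by move=> a' b' h; rewrite m3E ?mA ?y_A ?A_Tmp//; lia.
have final t : (t < a)%N -> m3 (y t) = m (y t).
  by move=> ta; rewrite m3E ?y_inj ?y_Tmp//; lia.
move=> a' /andP[qa']; rewrite ltnS leq_eqVlt => /orP[/eqP ->|lt]; last first.
  rewrite -[RHS]my; last by lia.
  by apply: eq_big_nat => t ht; rewrite final//; lia.
rewrite big_nat_recr/=; last by lia.
rewrite m3a (m2E (A a a)) ?y_A ?A_Tmp// mA ?leqnn// [F a a * _]mulrC divfK; last by rewrite lt0r_neq0// F_pos.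
rewrite m2b /m1 /= writeE eqxx.
rewrite subnKC; last by lia.
rewrite [X in _ + (_ - X)](eq_big_nat _ _ (F2 := fun t => F a t * m3 (y t))).
  by rewrite addrC subrK.
move=> t ht; rewrite final; last by lia.
by rewrite -/(step ev m (iBit (y a) (a == q))) -/m1 !m1E ?y_A ?y_inj ?mA//; lia.
Qed.

Lemma run_backward m m' :
  (forall a b, (b <= a < n)%N -> m (A a b) = F a b) ->
  run ev (backward_subst n A y) m = m' ->
  forall a, (a < n)%N ->
    \sum_(a <= t < n) F t a * m' (y t) = m (y a).
Proof.
move=> mA <-.
suff [_ [_ H]] : (forall a b, (b <= a < n)%N -> run ev (backward_subst n A y) m (A a b) = F a b) /\
  (forall a, (a < 0)%N -> run ev (backward_subst n A y) m (y a) = m (y a)) /\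
  forall a, (0 <= a < n)%N ->
    \sum_(a <= t < n) F t a * run ev (backward_subst n A y) m (y t) = m (y a).
  by move=> a an; apply: H.
apply: (run_loop_rev (P := fun k m' => (forall a b, (b <= a < n)%N -> m' (A a b) = F a b) /\
  (forall a, (a < k)%N -> m' (y a) = m (y a)) /\
  forall a, (k <= a < n)%N -> \sum_(a <= t < n) F t a * m' (y t) = m (y a))).
  by split=> //; split=> // a; lia.
move=> a {}m' an [m'A [m'0 m'y]]; rewrite run_cat run_cons.
set m2 := run ev _ m'; have [|m2b m2f] := run_submul_loop (y_Tmp an) _ (erefl m2).
  by move=> t tb; rewrite !y_A ?y_inj ?A_Tmp ?y_Tmp//; lia.
rewrite /run /=; set m3 := write m2 _ _.
have m3a : m3 (y a) = m2 (y a) / m2 (A a a) by rewrite /m3 writeE eqxx.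
have m3E c : c != y a -> c != Tmp -> m3 c = m' c by move=> ca cT; rewrite /m3 writeE ifN// m2f.
clearbody m3; split.
  by move=> a' b' h; rewrite m3E ?m'A ?y_A ?A_Tmp//; lia.
have final t : (t < n)%N -> t != a -> m3 (y t) = m' (y t).
  by move=> ta ne; rewrite m3E ?y_inj ?y_Tmp//; lia.
split=> [t ta|a' /andP[]]; first by rewrite final ?m'0//; lia.
rewrite leq_eqVlt => /orP[/eqP <- _|lt a'n]; last first.
  rewrite -[RHS]m'y; last by lia.
  by apply: eq_big_nat => t ht; rewrite final//; lia.
rewrite big_ltn// m3a (m2f (A a a)) ?y_A ?A_Tmp// m'A ?leqnn// [F a a * _]mulrC divfK; last by rewrite lt0r_neq0// F_pos.
rewrite m2b m'0// subnKC//.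
rewrite [X in _ - X + _](eq_big_nat _ _ (F2 := fun t => F t a * m3 (y t))).
  by rewrite subrK.
by move=> t ht; rewrite final ?m'A//; lia.
Qed.
End Substitution.
End Matrix.

Lemma run_load i0 (s : seq I) m a b : (a < size s)%N -> (b < size s)%N ->
  run ev (load i0 s) m (Mat a b) = ev (nth i0 s a) (nth i0 s b).
Proof.
move=> ha hb; rewrite /load.
have -> : [seq iEval (Mat a b) (nth i0 s a) (nth i0 s b) | a <- iota 0 (size s), b <- iota 0 (size s)]
  = [seq iEval (Mat x.1 x.2) (nth i0 s x.1) (nth i0 s x.2) |
      x <- [seq (a, b) | a <- iota 0 (size s), b <- iota 0 (size s)]].
  by rewrite map_allpairs.
have : (a, b) \in [seq (a, b) | a <- iota 0 (size s), b <- iota 0 (size s)].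
  by apply: allpairs_f; rewrite mem_iota.
set xs := [seq (a, b) | a <- _, b <- _].
elim/last_ind: xs => [//|xs x IH]; rewrite mem_rcons inE map_rcons -cats1 run_cat.
rewrite [run _ [:: _] _]/run/= writeE.
case: (eqVneq (a, b) x) => [<- _|ne /= /IH ->]; first by rewrite eqxx.
rewrite ifN//; apply: contraNneq ne => -[-> ->].
Qed.
End Run.

(** * The program of one column and of one supernode *)

Section Dests.
Variables (I : Type) (P : pred (cell I)).
Hypothesis P_Tmp : P Tmp.
Local Notation writes_in := (all (fun o => P (dest o))).

Lemma submul_loop_dest c (g h : nat -> cell I) r :
  P c -> writes_in (flatten [seq submul c (g t) (h t) | t <- r]).
Proof. by move=> Pc; rewrite all_flatten_map; apply/allP => t _ /=; rewrite P_Tmp Pc. Qed.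

Lemma cholesky_dest n A : (forall a b, P (A a b)) -> writes_in (cholesky n A).
Proof.
move=> PA; rewrite /cholesky all_flatten_map; apply/allP => b _.
rewrite all_cat submul_loop_dest//= PA all_flatten_map; apply/allP => a _.
by rewrite all_cat submul_loop_dest//= PA.
Qed.

Lemma forward_dest n A y q : (forall a, P (y a)) -> writes_in (forward_subst n A y q).
Proof.
move=> Py; rewrite /forward_subst all_flatten_map; apply/allP => a _.
by rewrite /= all_cat submul_loop_dest//= Py.
Qed.

Lemma backward_dest n A y : (forall a, P (y a)) -> writes_in (backward_subst n A y).
Proof.
move=> Py; rewrite /backward_subst all_flatten_map; apply/allP => a _.
by rewrite all_cat submul_loop_dest//= Py.
Qed.

Lemma load_dest i0 s : (forall a b, P (Mat a b)) -> writes_in (load i0 s).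
Proof.
move=> PM; rewrite /load all_flatten_map; apply/allP => a _.
by rewrite all_map; apply/allP => b _ /=.
Qed.
End Dests.

Section Blocks.
Variables (R : realType) (N : nat) (ev : 'I_N -> 'I_N -> R).
Local Notation I := 'I_N.

Lemma sum_range_ord lo hi n (g : nat -> R) : (hi <= n)%N ->
  \sum_(lo <= t < hi) g t = \sum_(t < n) if (lo <= t < hi)%N then g t else 0.
Proof.
move=> hin; rewrite (big_nat_widenl _ 0%N)// (big_nat_widen _ _ n)// big_mkcond big_mkord.
by apply: eq_bigr.
Qed.

Lemma sum_shift_ord q n (g : nat -> R) :
  \sum_(q <= t < n) g t = \sum_(b < n - q) g (q + b)%N.
Proof.
by rewrite -{1}[q]add0n big_addn big_mkord; apply: eq_bigr => b _; rewrite addnC.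
Qed.

(** The solution v of Theta v = e_0 satisfies v_0 = |z|^2 > 0 for z the solution of
    the first triangular system, which makes the division by sqrt v_0 legitimate. *)
Lemma run_column_program (k : I) (s : seq I) m m' :
  uniq s -> (0 < size s)%N -> nth k s 0 = k ->
  positive_definite (\matrix_(a < size s, b < size s) ev (nth k s a) (nth k s b)) ->
  run ev (column_program k s) m = m' ->
  let y a := m' (Out (nth k s a) k) in
  0 < y 0%N /\ forall a, (a < size s)%N ->
    \sum_(b < size s) ev (nth k s b) (nth k s a) * y b = (a == 0)%:R / y 0%N.
Proof.
move=> us s0 s0k pdT <-; set n := size s in s0 pdT *.
have [F [Fpos FE]] := @cholesky_exists _ n (fun a b => ev (nth k s a) (nth k s b)) pdT.
rewrite /column_program -/n !run_cat run_cons.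
set m1 := run ev (load k s) m; set m2 := run ev _ m1; set m3 := run ev _ m2.
set m4 := run ev _ m3; set m5 := step ev m4 _; set m6 := run ev _ m5.
(* m2 holds the factor, m3 and m4 the solutions of the two triangular systems,
   m6 the output. *)
have m2E a b : (b <= a < n)%N -> m2 (Mat a b) = F a b.
  apply: run_cholesky => // {}a {}b hab.
  have [an bn] : (a < size s)%N /\ (b < size s)%N by rewrite -/n; lia.
  by rewrite /m1 run_load//; exact: FE.
have VecT a : (a < n)%N -> Vec a != Tmp :> cell I by [].
have MatT a b : (a < n)%N -> (b < n)%N -> Mat a b != Tmp :> cell I by [].
have VecI a b : (a < n)%N -> (b < n)%N -> (Vec a == Vec b :> cell I) = (a == b).
  by move=> _ _; apply/eqP/eqP => [[]|->].
have MatV a b t : (a < n)%N -> (b < n)%N -> (t < n)%N -> Mat a b != Vec t :> cell I by [].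
have [m3M m3V] := run_forward MatT Fpos VecT VecI MatV (leq0n n) m2E (erefl m3).
have m4V := run_backward MatT Fpos VecT VecI MatV m3M (erefl m4).
pose Fm : 'M[R]_n := \matrix_(a, t) if (t <= a)%N then F a t else 0.
pose T : 'M[R]_n := \matrix_(a, b) ev (nth k s a) (nth k s b).
have TE : T = Fm *m Fm^T.
  have H (a b : 'I_n) : (b <= a)%N -> T a b = (Fm *m Fm^T) a b.
    move=> ba; rewrite !mxE FE ?ba ?ltn_ord// (sum_range_ord _ _ (ltn_ord b)); apply: eq_bigr => t _.
    rewrite !mxE leq0n ltnS; case: (boolP (t <= b)%N) => tb; last by rewrite mulr0.
    by rewrite (leq_trans tb ba).
  apply/matrixP => a b; have [/H //|/ltnW/H ab] := leqP b a.
  have symT : T^T = T := pdT.1.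
  rewrite -{1}symT mxE ab.
  have symF : (Fm *m Fm^T)^T = Fm *m Fm^T by rewrite trmx_mul trmxK.
  by rewrite -{1}symF mxE.
pose z : 'cV[R]_n := \col_a m3 (Vec a); pose v : 'cV[R]_n := \col_a m4 (Vec a).
pose o0 := Ordinal s0; pose e0 : 'cV[R]_n := \col_a (a == o0)%:R.
have Fz : Fm *m z = e0.
  apply/colP => a; rewrite !mxE -val_eqE /= -m3V ?ltn_ord// (sum_range_ord _ _ (ltn_ord a)).
  by apply: eq_bigr => t _; rewrite !mxE leq0n ltnS; case: ifP; rewrite ?mul0r.
have Fv : Fm^T *m v = z.
  apply/colP => a; rewrite !mxE -m4V ?ltn_ord// (sum_range_ord _ _ (leqnn n)).
  by apply: eq_bigr => t _; rewrite !mxE ltn_ord andbT; case: ifP; rewrite ?mul0r.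
have Tv : T *m v = e0 by rewrite TE -mulmxA Fv.
have v0 : 0 < v o0 ord0.
  have -> : v o0 ord0 = (e0^T *m v) ord0 ord0.
    rewrite [RHS]mxE (bigD1 o0)//= big1 ?addr0; first by rewrite !mxE eqxx mul1r.
    by move=> a ao; rewrite !mxE (negbTE ao) mul0r.
  rewrite -Fz trmx_mul -mulmxA Fv mxE (bigD1 o0)//=.
  have z0 : z o0 ord0 * F 0%N 0%N = 1.
    by have := m3V 0%N s0; rewrite big_nat1 mxE mulrC => ->.
  have zn : z o0 ord0 != 0 by apply: contra_eq_neq z0 => ->; rewrite mul0r eq_sym oner_eq0.
  rewrite [_^T _ _]mxE -expr2 ltr_pwDl ?exprn_even_gt0//.
  by apply: sumr_ge0 => a _; rewrite [_^T _ _]mxE -expr2 sqr_ge0.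
have m5V a : m5 (Vec a) = m4 (Vec a) by [].
have m5T : m5 Tmp = Num.sqrt (v o0 ord0) by rewrite /m5/= writeE eqxx mxE.
have m6E a : (a < n)%N -> m6 (Out (nth k s a) k) = m4 (Vec a) / Num.sqrt (v o0 ord0).
  pose P b m := (forall a, m (Vec a) = m4 (Vec a)) /\ m Tmp = Num.sqrt (v o0 ord0) /\
    forall a, (a < b)%N -> m (Out (nth k s a) k) = m4 (Vec a) / Num.sqrt (v o0 ord0).
  have [_ [_ H]] // : P (0 + n)%N m6; last exact: H.
  have -> : m6 = run ev (flatten [seq [:: iDiv (Out (nth k s a) k) (Vec a) Tmp] | a <- iota 0 n]) m5.
    by rewrite /m6; congr run; elim: (iota 0 n) => //= b r ->.
  apply: run_loop => // b m7; rewrite add0n => /andP[_ bn] [mV [mT mO]].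
  split=> //; split=> // c; rewrite ltnS leq_eqVlt /run/= writeE mV mT => /orP[/eqP ->|cb].
    by rewrite eqxx.
  rewrite ifN ?mO//; apply/eqP => -[/eqP]; rewrite nth_uniq//; first by rewrite ltn_eqF.
  exact: ltn_trans bn.
have v0E : m4 (Vec 0) = v o0 ord0 by rewrite mxE.
split; first by rewrite m6E// v0E divr_gt0// sqrtr_gt0.
move=> a an; rewrite !m6E//.
rewrite v0E.
have -> : v o0 ord0 / Num.sqrt (v o0 ord0) = Num.sqrt (v o0 ord0).
  by rewrite -{1}(sqr_sqrtr (ltW v0)) expr2 mulfK// lt0r_neq0// sqrtr_gt0.
have /colP/(_ (Ordinal an)) := Tv; rewrite !mxE -val_eqE/= => <-.
rewrite mulr_suml; apply: eq_bigr => b _.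
have /matrixP/(_ b (Ordinal an)) := pdT.1; rewrite !mxE/= => ->.
by rewrite m6E// mulrA -v0E.
Qed.

(** Let y solve the triangular system U^T y = e_q, extended by zero before q.
    Then Theta y = U e_q, and the entries of U e_q after position q vanish because
    U is upper triangular; the entry at q is U_qq = 1 / y_q. *)
Lemma run_supernode_program (k1 k : I) (ks s : seq I) m m' :
  uniq s -> uniq ks -> {subset ks <= s} -> k \in ks ->
  positive_definite (\matrix_(a < size s, b < size s) ev (nth k1 s a) (nth k1 s b)) ->
  run ev (supernode_program k1 ks s) m = m' ->
  let q := index k s in
  let y a := m' (Out (nth k1 s (q + a)) k) in
  0 < y 0%N /\ forall a, (a < size s - q)%N ->
    \sum_(b < size s - q) ev (nth k1 s (q + b)) (nth k1 s (q + a)) * y b = (a == 0)%:R / y 0%N.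
Proof.
move=> us uks kss kks pdT <- q; set n := size s in pdT *.
have qn : (q < n)%N by rewrite index_mem kss.
(* The factorization runs on the reversed matrix, hence yields U after the
   positions have been reversed by r. *)
pose r a := (n.-1 - a)%N.
have rlt a : (a < n)%N -> (r a < n)%N by rewrite /r; lia.
have rK a : (a < n)%N -> r (r a) = a by rewrite /r; lia.
have pdr : positive_definite (\matrix_(a < n, b < n) ev (nth k1 s (r a)) (nth k1 s (r b))).
  have := pd_sub pdT (@rev_ord_inj n); congr positive_definite.
  by apply/matrixP => a b; rewrite !mxE /r /= !subnS !predn_sub.
have [F [Fpos FE]] := @cholesky_exists _ n (fun a b => ev (nth k1 s (r a)) (nth k1 s (r b))) pdr.
rewrite /supernode_program -/n !run_cat.
set m1 := run ev (load k1 s) m; set m2 := run ev _ m1; set m3 := run ev _ m2.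
have m2E a b : (b <= a < n)%N -> m2 (Mat (r a) (r b)) = F a b.
  move: a b; apply: (@run_cholesky _ _ ev n (fun a b => Mat (r a) (r b))) => //.
    move=> a b a' b' an bn an' bn'; apply/eqP/andP => [[ea eb]|[/eqP -> /eqP ->]//].
    by split; apply/eqP; move: ea eb; rewrite /r; lia.
  move=> a b hab; rewrite -FE//.
  have [an bn] : (r a < size s)%N /\ (r b < size s)%N by rewrite -/n !rlt//; lia.
  by rewrite /m1 run_load.
pose U a t := F (r a) (r t).
have UE a b : (b <= a < n)%N -> m2 (Mat b a) = U b a.
  by move=> hab; rewrite /U -m2E ?rK//; rewrite /r; lia.
pose Q (c : cell I) := if c is Out _ k' then k' == k else false.
pose f k := forward_subst n (fun a b => Mat b a : cell I) (fun a => Out (nth k1 s a) k) (index k s).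
have [k' _ k'k|ks1 [_ m3E]] := @run_block _ _ ev _ f ks k Q m2 uks kks.
  exact: (@forward_dest _ (fun c => ~~ Q c)).
set m4 := run ev (flatten (map f ks1)) m2 in m3E.
have m4E a b : (b <= a < n)%N -> m4 (Mat b a) = U b a.
  move=> hab; rewrite -UE// /m4 run_frame// all_flatten_map; apply/allP => k' _.
  exact: (forward_dest (P := fun c => Mat b a != c)).
have OutT a : (a < n)%N -> Out (nth k1 s a) k != Tmp by [].
have MatT a b : (a < n)%N -> (b < n)%N -> Mat b a != Tmp :> cell I by [].
have OutI a b : (a < n)%N -> (b < n)%N -> (Out (nth k1 s a) k == Out (nth k1 s b) k) = (a == b).
  move=> an bn; rewrite -(nth_uniq k1 an bn us).
  by apply/eqP/eqP => [[]//|->].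
have MatO a b t : (a < n)%N -> (b < n)%N -> (t < n)%N -> Mat b a != Out (nth k1 s t) k by [].
have Upos b : (b < n)%N -> 0 < U b b by move=> bn; rewrite Fpos// rlt.
have [_ fwd] := run_forward (F := fun a b => U b a) MatT Upos OutT OutI MatO (ltnW qn) m4E (erefl (run ev (f k) m4)).
(* The entries of the solution before q are not stored; they count as zero. *)
pose Y t := if (q <= t)%N then m3 (Out (nth k1 s t) k) else 0.
pose Um : 'M[R]_n := \matrix_(a, t) if (a <= t)%N then U a t else 0.
pose T : 'M[R]_n := \matrix_(a, b) ev (nth k1 s a) (nth k1 s b).
have TE : T = Um *m Um^T.
  have H (a b : 'I_n) : (a <= b)%N -> T a b = (Um *m Um^T) a b.
    move=> ab; rewrite !mxE.
    have := FE (r a) (r b); rewrite !rK// => ->; last by rewrite /r; have := ltn_ord b; lia.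
    rewrite (sum_range_ord _ _ (rlt _ (ltn_ord b))) (reindex_inj (@rev_ord_inj n)).
    apply: eq_bigr => t _; rewrite !mxE /U -/(r _).
    have -> : (0 <= rev_ord t < (r b).+1)%N = (b <= t)%N.
      by rewrite /r /=; have := ltn_ord b; have := ltn_ord t; lia.
    have -> : nat_of_ord (rev_ord t) = r t by rewrite /r /=; lia.
    case: (boolP (b <= t)%N) => bt; last by rewrite mulr0.
    by rewrite (leq_trans ab bt).
  apply/matrixP => a b; have [/H //|/ltnW/H ab] := leqP a b.
  have symT : T^T = T := pdT.1.
  rewrite -{1}symT mxE ab.
  have symF : (Um *m Um^T)^T = Um *m Um^T by rewrite trmx_mul trmxK.
  by rewrite -{1}symF mxE.
pose yv : 'cV[R]_n := \col_t Y t; pose oq := Ordinal qn.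
pose eq : 'cV[R]_n := \col_a (a == oq)%:R.
have m3O a : m3 (Out (nth k1 s a) k) = run ev (f k) m4 (Out (nth k1 s a) k).
  by apply: m3E; rewrite /Q eqxx.
have Uy : Um^T *m yv = eq.
  apply/colP => a; rewrite !mxE -val_eqE/=.
  have [qa|aq] := leqP q a.
    rewrite -fwd ?qa ?ltn_ord// (sum_range_ord _ _ (ltn_ord a)).
    apply: eq_bigr => t _; rewrite !mxE /Y ltnS andbC -m3O.
    by case: (t <= a)%N; case: (q <= t)%N; rewrite ?mul0r ?mulr0.
  rewrite big1 ?ltn_eqF// => t _; rewrite !mxE /Y.
  case: ifP => ta; last by rewrite mul0r.
  by rewrite ifN ?mulr0// -ltnNge (leq_ltn_trans ta).
have Tyv (a : 'I_n) : (q <= a)%N -> (T *m yv) a ord0 = (a == oq)%:R * U q q.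
  move=> qa; rewrite TE -mulmxA Uy mxE (bigD1 oq)//= [X in _ + X]big1 ?addr0 => [|t tq]; last first.
    by rewrite [eq _ _]mxE (negbTE tq) mulr0.
  rewrite [eq _ _]mxE eqxx mulr1 mxE -val_eqE/=.
  have [<-|aq] := eqVneq (a : nat) q; first by rewrite leqnn mul1r.
  by rewrite mul0r ifN// -ltnNge ltn_neqAle eq_sym aq.
have y0 : U q q * m3 (Out (nth k1 s q) k) = 1.
  by have := fwd q; rewrite leqnn qn big_nat1 eqxx m3O; apply.
have Uq : U q q = (m3 (Out (nth k1 s q) k))^-1.
  have x0 : m3 (Out (nth k1 s q) k) != 0.
    by apply: contra_eq_neq y0 => ->; rewrite mulr0 eq_sym oner_eq0.
  by apply: (mulIf x0); rewrite y0 mulVf.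
have m30 : 0 < m3 (Out (nth k1 s q) k).
  by rewrite -invr_gt0 -Uq Upos.
rewrite addn0; split=> // a an.
have qan : (q + a < n)%N by lia.
have := Tyv (Ordinal qan) (leq_addr _ _).
rewrite -Uq -val_eqE/= -[X in _ == X]addn0 eqn_add2l => <-.
rewrite mxE.
transitivity (\sum_(q <= t < n) ev (nth k1 s (q + a)) (nth k1 s t) * m3 (Out (nth k1 s t) k)).
  rewrite sum_shift_ord; apply: eq_bigr => b _.
  have qbn : (q + b < n)%N by have := ltn_ord b; lia.
  have /matrixP/(_ (Ordinal qbn) (Ordinal qan)) := pdT.1.
  by rewrite !mxE/= => ->.
rewrite (sum_range_ord _ _ (leqnn n)); apply: eq_bigr => t _.
by rewrite !mxE/= /Y ltn_ord andbT; case: ifP; rewrite ?mulr0.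
Qed.
End Blocks.

(** * Exactness of the two algorithms *)

Section Correctness.
Variables (R : realType) (d N : nat) (prec : rel 'I_N) (S : {set 'I_N * 'I_N}).
Variables (G : 'rV[R]_d -> 'rV[R]_d -> R) (x : 'I_N -> 'rV[R]_d).
Hypothesis so : strict_total_order prec.
Hypothesis pdT : positive_definite (kernel_mx G x).
Hypothesis lowS : lower_pattern prec S.
Local Notation ev := (fun i j => G (x i) (x j)).
Local Notation Theta := (kernel_mx G x).

Lemma kernel_entry i j : G (x i) (x j) = Theta i j.
Proof. by rewrite mxE. Qed.

Lemma pd_listing k1 (s : seq 'I_N) : uniq s ->
  positive_definite (\matrix_(a < size s, b < size s) ev (nth k1 s a) (nth k1 s b)).
Proof.
move=> us; have := @pd_sub _ (size s) N Theta (fun a => nth k1 s a) pdT.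
have -> : \matrix_(a, b) Theta (nth k1 s a) (nth k1 s b) =
  \matrix_(a < size s, b < size s) ev (nth k1 s a) (nth k1 s b).
  by apply/matrixP => a b; rewrite !mxE.
by apply=> a b /eqP; rewrite nth_uniq// => /eqP/val_inj.
Qed.

Lemma row_output (s : seq 'I_N) k1 k (m : memory R 'I_N) : s =i column S k ->
  (col k (output S m))^T =
  \row_i if i \in s then m (Out (nth k1 s (index i s)) k) else 0.
Proof.
move=> sE; apply/rowP => i; rewrite !mxE sE inE.
by case: ifP => // iS; rewrite nth_index// sE inE.
Qed.

Lemma non_aggregated_correct : computes_KL_factor prec S G x (non_aggregated prec S).
Proof.
split; first exact: KL_factor_minimizer.
move=> m; apply: (KL_factor_eq so pdT lowS) => k.
set s := listing prec (column S k).
have us : uniq s by exact: listing_uniq.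
have ks : k \in s by rewrite mem_listing inE lowS.1.
have s0 : (0 < size s)%N by rewrite -has_predT; apply/hasP; exists k.
have sk : nth k s 0 = k by exact: listing_column_head.
pose Q (c : cell 'I_N) := if c is Out _ k' then k' == k else false.
pose f k := column_program k (listing prec (column S k)).
have [k' _ k'k|s1 [_ mE]] := @run_block _ _ ev _ f (enum 'I_N) k Q m (enum_uniq _) (mem_enum _ _).
  pose NQ c := ~~ Q c; rewrite -/(all (fun o => NQ (dest o)) _).
  rewrite /f /column_program !all_cat (@load_dest _ NQ)// (@cholesky_dest _ NQ)//.
  rewrite (@forward_dest _ NQ)// (@backward_dest _ NQ)//=.
  by rewrite all_map; apply/allP.
set m' := run _ (non_aggregated _ _) m; set m0 := run _ (flatten (map f s1)) m in mE.
have [y0 eqy] := run_column_program us s0 sk (pd_listing k us) (erefl (run ev (f k) m0)).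
rewrite (row_output k m' (s := s)); last by move=> i; rewrite mem_listing.
have E a : m' (Out (nth k s a) k) = run ev (f k) m0 (Out (nth k s a) k).
  by rewrite -mE// /Q eqxx.
apply: (kl_column_of_seq (y := fun a => m' (Out (nth k s a) k))) => //.
- by move=> i; rewrite mem_listing.
- by rewrite E.
move=> a /eqy; rewrite E => <-; apply: eq_bigr => b _.
by rewrite E kernel_entry.
Qed.

Variable nodes : seq ('I_N * seq 'I_N).
Hypothesis uniq_nodes : uniq nodes.
Hypothesis cover_nodes : forall k, exists2 K, K \in nodes & k \in K.2.
Hypothesis disjoint_nodes : forall K K' k, K \in nodes -> K' \in nodes ->
  k \in K.2 -> k \in K'.2 -> K = K'.
Hypothesis uniq_members : forall K, K \in nodes -> uniq K.2.
Hypothesis node_column : forall K k, K \in nodes -> k \in K.2 ->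
  column S k =i [pred i | (i \in rows S K) && preceq prec k i].

Lemma member_rows K k : k \in K.2 -> k \in rows S K.
Proof. by move=> kK; apply/bigcupP; exists k => //; rewrite inE lowS.1. Qed.

(** The hypotheses say that the nodes partition the indices, and that the columns
    of a node are the final segments of its rows. *)
Lemma aggregated_correct : computes_KL_factor prec S G x (aggregated prec nodes S).
Proof.
split; first exact: KL_factor_minimizer.
move=> m; apply: (KL_factor_eq so pdT lowS) => k.
have [K Kn kK] := cover_nodes k.
set s := listing prec (rows S K).
have us : uniq s by exact: listing_uniq.
have ms i : (i \in s) = (i \in rows S K) by rewrite mem_listing.
have ks : k \in s by rewrite ms member_rows.
pose Q (c : cell 'I_N) := if c is Out _ k' then k' == k else false.
pose f (K : 'I_N * seq 'I_N) := supernode_program K.1 K.2 (listing prec (rows S K)).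
have [K' K'n K'K|s1 [_ mE]] := @run_block _ _ ev _ f nodes K Q m uniq_nodes Kn.
  pose NQ c := ~~ Q c; rewrite -/(all (fun o => NQ (dest o)) _).
  rewrite /f /supernode_program !all_cat (@load_dest _ NQ)// (@cholesky_dest _ NQ)//=.
  rewrite all_flatten_map; apply/allP => k' k'K'; apply: (@forward_dest _ NQ) => // a.
  rewrite /NQ /=; apply: contraNneq K'K => e; rewrite e in k'K'.
  by apply/eqP; apply: (disjoint_nodes (k := k)).
set m' := run _ (aggregated _ _ _) m; set m0 := run _ (flatten (map f s1)) m in mE.
have Ks : {subset K.2 <= s} by move=> i iK; rewrite ms member_rows.
set q := index k s.
have [y0 eqy] := run_supernode_program us (uniq_members Kn) Ks kK (pd_listing K.1 us)
  (erefl (run ev (f K) m0)).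
rewrite -/q in y0 eqy.
have sE : drop q s =i column S k.
  apply: (listing_drop so); first exact: member_rows.
  exact: node_column.
rewrite (row_output K.1 m' sE).
have E a : m' (Out (nth K.1 (drop q s) a) k) = run ev (f K) m0 (Out (nth K.1 s (q + a)) k).
  by rewrite nth_drop -mE// /Q eqxx.
apply: (kl_column_of_seq (y := fun a => m' (Out (nth K.1 (drop q s) a) k))).
- exact: drop_uniq.
- by move=> i; rewrite [RHS]sE.
- by rewrite (sE k) inE lowS.1.
- by rewrite nth_drop addn0 nth_index.
- by rewrite E.
rewrite size_drop => a an; rewrite E -eqy//; apply: eq_bigr => b _.
have qb : (q + b < size s)%N by have := ltn_ord b; lia.
have qa : (q + a < size s)%N by lia.
by rewrite E kernel_entry !nth_drop !(set_nth_default k K.1).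
Qed.
End Correctness.

(** * Time and memory of one block *)

Section Time.
Variables (I : Type) (cost : I -> I -> nat) (cmax : nat).
Hypothesis cost_le : forall i j, (cost i j <= cmax)%N.
Local Notation time := (time_cost cost).

Lemma time_cat p1 p2 : time (p1 ++ p2) = (time p1 + time p2)%N.
Proof. by rewrite /time_cost map_cat sumn_cat. Qed.

Lemma time_cons o p : time (o :: p) = (instr_time cost o + time p)%N.
Proof. by []. Qed.

Lemma time_flatten (T : Type) (f : T -> seq (instr I)) s :
  time (flatten (map f s)) = (\sum_(x <- s) time (f x))%N.
Proof.
elim: s => [|x s IH]; first by rewrite big_nil.
by rewrite big_cons /= time_cat IH.
Qed.

Lemma time_flatten_le (T : eqType) (f : T -> seq (instr I)) s b :
  (forall x, x \in s -> time (f x) <= b)%N -> (time (flatten (map f s)) <= size s * b)%N.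
Proof.
move=> fb; rewrite time_flatten -sum1_size big_distrl /= big_seq [leqRHS]big_seq.
by apply: leq_sum => x /fb; rewrite mul1n.
Qed.

Lemma time_submul_loop (c : cell I) (g h : nat -> cell I) r :
  time (flatten [seq submul c (g t) (h t) | t <- r]) = (2 * size r)%N.
Proof. by elim: r => //= t r IH; rewrite time_cons/= time_cons /= IH; lia. Qed.

Lemma time_load i0 s : (time (load i0 s) <= size s * (size s * cmax.+1))%N.
Proof.
rewrite -[X in (_ <= X * _)%N](size_iota 0); apply: time_flatten_le => a _.
rewrite -[X in (_ <= X * _)%N](size_iota 0).
elim: (iota _ _) => //= b r IH; rewrite time_cons mulSn leq_add//= ltnS; exact: cost_le.
Qed.

Lemma time_cholesky n A : (time (@cholesky I n A) <= 6 * n ^ 3)%N.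
Proof.
apply: (@leq_trans (n * (2 * n + (1 + n * (2 * n + 1))))); last by case: n => // n; nia.
rewrite -[X in (_ <= X * _)%N](size_iota 0 n); apply: time_flatten_le => b.
rewrite mem_iota add0n => /andP[_ bn]; rewrite time_cat time_submul_loop size_iota time_cons.
apply: leq_add; first by lia.
rewrite leq_add2l; apply: (@leq_trans (size (iota b.+1 (n - b.+1)) * (2 * n + 1))).
  apply: time_flatten_le => a _; rewrite time_cat time_submul_loop size_iota /time_cost/=; lia.
by rewrite size_iota leq_mul2r leq_subr orbT.
Qed.

Lemma time_forward n A y q : (q <= n)%N -> (time (@forward_subst I n A y q) <= 4 * n ^ 2)%N.
Proof.
move=> qn; apply: (@leq_trans ((n - q) * (2 * n + 2))); last by nia.
rewrite -[X in (_ <= X * _)%N](size_iota q); apply: time_flatten_le => a.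
rewrite mem_iota subnKC// => /andP[qa an].
by rewrite time_cons time_cat time_submul_loop size_iota /time_cost/=; lia.
Qed.

Lemma time_backward n A y : (time (@backward_subst I n A y) <= 3 * n ^ 2)%N.
Proof.
apply: (@leq_trans (n * (2 * n + 1))); last by nia.
rewrite -[X in (_ <= X * _)%N](size_iota 0 n) -(size_rev (iota 0 n)); apply: time_flatten_le => a.
rewrite mem_rev mem_iota add0n => /andP[_ an].
by rewrite time_cat time_submul_loop size_iota /time_cost/=; lia.
Qed.

Lemma time_column_program k s : (0 < size s)%N ->
  (time (column_program k s) <= (cmax + 16) * size s ^ 3)%N.
Proof.
move=> s0; rewrite /column_program !time_cat time_cons.
have -> : time [seq iDiv (Out (nth k s a) k) (Vec a) Tmp | a <- iota 0 (size s)] = size s.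
  rewrite -[RHS](size_iota 0); elim: (iota _ _) => //= a r IH; by rewrite time_cons IH.
have := time_load k s; have := @time_cholesky (size s) Mat.
have := time_forward Mat Vec (leq0n (size s)); have := @time_backward (size s) Mat Vec.
move: (size s) s0 => n n0 /=; set t1 := time _; set t2 := time _; set t3 := time _; set t4 := time _.
move: t1 t2 t3 t4 => t1 t2 t3 t4.
rewrite !expnS expn0 !muln1 => h1 h2 h3 h4.
have n1 : (n <= n * n)%N by nia.
have n2 : (n * n <= n * (n * n))%N by nia.
have n3 : (n * n * cmax <= n * (n * n) * cmax)%N by rewrite leq_mul2r; apply/orP; right; lia.
by nia.
Qed.
End Time.

Lemma time_supernode_program (I : eqType) (cost : I -> I -> nat) (cmax : nat) k1 (ks s : seq I) :
  (forall i j, (cost i j <= cmax)%N) -> uniq ks -> {subset ks <= s} ->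
  (time_cost cost (supernode_program k1 ks s) <= (cmax + 16) * size s ^ 3)%N.
Proof.
move=> cost_le uks kss; rewrite /supernode_program !time_cat.
set A := fun a b : nat => _.
have h1 := time_load cost_le k1 s; have h2 := @time_cholesky _ cost (size s) A.
have h3 : (time_cost cost (flatten [seq forward_subst (size s) (fun a b => Mat b a)
  (fun a => Out (nth k1 s a) k) (index k s) | k <- ks]) <= size ks * (4 * size s ^ 2))%N.
  by apply: time_flatten_le => k _; apply: time_forward; exact: index_size.
have h4 := uniq_leq_size uks kss.
move: (time_cost _ _) (time_cost _ _) (time_cost _ _) h1 h2 h3 => t1 t2 t3.
move: (size s) (size ks) h4 => n m mn; rewrite !expnS expn0 !muln1 => h1 h2 h3.
have n2 : (n * n <= n * (n * n))%N by nia.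
have n3 : (n * n * cmax <= n * (n * n) * cmax)%N by rewrite leq_mul2r n2 orbT.
have n4 : (m * (n * n) <= n * (n * n))%N by rewrite leq_mul2r mn orbT.
by nia.
Qed.

Section Space.
Variables (I : eqType) (P : pred (cell I)).
Hypothesis P_Tmp : P Tmp.
Definition cells_in (p : seq (instr I)) := all (fun o => all P (instr_cells o)) p.

Lemma cells_in_cat p1 p2 : cells_in (p1 ++ p2) = cells_in p1 && cells_in p2.
Proof. exact: all_cat. Qed.

Lemma cells_in_flatten (T : eqType) (f : T -> seq (instr I)) s :
  (forall x, x \in s -> cells_in (f x)) -> cells_in (flatten (map f s)).
Proof. by move=> H; rewrite /cells_in all_flatten_map; apply/allP. Qed.

Lemma cells_submul_loop c (g h : nat -> cell I) lo n : P c ->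
  (forall t, (lo <= t < lo + n)%N -> P (g t) && P (h t)) ->
  cells_in (flatten [seq submul c (g t) (h t) | t <- iota lo n]).
Proof.
move=> Pc H; apply: cells_in_flatten => t; rewrite mem_iota => /H/andP[gt ht].
by rewrite /cells_in /= Pc gt ht P_Tmp.
Qed.

Lemma cells_load i0 s : (forall a b, (a < size s)%N -> (b < size s)%N -> P (Mat a b)) ->
  cells_in (load i0 s).
Proof.
move=> PM; apply: cells_in_flatten => a; rewrite mem_iota => /andP[_ an].
rewrite /cells_in all_map; apply/allP => b; rewrite mem_iota => /andP[_ bn] /=.
by rewrite PM.
Qed.

Lemma cells_cholesky n A : (forall a b, (a < n)%N -> (b < n)%N -> P (A a b)) ->
  cells_in (cholesky n A).
Proof.
move=> PA; apply: cells_in_flatten => b; rewrite mem_iota => /andP[_ bn].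
rewrite cells_in_cat; apply/andP; split.
  by apply: cells_submul_loop => [|t tb]; rewrite ?PA//; lia.
rewrite /cells_in /= PA//=; apply: cells_in_flatten => a; rewrite mem_iota => /andP[ba an].
have {}an : (a < n)%N by lia.
rewrite cells_in_cat /cells_in /= !PA// !andbT.
by apply: cells_submul_loop => [|t tb]; rewrite ?PA//; lia.
Qed.

Lemma cells_forward n A y q : (q <= n)%N ->
  (forall a b, (a < n)%N -> (b < n)%N -> P (A a b)) -> (forall a, (a < n)%N -> P (y a)) ->
  cells_in (forward_subst n A y q).
Proof.
move=> qn PA Py; apply: cells_in_flatten => a; rewrite mem_iota subnKC// => /andP[qa an].
rewrite /cells_in /= Py//= -/(cells_in _) cells_in_cat /cells_in /= Py// PA// !andbT.
by apply: cells_submul_loop => [|t tb]; rewrite ?PA ?Py//; lia.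
Qed.

Lemma cells_backward n A y :
  (forall a b, (a < n)%N -> (b < n)%N -> P (A a b)) -> (forall a, (a < n)%N -> P (y a)) ->
  cells_in (backward_subst n A y).
Proof.
move=> PA Py; apply: cells_in_flatten => a; rewrite mem_rev mem_iota => /andP[_ an].
rewrite cells_in_cat /cells_in /= Py// PA// !andbT.
by apply: cells_submul_loop => [|t tb]; rewrite ?PA ?Py//; lia.
Qed.
End Space.

Lemma space_cost_le (I : eqType) (p : seq (instr I)) (cs : seq (cell I)) :
  cells_in (mem cs) p -> (space_cost p <= size cs)%N.
Proof.
move=> H; apply: uniq_leq_size; first exact: undup_uniq.
move=> c; rewrite mem_undup; elim: p H => //= o p IH /andP[ho /IH hp].
by rewrite mem_cat => /orP[/(allP ho)|/hp].
Qed.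

(** * Time and memory of the algorithms *)

Section TotalCosts.
Variables (R : realType) (N : nat) (prec : rel 'I_N) (S : {set 'I_N * 'I_N}).
Variables (cost : 'I_N -> 'I_N -> nat) (cmax : nat) (M : R).
Hypothesis cost_le : forall i j, (cost i j <= cmax)%N.
Hypothesis N_gt0 : (0 < N)%N.
Hypothesis M_ge1 : 1 <= M.
Hypothesis diagS : forall k, (k, k) \in S.

Lemma size_flatten_map (T U : Type) (f : T -> seq U) s :
  size (flatten (map f s)) = (\sum_(x <- s) size (f x))%N.
Proof. by elim: s => [|x s IH]; rewrite ?big_nil// big_cons /= size_cat IH. Qed.

(** All columns share the same working memory; it has n^2 cells for the largest
    column size n, and n^2 <= N M because n <= N. *)
Lemma non_aggregated_space :
  (forall k, #|column S k|%:R <= M) ->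
  (space_cost (non_aggregated prec S))%:R <= 4 * N%:R * M.
Proof.
move=> colM; pose n := (\max_k #|column S k|)%N.
have nM : n%:R <= M.
  have [|k nE] := @bigop.eq_bigmax _ (fun k => #|column S k|); first by rewrite card_ord.
  by rewrite /n nE; exact: colM.
have nN : (n <= N)%N by apply/bigop.bigmax_leqP => k _; rewrite (leq_trans (max_card _))// card_ord.
have le_n k : (size (listing prec (column S k)) <= n)%N.
  by rewrite size_listing; exact: (bigop.leq_bigmax k).
pose cs := Tmp :: [seq Vec a | a <- iota 0 n] ++ [seq Mat a b | a <- iota 0 n, b <- iota 0 n]
  ++ flatten [seq [seq Out i k | i <- listing prec (column S k)] | k <- enum 'I_N].
have csT : Tmp \in cs by rewrite inE eqxx.
have csV a : (a < n)%N -> Vec a \in cs.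
  by move=> an; rewrite inE mem_cat map_f ?orbT// mem_iota.
have csM a b : (a < n)%N -> (b < n)%N -> Mat a b \in cs.
  by move=> an bn; rewrite inE !mem_cat allpairs_f ?orbT// mem_iota.
have csO i k : i \in column S k -> Out i k \in cs.
  move=> ik; rewrite inE !mem_cat; apply/orP; right; apply/orP; right; apply/orP; right.
  apply/flattenP; exists [seq Out i k | i <- listing prec (column S k)].
    by apply/mapP; exists k; rewrite ?mem_enum.
  by apply: map_f; rewrite mem_listing.
have H : (space_cost (non_aggregated prec S) <= size cs)%N.
  apply: space_cost_le; apply: cells_in_flatten => k _.
  have lek a : (a < size (listing prec (column S k)))%N -> (a < n)%N by move=> /leq_trans; apply.
  rewrite /column_program !cells_in_cat cells_load ?cells_cholesky ?cells_forward ?cells_backward//=;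
    try by move=> *; rewrite ?csM ?csV ?lek.
  rewrite csV; last first.
    by apply: lek; rewrite -has_predT; apply/hasP; exists k; rewrite ?mem_listing ?inE.
  rewrite /cells_in all_map; apply/allP => a; rewrite mem_iota => /andP[_ an] /=.
  rewrite csV ?lek// csO//.
  by rewrite -(mem_listing prec) mem_nth.
apply: (@le_trans _ _ (size cs)%:R); first by rewrite ler_nat.
rewrite /cs /= !size_cat size_map size_allpairs !size_iota size_flatten_map.
under eq_bigr do rewrite size_map size_listing.
rewrite big_enum/=.
have N1 : 1 <= N%:R :> R by rewrite ler1n.
rewrite -natr1 !natrD natrM natr_sum.
have h1 : \sum_k #|column S k|%:R <= N%:R * M.
  rewrite -[X in X%:R * _](card_ord N) -sum1_card natr_sum mulr_suml.
  by apply: ler_sum => k _; rewrite mul1r.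
have nN' : n%:R <= N%:R :> R by rewrite ler_nat.
have n0 : 0 <= n%:R :> R by [].
move: (\sum_k _) h1 => t h1.
have h2 : n%:R * n%:R <= N%:R * M by rewrite ler_pM.
have h3 : 1 <= N%:R * M by rewrite mulr_ege1.
have h4 : n%:R <= N%:R * M by rewrite (le_trans nM)// ler_peMl// (le_trans _ M_ge1).
lra.
Qed.

Lemma non_aggregated_time :
  (forall k, #|column S k|%:R <= M) ->
  (time_cost cost (non_aggregated prec S))%:R <= (cmax + 16)%:R * N%:R * M ^+ 3.
Proof.
move=> colM; rewrite /non_aggregated time_flatten big_enum/= natr_sum.
rewrite -[X in _ * X%:R * _](card_ord N) -sum1_card natr_sum mulr_sumr mulr_suml.
apply: ler_sum => k _; rewrite mulr1.
apply: (@le_trans _ _ ((cmax + 16) * size (listing prec (column S k)) ^ 3)%:R).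
  rewrite ler_nat; apply: time_column_program => //.
  by rewrite -has_predT; apply/hasP; exists k; rewrite ?mem_listing ?inE.
rewrite natrM natrX size_listing ler_wpM2l// lerXn2r// nnegrE//.
exact: le_trans M_ge1.
Qed.

Variable nodes : seq ('I_N * seq 'I_N).
Hypothesis uniq_members : forall K, K \in nodes -> uniq K.2.
Hypothesis size_members : (\sum_(K <- nodes) size K.2 = N)%N.
Hypothesis rowsM : forall K, K \in nodes -> #|rows S K|%:R <= M.

Lemma member_listing_rows K : {subset K.2 <= listing prec (rows S K)}.
Proof.
by move=> k kK; rewrite mem_listing; apply/bigcupP; exists k => //; rewrite inE.
Qed.

Lemma aggregated_space : (space_cost (aggregated prec nodes S))%:R <= 3 * N%:R * M.
Proof.
pose n := (\max_(K <- nodes) #|rows S K|)%N.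
have le_n K : K \in nodes -> (size (listing prec (rows S K)) <= n)%N.
  by move=> Kn; rewrite size_listing; exact: (bigop.leq_bigmax_seq _ Kn).
have nM : n%:R <= M.
  rewrite /n big_seq; elim/big_ind: _ => [|a b aM bM|K]; first exact: le_trans M_ge1.
    by rewrite /maxn; case: ifP.
  exact: rowsM.
have nN : (n <= N)%N.
  apply/bigop.bigmax_leqP_seq => K _ _; rewrite (leq_trans (max_card _))// card_ord//.
pose cs := Tmp :: [seq Mat a b | a <- iota 0 n, b <- iota 0 n]
  ++ flatten [seq flatten [seq [seq Out i k | i <- listing prec (rows S K)] | k <- K.2] | K <- nodes].
have csT : Tmp \in cs by rewrite inE eqxx.
have csM a b : (a < n)%N -> (b < n)%N -> Mat a b \in cs.
  by move=> an bn; rewrite inE !mem_cat allpairs_f ?orbT// mem_iota.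
have csO K i k : K \in nodes -> k \in K.2 -> i \in listing prec (rows S K) -> Out i k \in cs.
  move=> Kn kK iK; rewrite inE !mem_cat; apply/orP; right; apply/orP; right.
  apply/flattenP; exists (flatten [seq [seq Out i k | i <- listing prec (rows S K)] | k <- K.2]).
    by apply/mapP; exists K.
  apply/flattenP; exists [seq Out i k | i <- listing prec (rows S K)]; last exact: map_f.
  by apply/mapP; exists k.
have H : (space_cost (aggregated prec nodes S) <= size cs)%N.
  apply: space_cost_le; apply: cells_in_flatten => K Kn.
  have leK a : (a < size (listing prec (rows S K)))%N -> (a < n)%N.
    by move=> /leq_trans; apply; exact: le_n.
  rewrite /supernode_program !cells_in_cat cells_load ?cells_cholesky//=;
    try by move=> *; rewrite ?csM// ?leK//; lia.
    apply: cells_in_flatten => k kK; apply: cells_forward => //.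
    - exact: index_size.
    - by move=> a b an bn; rewrite [_ _ _]csM ?leK.
    - by move=> a an; apply: (csO K) => //; rewrite mem_nth.
apply: (@le_trans _ _ (size cs)%:R); first by rewrite ler_nat.
rewrite /cs /= size_cat size_allpairs !size_iota size_flatten_map.
have h0 : (\sum_(K <- nodes) size (flatten [seq [seq Out i k | i <- listing prec (rows S K)] | k <- K.2])
    <= n * N)%N.
  rewrite -[X in (_ <= _ * X)%N]size_members big_distrr/= big_seq [leqRHS]big_seq; apply: leq_sum => K Kn.
  rewrite size_flatten_map; under eq_bigr do rewrite size_map.
  by rewrite big_const_seq count_predT iter_addn_0 leq_mul2r le_n ?orbT.
have N1 : 1 <= N%:R :> R by rewrite ler1n.
rewrite -natr1 natrD natrM.
have h1 : (\sum_(K <- nodes) size (flatten [seq [seq Out i k | i <- listing prec (rows S K)] | k <- K.2]))%:R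
  <= n%:R * N%:R :> R by rewrite -natrM ler_nat.
move: (\sum_(K <- nodes) _)%N h1 {h0} => t h1.
have nN' : n%:R <= N%:R :> R by rewrite ler_nat.
have n0 : 0 <= n%:R :> R by [].
have h2 : n%:R * n%:R <= N%:R * M by rewrite ler_pM.
have h3 : 1 <= N%:R * M by rewrite mulr_ege1.
have h4 : n%:R * N%:R <= N%:R * M by rewrite mulrC ler_wpM2l.
lra.
Qed.

(** For a supernode with n rows, n^3 <= M^2 n: this reduces the time to the total
    number of rows. *)
Lemma aggregated_time (W : R) :
  (\sum_(K <- nodes) #|rows S K|)%N%:R <= W ->
  (time_cost cost (aggregated prec nodes S))%:R <= (cmax + 16)%:R * M ^+ 2 * W.
Proof.
move=> HW; apply: (@le_trans _ _ ((cmax + 16)%:R * M ^+ 2 * (\sum_(K <- nodes) #|rows S K|)%N%:R)); last first.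
  by rewrite ler_wpM2l// mulr_ge0// sqr_ge0.
rewrite /aggregated time_flatten !natr_sum mulr_sumr big_seq [leRHS]big_seq.
apply: ler_sum => K Kn.
apply: (@le_trans _ _ ((cmax + 16) * size (listing prec (rows S K)) ^ 3)%:R).
  rewrite ler_nat; apply: time_supernode_program => //; first exact: uniq_members.
  exact: member_listing_rows.
rewrite natrM natrX size_listing -mulrA ler_wpM2l// exprSr ler_wpM2r//.
by rewrite lerXn2r// ?nnegrE// ?rowsM//; exact: le_trans M_ge1.
Qed.
End TotalCosts.

(** * Euclidean distance, greedy aggregation *)

Section Distance.
Variables (R : realType) (d : nat).
Implicit Types y z w : 'rV[R]_d.

Lemma edist_ge0 y z : 0 <= edist y z.
Proof. exact: sqrtr_ge0. Qed.

Lemma edistC y z : edist y z = edist z y.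
Proof. by rewrite /edist; under eq_bigr do rewrite -sqrrN opprB. Qed.

Lemma edistxx y : edist y y = 0.
Proof. by rewrite /edist big1 ?sqrtr0// => t _; rewrite subrr expr0n. Qed.

Lemma edist_eq0 y z : edist y z = 0 -> y = z.
Proof.
move/eqP; rewrite sqrtr_eq0 => le0.
have : \sum_(t < d) (y ord0 t - z ord0 t) ^+ 2 == 0.
  by rewrite eq_le le0 sumr_ge0// => t _; rewrite sqr_ge0.
rewrite psumr_eq0 => [/allP H|t _]; last exact: sqr_ge0.
apply/rowP => t; have := H t (mem_index_enum _).
by rewrite sqrf_eq0 subr_eq0 => /eqP.
Qed.

Lemma cauchy_schwarz (a b : 'I_d -> R) :
  \sum_t a t * b t <= Num.sqrt (\sum_t a t ^+ 2) * Num.sqrt (\sum_t b t ^+ 2).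
Proof.
have sq (c : 'I_d -> R) : 0 <= \sum_t c t ^+ 2 by apply: sumr_ge0 => t _; exact: sqr_ge0.
have [a0|a0] := eqVneq (\sum_t a t ^+ 2) 0.
  rewrite a0 sqrtr0 mul0r big1// => t _.
  have : \sum_t a t ^+ 2 == 0 by rewrite a0.
  rewrite psumr_eq0 => [/allP/(_ t (mem_index_enum _))|? _]; last exact: sqr_ge0.
  by rewrite sqrf_eq0 => /eqP ->; rewrite mul0r.
have [b0|b0] := eqVneq (\sum_t b t ^+ 2) 0.
  rewrite b0 sqrtr0 mulr0 big1// => t _.
  have : \sum_t b t ^+ 2 == 0 by rewrite b0.
  rewrite psumr_eq0 => [/allP/(_ t (mem_index_enum _))|? _]; last exact: sqr_ge0.
  by rewrite sqrf_eq0 => /eqP ->; rewrite mulr0.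
set A := Num.sqrt _; set B := Num.sqrt (\sum_t b t ^+ 2).
have A0 : 0 < A by rewrite sqrtr_gt0 lt_def a0 sq.
have B0 : 0 < B by rewrite sqrtr_gt0 lt_def b0 sq.
have A2 : A ^+ 2 = \sum_t a t ^+ 2 by rewrite sqr_sqrtr.
have B2 : B ^+ 2 = \sum_t b t ^+ 2 by rewrite sqr_sqrtr.
have : 0 <= \sum_t (B * a t - A * b t) ^+ 2 by apply: sumr_ge0 => t _; exact: sqr_ge0.
have E t : (B * a t - A * b t) ^+ 2 = B ^+ 2 * a t ^+ 2 - 2 * A * B * (a t * b t) + A ^+ 2 * b t ^+ 2.
  by ring.
under eq_bigr do rewrite E.
rewrite big_split sumrB/= -!mulr_sumr -A2 -B2.
have -> : B ^+ 2 * A ^+ 2 - 2 * A * B * (\sum_i a i * b i) + A ^+ 2 * B ^+ 2 =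
  (2 * (A * B)) * (A * B - \sum_i a i * b i) by ring.
by rewrite pmulr_rge0 ?mulr_gt0// subr_ge0.
Qed.

Lemma edist_triangle y z w : edist y w <= edist y z + edist z w.
Proof.
rewrite -ler_sqr ?nnegrE ?addr_ge0 ?edist_ge0// sqrrD.
rewrite !sqr_sqrtr; try by apply: sumr_ge0 => t _; exact: sqr_ge0.
have -> : \sum_(t < d) (y ord0 t - w ord0 t) ^+ 2 = \sum_(t < d) (y ord0 t - z ord0 t) ^+ 2 +
   (\sum_(t < d) (y ord0 t - z ord0 t) * (z ord0 t - w ord0 t)) *+ 2 +
   \sum_(t < d) (z ord0 t - w ord0 t) ^+ 2.
  rewrite -sumrMnl -!big_split/=; apply: eq_bigr => t _; ring.
rewrite lerD2r lerD2l ler_wMn2r//.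
exact: (cauchy_schwarz (fun t => y ord0 t - z ord0 t) (fun t => z ord0 t - w ord0 t)).
Qed.

Lemma dist_set_le y z (A : set 'rV[R]_d) : A z -> (dist_set y A <= (edist y z)%:E)%E.
Proof. by move=> Az; apply: ereal_inf_lbound; exists z. Qed.

Lemma dist_set_sub y (A B : set 'rV[R]_d) : (A `<=` B)%classic -> (dist_set y B <= dist_set y A)%E.
Proof. by move=> AB; apply: ereal_inf_le_tmp => _ [z Az <-]; exists z => //; exact: AB. Qed.
End Distance.

Section FlattenUniq.
Variables (T U : eqType) (f : T -> seq U).

(** Disjointness of the supernodes, once they are known to enumerate every index
    once. *)
Lemma flatten_map_uniq s : uniq (flatten (map f s)) ->
  (forall K, K \in s -> uniq (f K)) /\
  (forall K K' k, K \in s -> K' \in s -> k \in f K -> k \in f K' -> K = K').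
Proof.
elim: s => [|K0 s IH] //=; rewrite cat_uniq => /and3P[u0 /hasPn nd /IH[us dis]].
have out K k : K \in s -> k \in f K -> k \in f K0 -> False.
  move=> Ks kK k0; have /nd /negP : k \in flatten (map f s).
    by apply/flattenP; exists (f K) => //; exact: map_f.
  exact.
split=> [K|K K' k]; rewrite !inE; first by case/predU1P => [->|/us].
case/predU1P => [->|Ks] /predU1P[->|K's] // kK kK'; last exact: (dis _ _ k).
  by case: (out _ _ K's kK' kK).
by case: (out _ _ Ks kK kK').
Qed.

Lemma flatten_map_uniq_index s : (forall K, K \in s -> f K != [::]) ->
  uniq (flatten (map f s)) -> uniq s.
Proof.
elim: s => [|K0 s IH] //= ne; rewrite cat_uniq => /and3P[u0 /hasPn nd us].
rewrite IH ?andbT//; last by move=> K Ks; apply: ne; rewrite inE Ks orbT.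
apply/negP => K0s; have := ne K0; rewrite inE eqxx => /(_ isT).
case e : (f K0) => [//|k t] _.
have /nd /negP : k \in flatten (map f s).
  by apply/flattenP; exists (f K0); [exact: map_f|rewrite e inE eqxx].
by apply; rewrite /= e inE eqxx.
Qed.
End FlattenUniq.

Section Supernodes.
Variables (R : realType) (N : nat) (prec : rel 'I_N) (S : {set 'I_N * 'I_N}).
Variables (l : 'I_N -> \bar R) (lambda : R).
Hypothesis so : strict_total_order prec.

Definition near_leader (i j : 'I_N) := ((j, i) \in S) && (l j <= lambda%:E * l i)%E.
Hypothesis near_refl : forall i, near_leader i i.

(** A later leader has not been absorbed by an earlier one, hence is not near it. *)
Lemma aggregateP n todo : (size todo <= n)%N -> sorted (preceq prec) todo ->
  let nodes := aggregate S l lambda n todo in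
  [/\ perm_eq (flatten (map snd nodes)) todo,
      forall K, K \in nodes -> K.1 \in K.2 /\ {in K.2, forall k, near_leader K.1 k} &
      pairwise (fun K K' => preceq prec K.1 K'.1 && ~~ near_leader K.1 K'.1) nodes].
Proof.
elim: n todo => [|n IH] [|i todo] //= sz srt.
rewrite -/(near_leader i i) near_refl.
pose far := [seq j <- todo | ~~ near_leader i j].
have farE : [seq j <- todo | ~~ (((j, i) \in S) && (l j <= lambda%:E * l i)%E)] = far by [].
rewrite /= farE.
have [||Hperm Hin Hpair] := IH far.
- by rewrite size_filter (leq_trans (count_size _ _)).
- by apply: sorted_filter (path_sorted srt); exact: preceq_trans.
have min_i j : j \in todo -> preceq prec i j.
  by move=> jt; have /allP := order_path_min (preceq_trans so) srt; apply.
split.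
- rewrite /= perm_cons.
  apply: perm_trans (permEl (perm_filterC (near_leader i) todo)).
  by rewrite perm_cat2l.
- move=> K; rewrite inE => /predU1P[->|/Hin//] /=; split; first by rewrite inE eqxx.
  by move=> k; rewrite inE mem_filter => /predU1P[->//|/andP[]].
rewrite Hpair andbT; apply/allP => K Kn /=.
have : K.1 \in far.
  rewrite -(perm_mem Hperm); apply/flattenP; exists K.2; first exact: map_f.
  by have [] := Hin K Kn.
by rewrite mem_filter => /andP[-> /min_i ->].
Qed.
End Supernodes.

(** * Length scales of a reverse maximin ordering *)

Section Positivity.
Variables (R : realType) (d N : nat) (x : 'I_N -> 'rV[R]_d).

Lemma pd_kernel_inj (G : 'rV[R]_d -> 'rV[R]_d -> R) :
  positive_definite (kernel_mx G x) -> injective x.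
Proof.
move=> [_ pos] i j xij; apply/eqP/negPn/negP => ij.
pose v : 'rV[R]_N := delta_mx 0 i - delta_mx 0 j.
have : v != 0.
  apply/eqP => /rowP/(_ i); rewrite !mxE !eqxx (negbTE ij) subr0 => /eqP.
  by rewrite oner_eq0.
move/pos; suff -> : v *m kernel_mx G x = 0 by rewrite mul0mx mxE ltxx.
by rewrite mulmxBl -!rowE; apply/rowP => k; rewrite !mxE xij subrr.
Qed.

(** The open set contains a ball around the point, and the Euclidean norm dominates
    the sup norm. *)
Lemma frontier_far (Omega : set 'rV[R]_d) (y : 'rV[R]_d) : open Omega -> Omega y ->
  exists2 e : R, 0 < e & forall z, frontier Omega z -> e <= edist y z.
Proof.
move=> oO Oy; have /nbhs_ballP[e /= e0 ballO] : nbhs y Omega by exact: open_nbhs_nbhs.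
exists e => // z [_ notint]; rewrite leNgt; apply/negP => lt; apply: notint.
apply: open_nbhs_nbhs; split=> //; apply: ballO; split=> // i j.
rewrite ord1 /ball/= /ball_/=; apply: le_lt_trans lt.
rewrite -sqrtr_sqr ler_wsqrtr// (bigD1 j)//= lerDl sumr_ge0// => t _; exact: sqr_ge0.
Qed.

(** Positive definiteness excludes coincident points and openness keeps the
    boundary away, so that length scales are never zero. *)
Lemma dist_after_gt0 (Omega : set 'rV[R]_d) prec j : strict_total_order prec ->
  injective x -> open Omega -> Omega (x j) ->
  (0 < dist_set (x j) (after prec x (frontier Omega) j))%E.
Proof.
move=> [irr _ _] injx oO Oj; have [e e0 far] := frontier_far oO Oj.
(* A minimum over finitely many positive numbers, one of which is e. *)
pose m := \big[Num.min/e]_(i | i != j) edist (x j) (x i).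
have m0 : 0 < m.
  rewrite /m; elim/big_ind: _ => // [a b a0 b0|i ij]; first by rewrite lt_min a0.
  rewrite lt_def edist_ge0 andbT; apply: contra_neq ij => /edist_eq0/injx.
  by move=> ->.
apply: (@lt_le_trans _ _ m%:E); first by rewrite lte_fin.
apply: le_ereal_inf_tmp => _ [z [[i /= ji <-]|/far ez] <-]; rewrite lee_fin.
  by rewrite /m (bigD1 i)//= ?ge_min ?lexx//; apply: contraTneq ji => ->; rewrite irr.
apply: le_trans ez; rewrite /m; elim/big_rec: _ => // i y _ ye.
by rewrite ge_min ye orbT.
Qed.
End Positivity.

Section Geometry.
Variables (R : realType) (d N : nat) (x : 'I_N -> 'rV[R]_d) (bd : set 'rV[R]_d).
Variables (prec : rel 'I_N) (l : 'I_N -> \bar R) (r : R).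
Hypothesis so : strict_total_order prec.
Hypothesis maximin : reverse_maximin r prec x bd l.
Hypothesis r_gt0 : 0 < r.
Hypothesis r_le1 : r <= 1.
Hypothesis l_gt0 : forall j, (0 < l j)%E.

Lemma after_sub i j : prec i j -> (after prec x bd j `<=` after prec x bd i)%classic.
Proof.
have [_ tr _] := so; move=> ij z [[k /= jk <-]|bz]; last by right.
by left; exists k => //=; exact: tr jk.
Qed.

Lemma scale_le_dist i j : prec i j -> (l i <= (edist (x i) (x j))%:E)%E.
Proof.
move=> ij; have [-> _] := maximin i.
by apply: dist_set_le; left; exists j.
Qed.

(** The points after j are among those after i, so that x_i is at distance at least
    l_i from them; the maximin condition at j compares this distance with l_j. *)
Lemma scale_mono i j : preceq prec i j -> (r%:E * l i <= l j)%E.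
Proof.
case/predU1P => [->|ij].
  by rewrite -[leRHS]mul1e lee_wpmul2r ?lee_fin// ltW.
have [_ H] := maximin j; apply: le_trans H; apply: lee_wpmul2l; first by rewrite lee_fin ltW.
apply: (@le_trans _ _ (dist_set (x i) (after prec x bd j))).
  by have [-> _] := maximin i; apply: dist_set_sub; exact: after_sub.
by rewrite (bigD1 i)//= le_max lexx.
Qed.

Lemma scale_separation k i j : preceq prec k i -> preceq prec k j -> i != j ->
  (r%:E * l k <= (edist (x i) (x j))%:E)%E.
Proof.
have [_ _ tot] := so; move=> ki kj ij; have /orP[ij'|ji] := tot _ _ ij.
  exact: le_trans (scale_mono ki) (scale_le_dist ij').
by rewrite edistC; exact: le_trans (scale_mono kj) (scale_le_dist ji).
Qed.

(** A later point would be at finite distance: the length scale is infinite at most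
    at the last index, when the boundary is empty. *)
Lemma scale_infinite_last k i : l k = +oo%E -> preceq prec k i -> i = k.
Proof.
move=> lk; case/predU1P => [//|/scale_le_dist].
by rewrite lk leye_eq.
Qed.

Lemma preceq_of_infinite k i : l k = +oo%E -> preceq prec i k.
Proof.
move=> lk; have /orP[//|ki] := preceq_total so i k.
by rewrite (scale_infinite_last lk ki) /preceq eqxx.
Qed.

Variables (Cd dt rho lambda : R).
Hypothesis idim : intrinsic_dimension x dt Cd.
Hypothesis rho_gt0 : 0 < rho.
Hypothesis lambda_gt1 : 1 < lambda.

(** The intrinsic dimension condition for a single point. *)
Lemma idim_ge1 (i : 'I_N) (c : R) : 1 <= c -> 1 <= Cd * c `^ dt.
Proof.
move=> c1; have := @idim 1 c (x i) [set i] ltr01 c1.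
rewrite cards1 divr1; apply=> [j|j k]; first by rewrite inE => /eqP ->; rewrite edistxx (le_trans _ c1).
by rewrite !inE => /eqP -> /eqP ->; rewrite eqxx.
Qed.

(** Bounds the number of rows of a column and of a supernode: the points lie in a
    ball of radius (1 + lambda) max(1, rho) l_k and are r l_k-separated. *)
Definition size_bound := Cd * ((1 + lambda) / r) `^ dt * Num.max 1 rho `^ dt.

Lemma size_boundE : size_bound = Cd * (((1 + lambda) * Num.max 1 rho) / r) `^ dt.
Proof.
have h : 0 <= (1 + lambda) / r by apply: divr_ge0; [move: lambda_gt1; lra|exact: ltW].
rewrite /size_bound -mulrA -powRM//; last by rewrite le_max ler01.
by congr (_ * _ `^ _); rewrite mulrAC.
Qed.

Lemma radius_ge1 : 1 <= (1 + lambda) * Num.max 1 rho.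
Proof. by rewrite mulr_ege1 ?le_max ?lexx//; move: lambda_gt1; lra. Qed.

Lemma size_bound_ge1 (i : 'I_N) : 1 <= size_bound.
Proof.
rewrite size_boundE idim_ge1// ler_pdivlMr// mul1r.
exact: le_trans r_le1 radius_ge1.
Qed.

Lemma ball_card k (A : {set 'I_N}) :
  (forall i, i \in A -> preceq prec k i /\
    ((edist (x i) (x k))%:E <= (rho * (1 + lambda))%:E * l k)%E) ->
  #|A|%:R <= size_bound.
Proof.
move=> HA; case lk : (l k) (l_gt0 k) => [a| |] //.
  rewrite lte_fin => a0; rewrite size_boundE.
  have := @idim (r * a) ((1 + lambda) * Num.max 1 rho * a) (x k) A.
  rewrite (_ : _ / (r * a) = (1 + lambda) * Num.max 1 rho / r); last first.
    by field; rewrite !lt0r_neq0.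
  apply=> [||i /HA[_]|i j /HA[ki _] /HA[kj _] ij].
  - exact: mulr_gt0.
  - by rewrite ler_pM2r// (le_trans r_le1 radius_ge1).
  - rewrite lk -EFinM lee_fin => /le_trans; apply; rewrite ler_pM2r// mulrC ler_wpM2l//; first by move: lambda_gt1; lra.
    by rewrite le_max lexx orbT.
  - by rewrite -lee_fin EFinM -lk; exact: scale_separation.
move=> _; apply: le_trans (size_bound_ge1 k).
rewrite -[1]/(1%:R) ler_nat -(cards1 k) subset_leq_card//.
by apply/fintype.subsetP => i /HA[ki _]; rewrite inE (scale_infinite_last lk ki).
Qed.

Lemma pattern_mem i j : ((i, j) \in pattern prec x l rho) =
  preceq prec j i && ((edist (x i) (x j))%:E <= rho%:E * l j)%E.
Proof. by rewrite inE. Qed.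

Lemma pattern_lower : lower_pattern prec (pattern prec x l rho).
Proof.
split=> [k|i k]; rewrite pattern_mem; last by case/andP.
by rewrite /preceq eqxx edistxx mule_ge0// ?lee_fin ltW.
Qed.

Lemma pattern_column_card k : #|column (pattern prec x l rho) k|%:R <= size_bound.
Proof.
apply: (@ball_card k) => i; rewrite inE pattern_mem => /andP[ki H]; split=> //.
apply: le_trans H _; rewrite lee_wpmul2r ?(ltW (l_gt0 k))// lee_fin.
by rewrite ler_peMr ?(ltW rho_gt0)//; move: lambda_gt1; lra.
Qed.

Local Notation nodes := (supernodes prec x l rho lambda).
Local Notation near := (near_leader (pattern prec x l rho) l lambda).

Lemma near_refl i : near i i.
Proof.
rewrite /near_leader pattern_lower.1 /= -[leLHS]mul1e lee_wpmul2r ?(ltW (l_gt0 i))//.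
by rewrite lee_fin ltW.
Qed.

Lemma supernodesP :
  [/\ perm_eq (flatten (map snd nodes)) (enum 'I_N),
      forall K, K \in nodes -> K.1 \in K.2 /\ {in K.2, forall k, near K.1 k} &
      pairwise (fun K K' => preceq prec K.1 K'.1 && ~~ near K.1 K'.1) nodes].
Proof.
have sz : (size (listing prec [set: 'I_N]) <= N)%N by rewrite size_listing cardsT card_ord.
have [perm H1 H2] := aggregateP so near_refl sz (listing_sorted so _).
split=> //; apply: perm_trans perm _; apply: uniq_perm; rewrite ?listing_uniq ?enum_uniq//.
by move=> i; rewrite mem_listing mem_enum !inE.
Qed.
End Geometry.

(** * The aggregated patterns *)

Section AggregatedPattern.
Variables (R : realType) (d N : nat) (x : 'I_N -> 'rV[R]_d).
Variables (prec : rel 'I_N) (l : 'I_N -> \bar R) (rho lambda : R).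
Hypothesis so : strict_total_order prec.
Hypothesis l_gt0 : forall j, (0 < l j)%E.
Hypothesis rho_gt0 : 0 < rho.
Hypothesis lambda_gt1 : 1 < lambda.
Local Notation nodes := (supernodes prec x l rho lambda).
Local Notation P := (pattern prec x l rho).
Local Notation near := (near_leader P l lambda).

Let nodesP := supernodesP x so l_gt0 rho_gt0 lambda_gt1.

Lemma leader_in K : K \in nodes -> K.1 \in K.2.
Proof. by have [_ H _] := nodesP => /H[]. Qed.

Lemma member_near K k : K \in nodes -> k \in K.2 -> near K.1 k.
Proof. by have [_ H _] := nodesP => /H[_]; apply. Qed.

Lemma uniq_flatten_nodes : uniq (flatten (map snd nodes)).
Proof. by have [H _ _] := nodesP; rewrite (perm_uniq H) enum_uniq. Qed.

Lemma nodes_uniq : uniq nodes.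
Proof.
apply: (@flatten_map_uniq_index _ _ snd) uniq_flatten_nodes => K /leader_in.
by case: K.2.
Qed.

Lemma members_uniq K : K \in nodes -> uniq K.2.
Proof. by have [H _] := flatten_map_uniq uniq_flatten_nodes; exact: H. Qed.

Lemma nodes_disjoint K K' k : K \in nodes -> K' \in nodes -> k \in K.2 -> k \in K'.2 -> K = K'.
Proof. by have [_ H] := flatten_map_uniq uniq_flatten_nodes; exact: H. Qed.

Lemma nodes_cover k : exists2 K, K \in nodes & k \in K.2.
Proof.
have [H _ _] := nodesP; have : k \in flatten (map snd nodes).
  by rewrite (perm_mem H) mem_enum.
by case/flattenP => _ /mapP[K Kn ->] kK; exists K.
Qed.

Lemma sum_size_members : (\sum_(K <- nodes) size K.2 = N)%N.
Proof.
have [/perm_size H _ _] := nodesP; move: H.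
by rewrite size_flatten_map -cardE card_ord.
Qed.

Lemma leaders_uniq : uniq (map fst nodes).
Proof.
rewrite map_inj_in_uniq ?nodes_uniq// => K K' Kn K'n e.
by apply: (nodes_disjoint (k := K.1)) => //; [|rewrite e]; exact: leader_in.
Qed.

Lemma leaders_far K K' : K \in nodes -> K' \in nodes -> K != K' ->
  (preceq prec K.1 K'.1 && ~~ near K.1 K'.1) || (preceq prec K'.1 K.1 && ~~ near K'.1 K.1).
Proof.
have [_ _ pw] := nodesP.
elim: (nodes) pw => [//|K0 s IH] /= /andP[/allP H0 /IH{}IH].
rewrite !inE => /predU1P[->|Ks] /predU1P[->|K's] ne.
- by rewrite eqxx in ne.
- by rewrite H0.
- by rewrite H0 ?orbT.
- exact: IH.
Qed.

Lemma mem_bigcup_seq (T : eqType) (s : seq T) (F : T -> {set 'I_N * 'I_N}) p :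
  (p \in \bigcup_(K <- s) F K) = has (fun K => p \in F K) s.
Proof. by elim: s => [|K s IH]; rewrite ?big_nil ?inE// big_cons inE IH. Qed.

Variables (T : 'I_N * seq 'I_N -> pred 'I_N) (S : {set 'I_N * 'I_N}).
Hypothesis S_def : S = \bigcup_(K <- nodes)
  [set p | [&& p.2 \in K.2, preceq prec p.2 p.1 & T K p.1]].
Hypothesis T_member : forall K k, K \in nodes -> k \in K.2 -> T K k.

(** T K is the set of rows allowed for the supernode K; the two aggregated
    patterns differ in this set only, and both are treated through it. *)
Lemma aggregated_mem K i k : K \in nodes -> k \in K.2 ->
  ((i, k) \in S) = preceq prec k i && T K i.
Proof.
move=> Kn kK; rewrite S_def mem_bigcup_seq; apply/hasP/idP => [[K' K'n]|ki].
  by rewrite inE /= => /and3P[kK' -> TK]; rewrite (nodes_disjoint Kn K'n kK kK') TK.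
by exists K => //; rewrite inE /= kK.
Qed.

Lemma aggregated_lower : lower_pattern prec S.
Proof.
split=> [k|i k]; have [K Kn kK] := nodes_cover k; rewrite (aggregated_mem _ Kn kK).
  by rewrite /preceq eqxx T_member.
by case/andP.
Qed.

Lemma rows_T K i : K \in nodes -> i \in rows S K -> T K i && preceq prec K.1 i.
Proof.
move=> Kn /bigcupP[k kK]; rewrite inE (aggregated_mem _ Kn kK) => /andP[ki ->] /=.
have := member_near Kn kK; rewrite /near_leader => /andP[+ _].
rewrite pattern_mem => /andP[Kk _]; exact: preceq_trans ki.
Qed.

Lemma aggregated_column K k : K \in nodes -> k \in K.2 ->
  column S k =i [pred i | (i \in rows S K) && preceq prec k i].
Proof.
move=> Kn kK i; rewrite !inE (aggregated_mem _ Kn kK); apply/andP/andP => [[ki Ti]|[iK ki]].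
  by split=> //; apply/bigcupP; exists k; rewrite ?inE ?(aggregated_mem _ Kn kK) ?ki.
by split=> //; have /andP[] := rows_T Kn iK.
Qed.
End AggregatedPattern.

Section TildeBar.
Variables (R : realType) (d N : nat) (x : 'I_N -> 'rV[R]_d).
Variables (prec : rel 'I_N) (l : 'I_N -> \bar R) (rho lambda : R).
Hypothesis so : strict_total_order prec.
Hypothesis l_gt0 : forall j, (0 < l j)%E.
Hypothesis rho_gt0 : 0 < rho.
Hypothesis lambda_gt1 : 1 < lambda.
Local Notation nodes := (supernodes prec x l rho lambda).
Local Notation P := (pattern prec x l rho).

(** For the first pattern, a row i of a member k of the node of K satisfies
    |x_i - x_k| <= rho l_k <= rho lambda l_K and |x_k - x_K| <= rho l_K.  The second
    pattern is this ball by definition. *)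
Lemma aggregated_pattern_rows S :
  S = pattern_tilde prec x l rho lambda \/ S = pattern_bar prec x l rho lambda ->
  exists T : 'I_N * seq 'I_N -> pred 'I_N,
  [/\ S = \bigcup_(K <- nodes) [set p | [&& p.2 \in K.2, preceq prec p.2 p.1 & T K p.1]],
      forall K k, K \in nodes -> k \in K.2 -> T K k &
      forall K i, K \in nodes -> T K i ->
        ((edist (x i) (x K.1))%:E <= (rho * (1 + lambda))%:E * l K.1)%E].
Proof.
have lam_ge0 : 0 <= lambda by rewrite (le_trans ler01)// ltW.
have near_dist K k : K \in nodes -> k \in K.2 ->
    ((edist (x k) (x K.1))%:E <= rho%:E * l K.1)%E /\ (l k <= lambda%:E * l K.1)%E.
  move=> Kn kK; have /andP[+ ->] := member_near so l_gt0 rho_gt0 lambda_gt1 Kn kK.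
  by rewrite pattern_mem => /andP[_ ->].
have Krho k : (rho%:E * l k <= (rho * (1 + lambda))%:E * l k)%E.
  by rewrite lee_wpmul2r ?(ltW (l_gt0 _))// lee_fin ler_peMr ?(ltW rho_gt0)// lerDl.
case=> ->.
- exists (fun K i => i \in rows P K); split=> // K.
    move=> k Kn kK; apply/bigcupP; exists k => //; rewrite inE.
    exact: (pattern_lower x prec l_gt0 rho_gt0).1.
  move=> i Kn /bigcupP[k kK]; rewrite inE pattern_mem => /andP[_ ik].
  have [kK1 lk] := near_dist _ _ Kn kK.
  apply: (@le_trans _ _ ((edist (x i) (x k))%:E + (edist (x k) (x K.1))%:E)%E).
    by rewrite -EFinD lee_fin edist_triangle.
  rewrite mulrDr mulr1 EFinD ge0_muleDl ?lee_fin ?mulr_ge0 ?(ltW rho_gt0)// addeC leeD//.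
  apply: (le_trans ik); rewrite EFinM -muleA.
  by rewrite lee_wpmul2l// lee_fin ltW.
- exists (fun K i => ((edist (x K.1) (x i))%:E <= (rho * (1 + lambda))%:E * l K.1)%E); split=> // K.
    move=> k Kn kK; rewrite /= edistC; have [H _] := near_dist _ _ Kn kK.
    exact: le_trans H (Krho _).
  by move=> i _; rewrite edistC.
Qed.
End TildeBar.

(** * Counting the rows of the supernodes level by level *)

(** The number of levels by which the length scale can drop along the ordering. *)
Lemma exists_pow_ge (R : realType) (r lambda : R) : 0 < r -> 1 < lambda ->
  exists m : nat, 1 <= r * lambda ^+ m.
Proof.
move=> r0 lam1; have lam0 : 0 < lambda by exact: lt_trans lam1.
have ll : 0 < ln lambda by rewrite ln_gt0.
exists (Num.truncn (- ln r / ln lambda)).+1; set m := _.+1.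
rewrite -ler_ln ?posrE ?mulr_gt0 ?exprn_gt0// ln1 lnM ?posrE ?exprn_gt0// lnXn//.
rewrite -mulr_natl -lerBlDl sub0r -ler_pdivrMr//; exact/ltW/truncnS_gt.
Qed.

Section LevelCounting.
Variables (R : realType) (d N : nat) (x : 'I_N -> 'rV[R]_d) (bd : set 'rV[R]_d).
Variables (prec : rel 'I_N) (l : 'I_N -> \bar R) (r Cd dt rho lambda : R).
Hypothesis so : strict_total_order prec.
Hypothesis maximin : reverse_maximin r prec x bd l.
Hypothesis r_gt0 : 0 < r.
Hypothesis r_le1 : r <= 1.
Hypothesis l_gt0 : forall j, (0 < l j)%E.
Hypothesis idim : intrinsic_dimension x dt Cd.
Hypothesis rho_gt0 : 0 < rho.
Hypothesis lambda_gt1 : 1 < lambda.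
Local Notation nodes := (supernodes prec x l rho lambda).

(** The integer k with lambda^k <= l_i < lambda^(k + 1). *)
Definition level (i : 'I_N) : int := Num.floor (ln (fine (l i)) / ln lambda).

Let lam_gt0 : 0 < lambda. Proof. exact: lt_trans lambda_gt1. Qed.

Lemma pow_le_level (k : int) (y : R) : 0 < y ->
  (lambda ^ k <= y) = (k <= Num.floor (ln y / ln lambda)).
Proof.
move=> y0; rewrite floor_ge_int ler_pdivlMr ?ln_gt0// -ln_powR ler_ln ?posrE ?powR_gt0//.
by rewrite powR_intmul// ltW.
Qed.

Lemma scaleE i : (l i < +oo)%E -> l i = (fine (l i))%:E /\ 0 < fine (l i).
Proof. by have := l_gt0 i; case: (l i) => //= a; rewrite lte_fin. Qed.

Lemma level_spec i : (l i < +oo)%E ->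
  lambda ^ level i <= fine (l i) < lambda ^ (level i + 1).
Proof.
move=> /scaleE[_ fi]; rewrite pow_le_level// lexx/= ltNge pow_le_level//.
rewrite -ltNge -/(level i); lia.
Qed.

Variable m : nat.
Hypothesis r_pow : 1 <= r * lambda ^+ m.

Lemma level_mono i j : preceq prec i j -> (l i < +oo)%E -> (l j < +oo)%E ->
  level i - m%:Z <= level j.
Proof.
move=> ij fi fj; have := scale_mono so maximin r_gt0 r_le1 l_gt0 ij.
have [li i0] := scaleE fi; have [lj j0] := scaleE fj.
rewrite li lj -EFinM lee_fin => rl; rewrite -pow_le_level//; apply: le_trans rl.
have /andP[lev _] := level_spec fi.
rewrite expfzDr ?lt0r_neq0//; apply: (@le_trans _ _ (fine (l i) * lambda ^ (- m%:Z))).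
  by rewrite ler_wpM2r// exprz_ge0// ltW.
rewrite mulrC ler_wpM2r ?(ltW i0)//.
by rewrite -invr_expz -[leLHS]mul1r ler_pdivrMr ?exprn_gt0.
Qed.

(** Bounds the number of rho lambda^k-separated points in a ball of radius
    rho (1 + lambda) lambda^(k + 1). *)
Definition level_bound := Cd * ((1 + lambda) * lambda) `^ dt.

Variable S : {set 'I_N * 'I_N}.
Hypothesis rowsP : forall K i, K \in nodes -> i \in rows S K -> preceq prec K.1 i /\
  ((edist (x i) (x K.1))%:E <= (rho * (1 + lambda))%:E * l K.1)%E.

Definition leads (j : 'I_N) (k : int) (K : 'I_N * seq 'I_N) :=
  [&& (l K.1 < +oo)%E, j \in rows S K & level K.1 == k].

(** Two leaders of the same level have length scales within a factor lambda, so
    the later one can only have escaped aggregation by being further than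
    rho lambda^k from the earlier one; on the other hand all the leaders counted here
    are close to x_j. *)
Lemma leaders_at_level j k : (count (leads j k) nodes)%:R <= level_bound.
Proof.
pose A := [set i in map fst (seq.filter (leads j k) nodes)].
have uA : uniq (map fst (seq.filter (leads j k) nodes)).
  apply: subseq_uniq (map_subseq _ (filter_subseq _ _)) _.
  exact: (leaders_uniq x so l_gt0 rho_gt0 lambda_gt1).
have -> : count (leads j k) nodes = #|A|.
  by rewrite cardsE (card_uniqP uA) size_map size_filter.
have memA i : i \in A -> exists2 K, K \in nodes & leads j k K /\ i = K.1.
  rewrite inE => /mapP[K]; rewrite mem_filter => /andP[lK Kn] ->.
  by exists K.
have lk0 : 0 < lambda ^ k by rewrite exprz_gt0.
have := @idim (rho * lambda ^ k) (rho * (1 + lambda) * lambda * lambda ^ k) (x j) A.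
rewrite (_ : _ / _ = (1 + lambda) * lambda); last first.
  by field; rewrite !lt0r_neq0.
apply.
- exact: mulr_gt0.
- rewrite ler_pM2r// -mulrA ler_peMr ?(ltW rho_gt0)// mulr_ege1//; last exact: ltW.
  by move: lambda_gt1; lra.
- move=> i /memA[K Kn [/and3P[fK jK /eqP levK] ->]].
  have [_] := rowsP Kn jK; have [-> _] := scaleE fK; rewrite -EFinM lee_fin edistC => /le_trans; apply.
  rewrite -[leRHS]mulrA ler_wpM2l//.
    by rewrite mulr_ge0 ?(ltW rho_gt0)//; move: lambda_gt1; lra.
  have /andP[_ /ltW] := level_spec fK; rewrite levK => /le_trans; apply.
  by rewrite expfzDr ?lt0r_neq0// expr1z mulrC.
move=> i i' /memA[K Kn [/and3P[fK jK /eqP levK] ->]] /memA[K' K'n [/and3P[fK' jK' /eqP levK'] ->]] ne.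
have KK' : K != K' by apply: contra_neq ne => ->.
wlog far : K K' Kn K'n fK fK' jK jK' levK levK' ne KK' / preceq prec K.1 K'.1 &&
    ~~ near_leader (pattern prec x l rho) l lambda K.1 K'.1.
  move=> H; have /orP[h|h] := leaders_far so l_gt0 rho_gt0 lambda_gt1 Kn K'n KK'.
    exact: H.
  by rewrite edistC; apply: H => //; rewrite eq_sym.
case/andP: far => KpK'; rewrite /near_leader pattern_mem KpK' /= => /nandP.
have [lK K0] := scaleE fK; have [lK' K'0] := scaleE fK'.
have /andP[lo _] := level_spec fK; have /andP[_ hi'] := level_spec fK'.
move: (fine (l K.1)) (fine (l K'.1)) lK K0 lK' K'0 lo hi' => a b -> a0 -> b0 lo hi'.
rewrite -!EFinM !lee_fin -!ltNge edistC; case=> [/ltW|ba].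
  by apply: le_trans; rewrite ler_wpM2l ?(ltW rho_gt0)// -levK.
have := lt_trans ba hi'; rewrite levK' -levK expfzDr ?lt0r_neq0// expr1z mulrC.
by rewrite ltr_pM2r// ltNge lo.
Qed.

Lemma infinite_unique i j : l i = +oo%E -> l j = +oo%E -> i = j.
Proof.
move=> li lj; exact: scale_infinite_last maximin _ _ lj (preceq_of_infinite so maximin j li).
Qed.

(** The regular refinement condition only counts indices with finite length scale. *)
Definition finite_rows K := [set j in rows S K | (l j < +oo)%E].

(** At most one row has an infinite length scale; it is charged to the members of
    the supernode, whose total number is N. *)
Lemma card_rows K : K \in nodes ->
  (#|rows S K| <= (l K.1 < +oo)%E * #|finite_rows K| + size K.2)%N.
Proof.
move=> Kn; have K2 : (0 < size K.2)%N.
  have := leader_in so l_gt0 rho_gt0 lambda_gt1 Kn.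
  by case: K.2.
have [fK|] := boolP (l K.1 < +oo)%E; last first.
  rewrite ltey negbK => /eqP lK; rewrite mul0n add0n; apply: leq_trans K2.
  rewrite -(cards1 K.1) subset_leq_card//; apply/fintype.subsetP => i /(rowsP Kn)[Ki _].
  by rewrite inE (scale_infinite_last maximin lK Ki).
rewrite mul1n -(cardsID [set j | (l j < +oo)%E] (rows S K)) leq_add//.
  by rewrite subset_leq_card//; apply/fintype.subsetP => i; rewrite !inE.
apply: leq_trans K2; apply/card_le1_eqP => i j; rewrite !inE !ltey !negbK.
by move=> /andP[/eqP li _] /andP[/eqP lj _]; exact: infinite_unique.
Qed.

Variables (i1 : 'I_N) (Clam : R).
Hypothesis i1_first : forall i, i != i1 -> prec i1 i.
Hypothesis refine : regular_refinement prec l lambda Clam.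

Lemma first_level (K : 'I_N * seq 'I_N) : (l K.1 < +oo)%E -> level i1 - m%:Z <= level K.1.
Proof.
move=> fK; have i1K : preceq prec i1 K.1.
  have [->|ne] := eqVneq i1 K.1; first by rewrite /preceq eqxx.
  by rewrite /preceq i1_first ?orbT// eq_sym.
apply: level_mono => //.
have := scale_mono so maximin r_gt0 r_le1 l_gt0 i1K; have := l_gt0 i1.
case: (l i1) => // [a _ _|_]; first by rewrite ltry.
by rewrite gt0_muley ?lte_fin// leye_eq => /eqP lK; rewrite lK in fK.
Qed.

Lemma leads_level j k : (l j < +oo)%E -> (0 < count (leads j k) nodes)%N -> k - m%:Z <= level j.
Proof.
move=> fj; rewrite -has_count => /hasP[K Kn /and3P[fK jK /eqP <-]].
by apply: level_mono => //; have [] := rowsP Kn jK.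
Qed.

Definition at_least (k : int) := #|[set j : 'I_N | (l j < +oo)%E && (k <= level j)]|.

(** The first 2 m levels, which lie below the range of the refinement condition,
    contribute at most N each. *)
Lemma sum_at_least U :
  (\sum_(u < U) at_least (level i1 - (2 * m)%:Z + u%:Z)%R)%N%:R <= (2 * m)%:R * N%:R + Clam * N%:R.
Proof.
apply: (@le_trans _ _ (\sum_(u < 2 * m + U) at_least (level i1 - (2 * m)%:Z + u%:Z)%R)%N%:R).
  rewrite ler_nat -!(big_mkord xpredT (fun u => at_least (level i1 - (2 * m)%:Z + u%:Z)%R)).
  by rewrite (big_cat_nat _ (n := U) (p := (2 * m + U)%N))//= ?leq_addl// leq_addr.
rewrite big_split_ord natrD lerD//.
  rewrite -natrM ler_nat -[X in (_ <= X * _)%N](card_ord (2 * m)) -sum_nat_const leq_sum// => u _.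
  by rewrite (leq_trans (max_card _))// card_ord.
rewrite -lee_fin; apply: le_trans (refine i1_first).
rewrite natr_sum -sumEFin.
apply: (@le_trans _ _ (\sum_(0 <= v < U) #|[set i : 'I_N | ((lambda ^ (level i1 + v%:Z))%:E <= l i < +oo)%E]|%:R%:E)%E); last first.
  by apply: nneseries_lim_ge => v _ _; rewrite lee_fin.
rewrite big_mkord; apply: lee_sum => v _; rewrite lee_fin ler_nat subset_leq_card//.
apply/fintype.subsetP => j; rewrite !inE => /andP[fj lev]; rewrite fj andbT.
have [-> j0] := scaleE fj; rewrite lee_fin pow_le_level//.
by move: lev; rewrite /= -/(level j) -/(level i1) PoszD; lia.
Qed.

(** Pairs of a supernode and a row are counted by the row j and the level k of the
    leader: for given j and k there are at most [level_bound] of them, and none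
    unless k is at most the level of j plus m.  Levels of leaders start at the level
    of the first index minus m. *)
Lemma sum_rows : (\sum_(K <- nodes) #|rows S K|)%N%:R <=
  (level_bound * (2 * m + 1)%:R + 1) * Num.max 1 Clam * N%:R.
Proof.
(* Levels of leaders are numbered from the lowest possible one. *)
pose dep (K : 'I_N * seq 'I_N) := absz (level K.1 - (level i1 - m%:Z))%R.
pose U := (\sum_(K <- nodes) dep K)%N.+1.
have depU K : K \in nodes -> (dep K < U)%N.
  move=> Kn; rewrite /U ltnS (big_rem K)//= leq_addr//.
have depE K : (l K.1 < +oo)%E -> level K.1 = level i1 - m%:Z + (dep K)%:Z.
  by move=> /first_level le; rewrite /dep gez0_abs; lia.
have bound0 : 0 <= level_bound.
  rewrite (le_trans ler01)// (idim_ge1 idim i1)// mulr_ege1//; last exact: ltW.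
  by move: lambda_gt1; lra.
have perj j : (l j < +oo)%E ->
  (\sum_(K <- nodes) ((l K.1 < +oo)%E && (j \in rows S K)))%N%:R <=
  level_bound * (\sum_(u < U) (level i1 - (2 * m)%:Z + u%:Z <= level j)%R)%N%:R.
  move=> fj; have -> : (\sum_(K <- nodes) ((l K.1 < +oo)%E && (j \in rows S K)) =
      \sum_(u < U) count (leads j (level i1 - m%:Z + u%:Z)%R) nodes)%N.
    under [RHS]eq_bigr do rewrite -sum1_count big_mkcond.
    rewrite exchange_big/= big_seq [RHS]big_seq; apply: eq_bigr => K Kn.
    have [fK|] := boolP (l K.1 < +oo)%E; last by move=> fK; rewrite big1// => u _; rewrite /leads (negbTE fK).
    have [jK|] := boolP (j \in rows S K); last by move=> jK; rewrite big1// => u _; rewrite /leads (negbTE jK) andbF.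
    rewrite (bigD1 (Ordinal (depU K Kn)))//= /leads fK jK -depE// eqxx big1// => u.
    rewrite -val_eqE/= => ne; rewrite depE// ifF//.
    by apply: contraNF ne => /eqP/addrI[->].
  rewrite !natr_sum mulr_sumr; apply: ler_sum => u _.
  have [/leads_level lev|] := boolP (0 < count (leads j (level i1 - m%:Z + u%:Z)%R) nodes)%N.
    rewrite (_ : (_ <= level j) = true) ?mulr1; first exact: leaders_at_level.
    by have := lev fj; rewrite PoszM; lia.
  by rewrite -leqNgt leqn0 => /eqP ->; rewrite mulr_ge0.
have total : (\sum_(K <- nodes) (l K.1 < +oo)%E * #|finite_rows K|)%N%:R <=
    level_bound * ((2 * m)%:R * N%:R + Clam * N%:R).
  have -> : (\sum_(K <- nodes) (l K.1 < +oo)%E * #|finite_rows K| =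
     \sum_(j | (l j < +oo)%E) \sum_(K <- nodes) ((l K.1 < +oo)%E && (j \in rows S K)))%N.
    rewrite exchange_big/=; apply: eq_bigr => K _.
    rewrite -sum1_card big_distrr/= [LHS]big_mkcond [RHS]big_mkcond/=; apply: eq_bigr => j _.
    rewrite inE; case: (j \in rows S K); case: (l j < +oo)%E; rewrite ?andbF// ?andbT ?muln1//.
  rewrite natr_sum; apply: le_trans (ler_sum _ (fun j => perj j)) _.
  rewrite -mulr_sumr ler_wpM2l//; apply: le_trans (sum_at_least U).
  rewrite -natr_sum ler_nat exchange_big/=; apply: leq_sum => u _.
  rewrite /at_least -sum1_card big_mkcond [leqRHS]big_mkcond/=; apply: leq_sum => j _.
  by rewrite inE; case: (l j < +oo)%E; case: (_ <= _)%R.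
have sz := sum_size_members x so l_gt0 rho_gt0 lambda_gt1.
have W : (\sum_(K <- nodes) #|rows S K| <= \sum_(K <- nodes) (l K.1 < +oo)%E * #|finite_rows K| + N)%N.
  rewrite -[X in (_ <= _ + X)%N]sz -big_split/= big_seq [leqRHS]big_seq; apply: leq_sum => K; exact: card_rows.
apply: (@le_trans _ _ (level_bound * ((2 * m)%:R * N%:R + Clam * N%:R) + N%:R)).
  apply: le_trans (lerD total (lexx _)); rewrite -natrD ler_nat; exact: W.
rewrite natrD -mulrDl mulrA -{2}[N%:R]mul1r -mulrDl ler_wpM2r//.
rewrite mulrDl mul1r lerD ?le_max ?lexx// -mulrA ler_wpM2l//.
set M := Num.max _ _.
have M1 : 1 <= M by rewrite le_max lexx.
have MC : Clam <= M by rewrite le_max lexx orbT.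
by rewrite mulrDl mul1r lerD// ler_peMr.
Qed.
End LevelCounting.

(** * Complexity *)

Lemma exists_first N (prec : rel 'I_N) : strict_total_order prec -> (0 < N)%N ->
  exists i1, forall i, i != i1 -> prec i1 i.
Proof.
move=> so N0; have [_ _ tot] := so.
pose i0 := Ordinal N0.
exists [arg min_(i < i0) prec_rank prec i]%N; case: arg_minnP => // i1 _ min i ne.
have /orP[//|/(prec_rank_lt so)] : prec i1 i || prec i i1 by apply: tot; rewrite eq_sym.
by rewrite ltnNge min.
Qed.

Lemma powR_natM (R : realType) (a b : R) (n : nat) : a `^ (n%:R * b) = (a `^ b) ^+ n.
Proof. by rewrite mulrC powRrM powR_mulrn// powR_ge0. Qed.

Unset Implicit Arguments.

Theorem theoremB5 (R : realType) (Cd dt r lambda : R) (cmax : nat)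
    (r_gt0 : 0 < r) (r_le1 : r <= 1) (lambda_gt1 : 1 < lambda) :
  exists C : R, forall (d N : nat) (x : 'I_N -> 'rV[R]_d)
    (Omega : set 'rV[R]_d) (G : 'rV[R]_d -> 'rV[R]_d -> R)
    (cost : 'I_N -> 'I_N -> nat) (prec : rel 'I_N) (l : 'I_N -> \bar R)
    (rho : R),
  open Omega -> (forall i, Omega (x i)) ->
  intrinsic_dimension x dt Cd ->
  positive_definite (kernel_mx G x) ->
  (forall i j, (cost i j <= cmax)%N) ->
  strict_total_order prec ->
  reverse_maximin r prec x (frontier Omega) l ->
  0 < rho ->
  (let S := pattern prec x l rho in
   let p := non_aggregated prec S in
   [/\ computes_KL_factor prec S G x p,
       (space_cost p)%:R <= C * N%:R * Num.max 1 rho `^ dt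
     & (time_cost cost p)%:R <= C * N%:R * Num.max 1 rho `^ (3 * dt)]) /\
  (forall Clam : R, regular_refinement prec l lambda Clam ->
   forall S : {set 'I_N * 'I_N},
   S = pattern_tilde prec x l rho lambda \/
   S = pattern_bar prec x l rho lambda ->
   let p := aggregated prec (supernodes prec x l rho lambda) S in
   [/\ computes_KL_factor prec S G x p,
       (space_cost p)%:R <= C * N%:R * Num.max 1 rho `^ dt
     & (time_cost cost p)%:R
         <= Num.max 1 Clam * C * N%:R * Num.max 1 rho `^ (2 * dt)]).
Proof.
have [m r_pow] := exists_pow_ge r_gt0 lambda_gt1.
(* Absolute values because Cd may be negative when N = 0. *)
pose B : R := `|Cd * ((1 + lambda) / r) `^ dt|.
pose B' : R := `|level_bound Cd dt lambda|.
pose c : R := (cmax + 16)%:R.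
pose C1 : R := 4 * B; pose C2 : R := c * B ^+ 3.
pose C3 : R := c * B ^+ 2 * (B' * (2 * m + 1)%:R + 1).
have B0 : 0 <= B by exact: normr_ge0.
have c0 : 0 <= c by [].
have C1_ge0 : 0 <= C1 by rewrite mulr_ge0.
have C2_ge0 : 0 <= C2 by rewrite mulr_ge0// exprn_ge0.
have C3_ge0 : 0 <= C3.
  by rewrite mulr_ge0 ?mulr_ge0 ?exprn_ge0// addr_ge0// mulr_ge0// normr_ge0.
exists (C1 + C2 + C3) => d N x Omega G cost prec l rho oO xO idim pdT cost_le so maximin rho_gt0.
have l_gt0 j : (0 < l j)%E.
  have [-> _] := maximin j.
  exact: dist_after_gt0 so (pd_kernel_inj pdT) oO (xO j).
set P := Num.max 1 rho `^ dt.
have P0 : 0 <= P by exact: powR_ge0.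
rewrite (powR_natM _ _ 3) (powR_natM _ _ 2) -/P.
pose M := size_bound r Cd dt rho lambda.
have MB : M <= B * P by rewrite /M /size_bound ler_wpM2r// ler_norm.
have M1 : (0 < N)%N -> 1 <= M.
  by move=> N_gt0; exact: (size_bound_ge1 r_gt0 r_le1 rho idim lambda_gt1 (Ordinal N_gt0)).
have space_le p (k : R) : (0 < N)%N -> k <= 4 -> p <= k * N%:R * M -> p <= (C1 + C2 + C3) * N%:R * P.
  move=> N_gt0 k4 /le_trans; apply; apply: (@le_trans _ _ (4 * N%:R * (B * P))).
    apply: (@le_trans _ _ (4 * N%:R * M)); last by rewrite ler_wpM2l.
    by rewrite ler_wpM2r ?ler_wpM2r// (le_trans _ (M1 N_gt0)).
  rewrite (_ : 4 * N%:R * (B * P) = C1 * N%:R * P); last by rewrite /C1; ring.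
  by rewrite !ler_wpM2r// -addrA lerDl addr_ge0.
have lowP := pattern_lower x prec l_gt0 rho_gt0.
split.
  have colM k := pattern_column_card so maximin r_gt0 r_le1 l_gt0 idim rho_gt0 lambda_gt1 k.
  split; first exact: non_aggregated_correct.
  - have [N0|N_gt0] := posnP N.
      subst N; rewrite /non_aggregated (size0nil (size_enum_ord 0)).
      by rewrite /space_cost /= mulr0 mul0r.
    apply: (space_le _ 4) => //.
    exact: (non_aggregated_space prec N_gt0 (M1 N_gt0) lowP.1 colM).
  - have [N0|N_gt0] := posnP N.
      subst N; rewrite /non_aggregated (size0nil (size_enum_ord 0)).
      by rewrite /time_cost /= mulr0 mul0r.
    apply: le_trans (non_aggregated_time prec cost_le (M1 N_gt0) lowP.1 colM) _.
    have M0 : 0 <= M by exact: le_trans (M1 N_gt0).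
    apply: (@le_trans _ _ (c * N%:R * (B * P) ^+ 3)).
      by rewrite ler_wpM2l ?mulr_ge0// lerXn2r// ?nnegrE// mulr_ge0.
    rewrite (_ : c * N%:R * (B * P) ^+ 3 = C2 * N%:R * P ^+ 3); last by rewrite /C2; ring.
    by rewrite !ler_wpM2r ?exprn_ge0// addrAC lerDr addr_ge0.
move=> Clam refine S HS.
have [T [SE Tmem Tdist]] := aggregated_pattern_rows so l_gt0 rho_gt0 lambda_gt1 HS.
have lowS := aggregated_lower so l_gt0 rho_gt0 lambda_gt1 SE Tmem.
have rowsP K i : K \in supernodes prec x l rho lambda -> i \in rows S K -> preceq prec K.1 i /\
  ((edist (x i) (x K.1))%:E <= (rho * (1 + lambda))%:E * l K.1)%E.
  move=> Kn /(rows_T so l_gt0 rho_gt0 lambda_gt1 SE Kn) /andP[Ti Ki].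
  by split=> //; exact: Tdist.
have rowsM K : K \in supernodes prec x l rho lambda -> #|rows S K|%:R <= M.
  move=> Kn; apply: (ball_card so maximin r_gt0 r_le1 l_gt0 idim lambda_gt1 (k := K.1)).
  by move=> i /(rowsP _ _ Kn).
have usz := sum_size_members x so l_gt0 rho_gt0 lambda_gt1.
have umem K : K \in supernodes prec x l rho lambda -> uniq K.2 by exact: members_uniq.
split.
- apply: aggregated_correct => //.
  + exact: nodes_uniq.
  + exact: nodes_cover.
  + by move=> K K' k; apply: nodes_disjoint.
  + by move=> K k Kn kK; apply: (aggregated_column so l_gt0 rho_gt0 lambda_gt1 SE).
- have [N0|N_gt0] := posnP N; first by subst N; rewrite /space_cost /= mulr0 mul0r.
  apply: (space_le _ 3) => //; first by rewrite ler_nat.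
  exact: (aggregated_space prec N_gt0 (M1 N_gt0) usz rowsM).
have [N0|N_gt0] := posnP N; first by subst N; rewrite /time_cost /= mulr0 mul0r.
have [i1 first] := exists_first so N_gt0.
have W := sum_rows so maximin r_gt0 r_le1 l_gt0 idim rho_gt0 lambda_gt1 r_pow rowsP first refine.
apply: le_trans (aggregated_time prec cost_le (M1 N_gt0) lowS.1 umem rowsM W) _.
set k := Num.max 1 Clam.
have k0 : 0 <= k by rewrite le_max ler01.
have M0 : 0 <= M by exact: le_trans (M1 N_gt0).
apply: (@le_trans _ _ (c * (B * P) ^+ 2 * ((B' * (2 * m + 1)%:R + 1) * k * N%:R))).
  apply: (@le_trans _ _ (c * M ^+ 2 * ((B' * (2 * m + 1)%:R + 1) * k * N%:R))).
    apply: ler_wpM2l; first by rewrite mulr_ge0 ?exprn_ge0.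
    do 2 apply: ler_wpM2r => //; rewrite lerD2r.
    by apply: ler_wpM2r => //; exact: ler_norm.
  rewrite ler_wpM2r//.
    by rewrite !mulr_ge0// addr_ge0// mulr_ge0// normr_ge0.
  by rewrite ler_wpM2l// lerXn2r// ?nnegrE// mulr_ge0.
rewrite (_ : c * (B * P) ^+ 2 * _ = k * C3 * N%:R * P ^+ 2); last by rewrite /C3; ring.
by rewrite !ler_wpM2r ?exprn_ge0// ler_wpM2l// lerDr addr_ge0.
Qed.
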